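(* Let $n\geqslant 1$. For any strict partition $\lambda\in\mathcal{D}_n$ the type $C$ double Schubert polynomial $\mathfrak{C}_{\lambda}(X,Y)=\mathfrak{C}_{w_\lambda}(X,Y)$ is equal to $$(-1)^{e(\lambda)+|\lambda'|}\sum_{\alpha}\widetilde{Q}_{\alpha}(X)\sum_{\beta}(-1)^{e(\alpha,\beta)+|\beta|}\,\widetilde{Q}_{(\alpha\cup\beta)'}(Y)\,\det\bigl(e_{\beta_i-\lambda'_j}(Y_{n-\lambda'_j})\bigr)_{1\leqslant i,j\leqslant \ell(\lambda')},$$ where the first sum is over all $\alpha\in\mathcal{D}_n$ and the second is over all $\beta\in\mathcal{D}_n$ with $\beta\supset\lambda'$, $\ell(\beta)=\ell(\lambda')$ and $\alpha\cap\beta=\emptyset$.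
   Context: Partitions. For a partition $\lambda=(\lambda_1\geqslant\lambda_2\geqslant\cdots)$, $|\lambda|$ is the sum of its parts, $\ell(\lambda)$ the number of nonzero parts, and $\lambda_r=0$ for $r>\ell(\lambda)$. $\mu\subset\lambda$ means $\mu_i\leqslant\lambda_i$ for all $i$ (containment of diagrams), while $\cup,\cap,\smallsetminus$ are taken on (multi)sets of parts. A partition is strict if its nonzero parts are distinct; $\rho_n=(n,n-1,\ldots,1)$; $\mathcal{D}_n$ is the set of strict partitions $\lambda\subset\rho_n$ (all parts at most $n$; the empty partition is included). For $\lambda\in\mathcal{D}_n$, $\lambda'=\rho_n\smallsetminus\lambda$ is the strict partition whose parts are the complement of the parts of $\lambda$ in $\{1,\ldots,n\}$. The excess is $e(\lambda)=|\lambda|-\ell(\lambda)(\ell(\lambda)+1)/2$. For $\alpha,\beta\in\mathcal{D}_n$ with $\alpha\cap\beta=\emptyset$, put $m_i(\alpha,\beta)=\#\{j\mid \alpha_i>\beta_j>\alpha_{i+1}\}$ (over parts $\beta_j$ of $\beta$) and $e(\alpha,\beta)=\sum_{i\geqslant1} i\,m_i(\alpha,\beta)$. Variables and $\widetilde Q$-polynomials. $X_k=(x_1,\ldots,x_k)$, $Y_k=(y_1,\ldots,y_k)$, $X=X_n$, $Y=Y_n$, commuting independent variables; $e_i$ is the $i$-th elementary symmetric polynomial ($e_0=1$, $e_i=0$ for $i<0$). Set $\widetilde Q_i(X)=e_i(X)$, $\widetilde Q_{i,j}(X)=\widetilde Q_i(X)\widetilde Q_j(X)+2\sum_{k=1}^j(-1)^k\widetilde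 Q_{i+k}(X)\widetilde Q_{j-k}(X)$, and for $\lambda=(\lambda_1\geqslant\cdots\geqslant\lambda_r\geqslant0)$ with $r$ even (put $\lambda_r=0$ if necessary), $\widetilde Q_\lambda(X)=\mathrm{Pfaffian}[\widetilde Q_{\lambda_i,\lambda_j}(X)]_{1\leqslant i<j\leqslant r}$. Put $\widetilde Q(X,Y)=\sum_{\lambda\in\mathcal{D}_n}\widetilde Q_\lambda(X)\widetilde Q_{\lambda'}(Y)$ and $\Delta(X,Y)=\prod_{i+j\leqslant n}(x_i-y_j)$. Weyl group. $W_n$ is the hyperoctahedral group of signed permutations $w=(w_1,\ldots,w_n)$ of $\{1,\ldots,n\}$ (a bar denotes a negative entry), generated by the simple transpositions $s_i$ ($1\leqslant i\leqslant n-1$), generating $S_n\subset W_n$, and $s_0$, where right multiplication by $s_i$ interchanges the entries in positions $i$ and $i+1$, and $(u_1,u_2,\ldots,u_n)s_0=(\overline{u}_1,u_2,\ldots,u_n)$. The longest element is $w_0=(\overline1,\ldots,\overline n)$. For $\lambda\in\mathcal{D}_n$ with $\ell=\ell(\lambda)$, $k=n-\ell$, the maximal Grassmannian element is $w_\lambda=(\overline{\lambda}_1,\ldots,\overline{\lambda}_\ell,\lambda'_k,\ldots,\lambda'_1)$. Divided differences. $W_n$ acts on $\mathbb{Z}[Y][X]$: $s_i$ interchanges $x_i,x_{i+1}$, and $s_0$ sends $x_1$ to $-x_1$ (the other variables being fixed). $\partial_i(f)=(f-s_if)/(x_i-x_{i+1})$ for $1\leqslant i\leqslant n-1$, $\partial_0(f)=(f-s_0f)/(2x_1)$;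 $\partial'_i=-\partial_i$ for $1\leqslant i\leqslant n-1$, $\partial'_0=\partial_0$; $\partial'_w=\partial'_{a_1}\circ\cdots\circ\partial'_{a_r}$ for any reduced word $w=s_{a_1}\cdots s_{a_r}$. The type $C$ double Schubert polynomials are $$\mathfrak{C}_w(X,Y)=(-1)^{n(n-1)/2}\,\partial'_{w^{-1}w_0}\bigl(\Delta(X,Y)\widetilde Q(X,Y)\bigr),\qquad w\in W_n.$$ *)

(* Defs.v *)
From mathcomp Require Import all_boot all_order all_fingroup all_algebra.
From mathcomp.multinomials Require Import mpoly.
From Stdlib Require Import ClassicalEpsilon.

Set Implicit Arguments.
Unset Strict Implicit.
Unset Printing Implicit Defensive.

Import Order.TTheory GRing.Theory Num.Theory.
Local Open Scope ring_scope.

(** * Partitions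

    A partition is the list of its nonzero parts in decreasing order, so that
    lambda_r is [nth 0 lam r.-1], [size lam] is the length and [sumn lam] the
    weight. *)

Definition strict_partition (lam : seq nat) : bool :=
  sorted gtn lam && (0%N \notin lam).

Definition pcontained (mu lam : seq nat) : bool :=
  [forall i : 'I_(size mu), (nth 0%N mu i <= nth 0%N lam i)%N].

Definition rho (n : nat) : seq nat := rev (iota 1 n).

(* The set D_n, as a duplicate-free list of partitions; see [mem_strictD] and
   [uniq_strictD]. *)
Definition strictD (n : nat) : seq (seq nat) :=
  [seq mask (val m) (rho n) | m <- enum {: n.-tuple bool}].

(* rho_n \ lam; for lam in D_n this is the strict partition lam'. *)
Definition pcompl (n : nat) (lam : seq nat) : seq nat :=
  [seq p <- rho n | p \notin lam].

Definition pcup (alpha beta : seq nat) : seq nat := sort geq (alpha ++ beta).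

Definition pdisjoint (alpha beta : seq nat) : bool :=
  ~~ has (mem alpha) beta.

(* The subtraction is not truncated when lam is strict. *)
Definition excess (lam : seq nat) : nat :=
  (sumn lam - (size lam * (size lam).+1)./2)%N.

(* m_i(alpha,beta) for i >= 1. *)
Definition gapcount (i : nat) (alpha beta : seq nat) : nat :=
  count (fun b => (nth 0 alpha i < b < nth 0 alpha i.-1)%N) beta.

(* The terms with i > size alpha vanish. *)
Definition excess2 (alpha beta : seq nat) : nat :=
  (\sum_(1 <= i < (size alpha).+1) i * gapcount i alpha beta)%N.

Lemma size_rho n : size (rho n) = n.
Proof. by rewrite size_rev size_iota. Qed.

Lemma mem_rho n p : (p \in rho n) = (0 < p <= n)%N.
Proof. by rewrite mem_rev mem_iota add1n ltnS. Qed.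

Lemma sorted_rho n : sorted gtn (rho n).
Proof. by rewrite rev_sorted; exact: iota_ltn_sorted. Qed.

Lemma gtn_trans : transitive gtn.
Proof. by move=> y x z /= xy yz; exact: ltn_trans yz xy. Qed.

Lemma gtn_irr : irreflexive gtn.
Proof. by move=> x /=; rewrite ltnn. Qed.

Lemma uniq_rho n : uniq (rho n).
Proof. by rewrite rev_uniq iota_uniq. Qed.

Lemma nth_rho n i : (nth 0 (rho n) i = n - i)%N.
Proof.
case: (ltnP i n) => lin; last first.
  by rewrite nth_default ?size_rho //; apply/esym/eqP.
rewrite nth_rev size_iota // nth_iota ?ltn_subrL //.
  by rewrite add1n subnSK.
exact: leq_ltn_trans (leq0n i) lin.
Qed.

Lemma mem_strictD n lam :
  (lam \in strictD n) = strict_partition lam && pcontained lam (rho n).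
Proof.
apply/idP/idP.
  case/mapP=> m _ ->; have ss := mask_subseq m (rho n).
  have st : sorted gtn (mask m (rho n)).
    exact: subseq_sorted gtn_trans _ _ ss (sorted_rho n).
  apply/andP; split.
    rewrite /strict_partition st /=; apply/negP => /(mem_subseq ss).
    by rewrite mem_rho.
  apply/forallP => /= -[i ilt] /=; rewrite nth_rho.
  have H j : (j < size (mask m (rho n)))%N ->
             (nth 0 (mask m (rho n)) j + j <= n)%N.
    elim: j => [|j IH] jlt.
      rewrite addn0; have /(mem_subseq ss) : nth 0%N (mask m (rho n)) 0
        \in mask m (rho n) by exact: mem_nth.
      by rewrite mem_rho => /andP[].
    apply: leq_trans (IH (ltnW jlt)); rewrite addnS -addSn leq_add2r.
    exact: (sortedP 0%N st).
  by rewrite leq_subRL ?[(i + _)%N]addnC ?H //; apply: leq_trans (H _ ilt);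
    exact: leq_addl.
case/andP=> /andP[st n0] /forallP /= ct.
have ss : {subset lam <= rho n}.
  move=> p /[dup] pl /(nthP 0%N)[i ilt E]; rewrite mem_rho; apply/andP; split.
    by rewrite lt0n; apply: contraNneq n0 => <-.
  by have := ct (Ordinal ilt); rewrite /= E nth_rho => /leq_trans -> //;
     exact: leq_subr.
have E : lam = [seq p <- rho n | p \in lam].
  apply: (irr_sorted_eq gtn_trans gtn_irr st).
    exact: sorted_filter gtn_trans _ _ (sorted_rho n).
  by move=> p; rewrite mem_filter; case pl: (p \in lam) => //=; rewrite ss.
have sz : size (map (mem lam) (rho n)) == n by rewrite size_map size_rho.
apply/mapP; exists (Tuple sz); first by rewrite mem_enum.
by rewrite [LHS]E filter_mask.
Qed.

Lemma uniq_strictD n : uniq (strictD n).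
Proof.
have H (s : seq bool) (r : seq nat) : size s = size r -> uniq r ->
    s = [seq p \in mask s r | p <- r].
  elim: s r => [|b s IH] [|p r] //= /eqP; rewrite eqSS => /eqP sz /andP[pr u].
  have pm : p \notin mask s r by apply: contra pr => /mem_mask.
  rewrite {1}(IH r sz u); case: b; rewrite /= ?inE ?eqxx ?(negbTE pm) //.
  congr cons; apply/eq_in_map => q qr; rewrite inE.
  by case: eqP qr pr => // -> ->.
rewrite map_inj_uniq ?enum_uniq // => m1 m2 E; apply: val_inj => /=.
rewrite (H (val m1) (rho n)) ?size_tuple ?size_rho ?uniq_rho //.
rewrite (H (val m2) (rho n)) ?size_tuple ?size_rho ?uniq_rho //.
by apply: eq_map => p; rewrite E.
Qed.

(** * Signed permutations

    The signed value ([k], [b]) stands for k+1 when [b] is false and for its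
    negative when [b] is true; a signed permutation is a bijection of signed
    values commuting with negation.  The product of [{perm _}] composes from
    left to right, so the product "u v" of signed permutations viewed as
    functions is [(v * u)%g]. *)

Definition sgnval (n : nat) : finType := ('I_n * bool)%type.

Definition signed_perms (n : nat) : {set {perm (sgnval n)}} :=
  [set w : {perm (sgnval n)} |
    [forall k : 'I_n, w (k, true) == ((w (k, false)).1, ~~ (w (k, false)).2)]].

Definition sgnval_int (n : nat) (v : sgnval n) : int := (-1) ^+ v.2 * (v.1.+1)%:Z.

(* (w_1, ..., w_n), a bar being a minus sign. *)
Definition one_line (n : nat) (w : {perm (sgnval n)}) : seq int :=
  [seq sgnval_int (w (k, false)) | k <- enum 'I_n].

(* The 0-based index i - 1 as an element of 'I_n. *)
Definition opred (n : nat) (i : 'I_n) : 'I_n :=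
  Ordinal (leq_ltn_trans (leq_pred i) (ltn_ord i)).

(* s_i for 0 <= i < n; the 1-based positions i, i + 1 are [opred i], [i]. *)
Definition sgen_fun (n : nat) (i : 'I_n) (v : sgnval n) : sgnval n :=
  if i == 0%N :> nat then (v.1, v.2 (+) (v.1 == i))
  else (tperm (opred i) i v.1, v.2).

Lemma sgen_funK n (i : 'I_n) : involutive (sgen_fun i).
Proof.
move=> [k b]; rewrite /sgen_fun.
by case E: (i == 0%N :> nat) => /=; rewrite ?addbK ?tpermK.
Qed.

Definition sgen (n : nat) (i : 'I_n) : {perm (sgnval n)} :=
  perm (inv_inj (@sgen_funK n i)).

Lemma longest_funK n : involutive (fun v : sgnval n => (v.1, ~~ v.2)).
Proof. by move=> [k b] /=; rewrite negbK. Qed.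

Definition longest (n : nat) : {perm (sgnval n)} :=
  perm (inv_inj (@longest_funK n)).

(* s_{a_1} ... s_{a_r} *)
Fixpoint word_elt (n : nat) (a : seq 'I_n) : {perm (sgnval n)} :=
  if a is i :: a' then (word_elt a' * sgen i)%g else 1%g.

Definition reduced_word (n : nat) (w : {perm (sgnval n)}) (a : seq 'I_n) : Prop :=
  word_elt a = w /\ forall b, word_elt b = w -> (size a <= size b)%N.

(* w^{-1} w_0 *)
Definition colongest (n : nat) (w : {perm (sgnval n)}) : {perm (sgnval n)} :=
  (longest n * w^-1)%g.

(* w_lam is given by its one-line notation; see [wmaxP]. *)
Definition wmax (n : nat) (lam : seq nat) : {perm (sgnval n)} :=
  odflt 1%g [pick w in signed_perms n |
    one_line w == [seq - p%:Z | p <- lam] ++ [seq p%:Z | p <- rev (pcompl n lam)]].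

Lemma signed_permsN n (w : {perm (sgnval n)}) : w \in signed_perms n ->
  forall k b, w (k, ~~ b) = ((w (k, b)).1, ~~ (w (k, b)).2).
Proof.
rewrite inE => /forallP W k b; have /eqP E := W k.
by case: b => //=; rewrite E /= negbK -surjective_pairing.
Qed.

Lemma signed_permsM n (i : 'I_n) w :
  w \in signed_perms n -> (sgen i * w)%g \in signed_perms n.
Proof.
move=> W; rewrite inE; apply/forallP => k; rewrite !permM !permE /sgen_fun /=.
by case: ifP => _; rewrite -(signed_permsN W) ?addNb.
Qed.

Lemma no_descent n (w : {perm (sgnval n)}) : w \in signed_perms n ->
  (forall i : 'I_n,
     if i == 0%N :> nat then (0 <= sgnval_int (w (i, false)))%R
     else (sgnval_int (w (opred i, false)) <= sgnval_int (w (i, false)))%R) ->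
  w = 1%g.
Proof.
move=> W D.
have inj1 k l : (w (k, false)).1 = (w (l, false)).1 -> k = l.
  case Ek : (w (k, false)) => [x b]; case El : (w (l, false)) => [y c] /= xy.
  case: (eqVneq b c) => [bc|bc].
    by have /perm_inj[] : w (k, false) = w (l, false) by rewrite Ek El xy bc.
  have /perm_inj[] // : w (k, false) = w (l, true).
  by rewrite (signed_permsN W l false) Ek El xy; case: (b) (c) bc => [] [].
have pos m (k : 'I_n) : k = m :> nat ->
    (w (k, false)).2 = false /\ (m <= (w (k, false)).1)%N.
  elim: m k => [|m IH] k km.
    split=> //; have := D k; rewrite km /= /sgnval_int.
    by case: (w (k, false)).2; rewrite //= expr1 mulN1r.
  have [p1 p2] := IH (opred k) (congr1 predn km).
  have := D k; rewrite km /= /sgnval_int p1 expr0 mul1r.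
  case E : (w (k, false)).2; first by rewrite expr1 mulN1r.
  rewrite expr0 mul1r lez_nat ltnS => le; split=> //.
  apply: leq_ltn_trans p2 _; rewrite ltn_neqAle le andbT.
  by apply/eqP => /val_inj /inj1 /(congr1 val) /=; rewrite km /= => /eqP;
     rewrite eqn_leq ltnn andbF.
have le (k : 'I_n) : (k <= (w (k, false)).1)%N by case: (pos k k erefl).
have eqk (k : 'I_n) : (w (k, false)).1 = k.
  have [m Em] := ubnP (n - k); elim: m => // m IH in k Em *.
  apply/eqP; rewrite eq_sym -val_eqE /= eqn_leq le /=.
  rewrite leqNgt; apply/negP => lt.
  set l := (w (k, false)).1 in lt.
  have El : (w (l, false)).1 = l.
    apply: IH; rewrite -ltnS; apply: leq_trans Em; rewrite ltnS.
    by apply: ltn_sub2l lt; exact: ltn_ord.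
  by have /inj1 kl := El; move: lt; rewrite kl ltnn.
apply/permP => -[k b]; rewrite perm1.
have E : w (k, false) = (k, false).
  by rewrite [LHS]surjective_pairing eqk; case: (pos k k erefl) => ->.
by case: b => //; rewrite (signed_permsN W k false) E.
Qed.

Lemma word_elt_cat n (a b : seq 'I_n) :
  word_elt (a ++ b) = (word_elt b * word_elt a)%g.
Proof. by elim: a => [|i a IH] /=; rewrite ?mulg1 // IH mulgA. Qed.

Lemma reduced_word_exists n (w : {perm (sgnval n)}) :
  w \in signed_perms n -> exists a, reduced_word w a.
Proof.
move=> W; suff [a Ea] : exists a, word_elt a = w.
  have ex : exists m, [exists t : m.-tuple 'I_n, word_elt t == w].
    by exists (size a); apply/existsP; exists (in_tuple a); rewrite /= Ea.
  case: (ex_minnP ex) => m /existsP[t /eqP Et] min; exists t; split=> // b Eb.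
  rewrite size_tuple; apply: min; apply/existsP; exists (in_tuple b).
  by rewrite /= Eb.
pose M (v : {perm (sgnval n)}) : int :=
  \sum_(k < n) (k.+1)%:Z * sgnval_int (v (k, false)).
pose H := <<[set sgen i | i : 'I_n]>>%G.
pose P v := (v \in signed_perms n) && (v * w^-1 \in H)%g.
have Pw : P w by rewrite /P W mulgV group1.
pose v := [arg max_(u > w | P u) M u]%O.
have [Pv vmax] : P v /\ forall u, P u -> (M u <= M v)%R.
  by rewrite /v; case: Order.TotalTheory.arg_maxP.
have Hi i : sgen i \in H by apply/mem_gen/imset_f.
have {}vmax i : (M (sgen i * v)%g <= M v)%R.
  apply: vmax; case/andP: Pv => V vH.
  by rewrite /P signed_permsM // -mulgA groupM.
case/andP: Pv => V vH.
have v1 : v = 1%g.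
  apply: no_descent => // i; have := vmax i; rewrite /M.
  case: ifP => i0.
    rewrite (bigD1 i) // [X in (_ <= X)%R](bigD1 i) //=.
    rewrite [X in (_ + X <= _)%R](eq_bigr (fun k : 'I_n =>
      (k.+1)%:Z * sgnval_int (v (k, false)))); last first.
      move=> k ki; rewrite permM permE /sgen_fun i0 /=.
      by rewrite (negbTE ki).
    rewrite lerD2r permM permE /sgen_fun i0 /= eqxx.
    rewrite ler_pM2l // -[true]/(~~ false) (signed_permsN V).
    rewrite /sgnval_int /=.
    by case: (v (i, false)) => x [] /=; rewrite ?expr1 ?expr0 ?mulN1r ?mul1r.
  have pi : opred i != i.
    apply/eqP => /(congr1 val) /= E; move: (ltn_predL (val i)).
    by rewrite E ltnn lt0n i0.
  rewrite (bigD1 i) // [X in (_ <= X)%R](bigD1 i) //=.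
  rewrite (bigD1 (opred i)) // [X in (_ <= _ + X)%R](bigD1 (opred i)) //=.
  rewrite [X in (_ + (_ + X) <= _)%R](eq_bigr (fun k : 'I_n =>
      (k.+1)%:Z * sgnval_int (v (k, false)))); last first.
    move=> k /andP[ki kp]; rewrite permM permE /sgen_fun i0 /=.
    by rewrite tpermD // eq_sym.
  rewrite !addrA lerD2r !permM !permE /sgen_fun i0 /= tpermL tpermR.
  have -> : i.-1.+1 = i by rewrite prednK // lt0n i0.
  rewrite -[i.+1]addn1 PoszD !mulrDl !mul1r.
  set a := sgnval_int _; set b := sgnval_int _ => h.
  rewrite -(lerD2l (i%:Z * a + i%:Z * b)) addrAC; apply: le_trans h _.
  by rewrite addrAC [X in X + _ <= _]addrC.
have wH : w \in H by move: vH; rewrite v1 mul1g groupV.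
have /gen_prodgP[m [c cA ->]] := wH.
elim: m c cA => [|m IH] c cA.
  by exists [::]; rewrite big_ord0.
rewrite big_ord_recl.
have [|a <-] := IH (fun k => c (lift ord0 k)) _; first by move=> k; exact: cA.
have /imsetP[i _ ->] := cA ord0.
by exists (a ++ [:: i]); rewrite word_elt_cat /= mul1g.
Qed.

Lemma colongest_signed n (w : {perm (sgnval n)}) :
  w \in signed_perms n -> colongest w \in signed_perms n.
Proof.
move=> W; rewrite inE; apply/forallP => k; apply/eqP; rewrite !permM.
have E v : longest n v = (v.1, ~~ v.2) by rewrite permE.
rewrite !E; apply: (@perm_inj _ w); rewrite permKV (signed_permsN W) -surjective_pairing.
by rewrite permKV.
Qed.

Lemma wmaxP n lam : lam \in strictD n ->
  wmax n lam \in signed_perms n /\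
  one_line (wmax n lam) =
    [seq - p%:Z | p <- lam] ++ [seq p%:Z | p <- rev (pcompl n lam)].
Proof.
rewrite /wmax; set s := _ ++ _ => lamD.
suff [w wW ws] : exists2 w : {perm (sgnval n)}, w \in signed_perms n & one_line w = s.
  by case: pickP => [v /andP[? /eqP ?] //|/(_ w)]; rewrite wW ws eqxx.
have [m _ lamE] := mapP lamD.
have ss : subseq lam (rho n) by rewrite lamE mask_subseq.
have pm : perm_eq (map absz s) (rho n).
  rewrite /s map_cat -!map_comp.
  have -> : map (absz \o (fun p => - p%:Z)) lam = lam.
    by rewrite -[RHS]map_id; apply: eq_map => p /=; rewrite abszN.
  rewrite (map_id (rev _)).
  apply: uniq_perm; rewrite ?uniq_rho //.
    rewrite cat_uniq (subseq_uniq ss) ?uniq_rho // rev_uniq filter_uniq ?uniq_rho //.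
    rewrite andbT; apply/hasPn => p /=; rewrite mem_rev mem_filter.
    by case/andP.
  move=> p; rewrite mem_cat mem_rev mem_filter; case pl: (p \in lam) => //=.
  by rewrite (mem_subseq ss).
have szs : size s = n by rewrite -(size_map absz) (perm_size pm) size_rho.
have rg (k : 'I_n) : (0 < `|nth 0%R s k|%N <= n)%N.
  rewrite -mem_rho -(perm_mem pm) -(nth_map 0%R 0%N absz) ?szs //.
  by rewrite mem_nth // size_map szs.
have lt1 (k : 'I_n) : (`|nth 0%R s k|%N.-1 < n)%N.
  by case/andP: (rg k) => h; apply: leq_trans; rewrite prednK.
pose f (v : sgnval n) : sgnval n :=
  (Ordinal (lt1 v.1), v.2 (+) (nth 0 s v.1 < 0)).
have f_inj : injective f.
  move=> [k b] [l c] [/= E]; suff -> : k = l by move/addIb => ->.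
  have : nth 0%N (map absz s) k = nth 0%N (map absz s) l.
    rewrite !(nth_map 0%R) ?szs //.
    case/andP: (rg k) => hk _; case/andP: (rg l) => hl _.
    by rewrite -(prednK hk) E prednK.
  move/eqP; rewrite nth_uniq ?size_map ?szs ?(perm_uniq pm) ?uniq_rho //.
  by move/eqP/val_inj.
exists (perm f_inj).
  by rewrite inE; apply/forallP => k; rewrite !permE /f /=.
apply: (@eq_from_nth _ 0).
  by rewrite size_map -cardE card_ord szs.
rewrite size_map -cardE card_ord => k kn.
rewrite (nth_map (Ordinal kn)) -?cardE ?card_ord //.
rewrite (nth_ord_enum (Ordinal kn) (Ordinal kn)) permE /sgnval_int /=.
rewrite prednK; last by have := rg (Ordinal kn); case/andP.
by rewrite -intEsign.
Qed.

(** * Symmetric functions of a list of ring elements *)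

Definition elem_sym (R : comNzRingType) (s : seq R) (i : int) : R :=
  if i is Posz k then (mesym (size s) R k).@[tnth (in_tuple s)] else 0.

Definition Qt1 (R : comNzRingType) (s : seq R) (i : nat) : R := elem_sym s i%:Z.

Definition Qt2 (R : comNzRingType) (s : seq R) (i j : nat) : R :=
  Qt1 s i * Qt1 s j +
  2%:R * \sum_(1 <= k < j.+1) (-1) ^+ k * (Qt1 s (i + k) * Qt1 s (j - k)).

Definition ord_evn (m : nat) (k : 'I_m) : 'I_m.*2 :=
  Ordinal (etrans (ltn_double k m) (ltn_ord k)).

Definition ord_odd (m : nat) (k : 'I_m) : 'I_m.*2 :=
  Ordinal (etrans (ltn_Sdouble k m) (ltn_ord k)).

(* The sum over the perfect matchings of the 2m indices; only the entries
   above the diagonal are used. *)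
Definition pfaffian (R : comNzRingType) (m : nat) (A : 'M[R]_(m.*2)) : R :=
  \sum_(s : {perm 'I_m.*2} |
        [forall k : 'I_m, (s (ord_evn k) < s (ord_odd k))%N] &&
        [forall k : 'I_m, forall l : 'I_m,
           (k < l)%N ==> (s (ord_evn k) < s (ord_evn l))%N])
    (-1) ^+ s * \prod_(k < m) A (s (ord_evn k)) (s (ord_odd k)).

(* The index runs up to the least even number >= size lam; [nth 0] supplies the
   additional zero part. *)
Definition Qt (R : comNzRingType) (s : seq R) (lam : seq nat) : R :=
  pfaffian (\matrix_(i < (uphalf (size lam)).*2, j < (uphalf (size lam)).*2)
              Qt2 s (nth 0%N lam i) (nth 0%N lam j)).

(** * The ring Z[Y][X] *)

Notation PolXY n := {mpoly {mpoly int[n]}[n]}.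

Definition xvar (n : nat) (i : 'I_n) : PolXY n := 'X_i.
Definition yvar (n : nat) (j : 'I_n) : PolXY n := ('X_j)%:MP.

Definition Xs (n : nat) : seq (PolXY n) := [seq xvar i | i <- enum 'I_n].
Definition Ys (n : nat) : seq (PolXY n) := [seq yvar j | j <- enum 'I_n].

Definition QtXY (n : nat) : PolXY n :=
  \sum_(lam <- strictD n) Qt (Xs n) lam * Qt (Ys n) (pcompl n lam).

Definition DeltaXY (n : nat) : PolXY n :=
  \prod_(i < n) \prod_(j < n | (i.+1 + j.+1 <= n)%N) (xvar i - yvar j).

(** * Divided differences *)

Definition sact (n : nat) (i : 'I_n) (f : PolXY n) : PolXY n :=
  f \mPo [tuple (if i == 0%N :> nat then (if j == i then - xvar j else xvar j)
                 else xvar (tperm (opred i) i j)) | j < n].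

Definition ddden (n : nat) (i : 'I_n) : PolXY n :=
  if i == 0%N :> nat then 2%:R * xvar i else xvar (opred i) - xvar i.

(* The quotient (f - s_i f) / ddden i, which exists and is unique in Z[Y][X]:
   see [ddE] and [dd_unique]. *)
Definition dd (n : nat) (i : 'I_n) (f : PolXY n) : PolXY n :=
  epsilon (inhabits 0) (fun g => ddden i * g = f - sact i f).

Lemma sact0 n (i : 'I_n) : sact i 0 = 0.
Proof. exact: raddf0. Qed.

Lemma sactD n (i : 'I_n) : {morph sact i : f g / f + g}.
Proof. exact: raddfD. Qed.

Lemma sactM n (i : 'I_n) : {morph sact i : f g / f * g}.
Proof. exact: rmorphM. Qed.

Lemma sact1 n (i : 'I_n) : sact i 1 = 1.
Proof. exact: rmorph1. Qed.

Lemma sactC n (i : 'I_n) c : sact i c%:MP = c%:MP.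
Proof. exact: comp_mpolyC. Qed.

Lemma sactX n (i j : 'I_n) : sact i (xvar j) =
  if i == 0%N :> nat then (if j == i then - xvar j else xvar j)
  else xvar (tperm (opred i) i j).
Proof. by rewrite /sact /xvar comp_mpolyXU -tnth_nth tnth_mktuple. Qed.

Lemma dd_exists n (i : 'I_n) (f : PolXY n) :
  exists g, ddden i * g = f - sact i f.
Proof.
pose P (f : PolXY n) := exists g, ddden i * g = f - sact i f.
have PC c : P c%:MP by exists 0; rewrite sactC subrr mulr0.
have PD f1 f2 : P f1 -> P f2 -> P (f1 + f2).
  by case=> g1 E1 [g2 E2]; exists (g1 + g2); rewrite mulrDr E1 E2 sactD addrACA opprD.
have PM f1 f2 : P f1 -> P f2 -> P (f1 * f2).
  case=> g1 E1 [g2 E2]; exists (g1 * f2 + sact i f1 * g2).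
  by rewrite mulrDr mulrA E1 mulrCA E2 sactM mulrBl mulrBr addrA subrK.
have PX j : P (xvar j).
  rewrite /P sactX /ddden; case: ifP => _.
    case: eqP => [->|_]; last by exists 0; rewrite mulr0 subrr.
    by exists 1; rewrite mulr1 opprK mulr2n mulrDl mul1r.
  case: tpermP => [->|->|_ _]; first by exists 1; rewrite mulr1.
    by exists (-1); rewrite mulrN1 opprB.
  by exists 0; rewrite mulr0 subrr.
suff PF h : P h by exact: (PF f).
rewrite [h]mpolyE.
apply: (big_ind P) => [|h1 h2|m _].
- exact: (PC 0).
- exact: (PD).
rewrite -mul_mpolyC; apply: (PM); first exact: PC.
rewrite mpolyXE_id.
apply: (big_ind P) => [||j _]; [exact: (PC 1) | exact: (PM) |].
elim: (m j) => [|d IH]; first exact: (PC 1).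
rewrite exprS; exact: (PM _ _ (PX j) IH).
Qed.

Lemma ddE n (i : 'I_n) (f : PolXY n) : ddden i * dd i f = f - sact i f.
Proof. exact: (epsilon_spec (inhabits 0) _ (dd_exists i f)). Qed.

Lemma ddden_neq0 n (i : 'I_n) : ddden i != 0.
Proof.
rewrite /ddden; case: ifP => [_|i0].
  apply/eqP => /(congr1 (fun p : PolXY n => p@_U_(i)%MM)) /eqP.
  rewrite mulr_natl mcoeffMn mcoeffXU eqxx mcoeff0 -mpolyC1 -mpolyCMn mpolyC_eq0.
  by [].
apply/eqP => /(congr1 (fun p : PolXY n => p@_U_(i)%MM)) /eqP.
rewrite mcoeffB !mcoeffXU eqxx mcoeff0.
have -> : (opred i == i) = false.
  apply/eqP => /(congr1 val) /= E; move: (ltn_predL (val i)).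
  by rewrite E ltnn lt0n i0.

by rewrite sub0r oppr_eq0 oner_eq0.
Qed.

Lemma dd_unique n (i : 'I_n) (f g : PolXY n) :
  ddden i * g = f - sact i f -> g = dd i f.
Proof. by rewrite -ddE => /(mulfI (ddden_neq0 i)). Qed.

Definition dd' (n : nat) (i : 'I_n) (f : PolXY n) : PolXY n :=
  if i == 0%N :> nat then dd i f else - dd i f.

Definition dd'_word (n : nat) (a : seq 'I_n) (f : PolXY n) : PolXY n :=
  foldr (@dd' n) f a.

(* Some reduced word of w is taken, which exists for every w in W_n by
   [reduced_word_exists]; the operator does not depend on its choice, the dd'_i
   satisfying the braid relations. *)
Definition dd'_perm (n : nat) (w : {perm (sgnval n)}) (f : PolXY n) : PolXY n :=
  dd'_word (epsilon (inhabits [::]) (reduced_word w)) f.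

Definition schubertC (n : nat) (w : {perm (sgnval n)}) : PolXY n :=
  (-1) ^+ (n * n.-1)./2 * dd'_perm (colongest w) (DeltaXY n * QtXY n).

(* Main.v *)
From HB Require Import structures.
Require Import Defs.
From mathcomp Require Import all_boot all_order all_fingroup all_algebra.
From mathcomp.multinomials Require Import mpoly.
From mathcomp Require Import ring zify.
From Stdlib Require Import ClassicalEpsilon.

(** Write T for the composite d'_{n-1} ... d'_1 d'_0 of the signed divided
    differences, Q for the kernel Q~(X,Y) and p_1 < ... < p_k for the parts of
    lambda'.

    The operators d'_i satisfy the braid relations, so any reduced word of
    w_lambda^{-1} w_0 may be used ([matsumoto]).  A convenient one is k copies of
    n-1, ..., 1, 0 followed by the word of an insertion sort: on the one-line
    notation of the inverse, the sort brings the parts of lambda' to the front, and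
    each cycle changes the sign of the first entry and sends it to the end.  Every
    letter raises the length, hence the word is reduced ([colongest_wordP]).

    The insertion letters are all positive and Q is symmetric in X, so they act on
    Delta alone.  Each of them removes a corner box x_i - y_j from the staircase
    Delta, and the product of the x_i - y_j over i <= k, j <= n - p_i remains
    ([foldr_insertion_word], [prod_column_rows]).  In its expansion the coefficient
    of x_1^{n-b_1} ... x_k^{n-b_k} is the product of the
    (-1)^{b_i-p_i} e_{b_i-p_i}(Y_{n-p_i}).

    It remains to evaluate T^k on the products of these monomials by Q.  Since T^k
    annihilates the images of d_1, ..., d_{k-1}, the value is antisymmetric in b
    ([iter_cyc_s]), and the sum over b collapses to one of determinants over the
    strict partitions beta of length k ([antisym_sum]); the determinant vanishes
    unless beta contains lambda' ([det_not_contained]).  For such a beta, with the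
    smallest part first, the exponents fit under the staircase n-1, ..., 1, 0, and
    then T uses up x_1 and renames x_{i+1} to x_i in the rest of the monomial
    ([cyc_shift]).  So everything reduces to one application of T:
    x_1^{n-b} Q~_mu goes to Q~_{mu - b} with a sign given by the position of b in mu,
    and to 0 if b is not a part of mu ([cyc_Qt], [scyc_Qt]).

    The reason for the last fact is that changing the sign of x_1 changes the matrix
    of the Q~_{i,j} by an alternating matrix of rank two, one of whose two vectors
    is the column of the padding zero; the Pfaffian then changes by a single sum
    over the parts ([pfl_perturb], [Qt_cons_opp]).  Hence d_0 Q~_mu is the
    alternating sum of the e_{mu_r - 1}(x_2, ..., x_n) Q~_{mu - mu_r}, and
    d_{n-1} ... d_1 takes x_1^{n-b} e_{c-1}(x_2, ..., x_n) to a sign if b = c and to 0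
    otherwise ([down_X0_elem_sym]).

    Writing mu for the union of alpha and beta in the kernel Q, the positions of the
    parts of beta in mu add up to e(alpha,beta) + k(k-1)/2 ([sum_index_pcup]); the
    remaining signs are compared in [sign_parity].

    All of this is done over an integral domain on which the reflections and divided
    differences of type B act ([typeB_action]), and specialized to Z[Y][X] at the
    end ([PolXY_action]); there the variables are numbered from 0 to N = n - 1. *)

Set Implicit Arguments.
Unset Strict Implicit.
Unset Printing Implicit Defensive.
Import Order.TTheory GRing.Theory Num.Theory.
Local Open Scope ring_scope.

(** * Elementary symmetric functions and Q-tilde polynomials *)

Section ElemSym.
Variable R : idomainType.
Implicit Types (x : R) (s : seq R).

Lemma elem_symN s i : i < 0 -> elem_sym s i = 0.
Proof. by case: i. Qed.

Lemma elem_sym_geq s (k : nat) : (size s < k)%N -> elem_sym s k%:Z = 0.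
Proof. by move=> lt; rewrite /elem_sym mesym_geqnE // meval0. Qed.

Lemma elem_sym_coef s (k : nat) : (k <= size s)%N ->
  elem_sym s k%:Z = (-1) ^+ k * (\prod_(c <- s) ('X - c%:P))`_(size s - k).
Proof.
move=> lek; have lt : (k < (size s).+1)%N by [].
have := mroots_coeff (in_tuple s) (Ordinal lt) => /= ->.
by rewrite mulrA -exprMn mulrNN mulr1 expr1n mul1r.
Qed.

Lemma elem_sym0 s : elem_sym s 0 = 1.
Proof.
rewrite elem_sym_coef // expr0 mul1r subn0.
have := monicP (monic_prod_XsubC s xpredT id); rewrite /lead_coef size_prod_XsubC //.
Qed.

Lemma elem_sym_nil (k : nat) : elem_sym (nil : seq R) k%:Z = (k == 0)%:R.
Proof. by case: k => [|k]; rewrite ?elem_sym0 // elem_sym_geq. Qed.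

Lemma elem_sym_cons x s (i : int) :
  elem_sym (x :: s) i = elem_sym s i + x * elem_sym s (i - 1).
Proof.
case: i => [[|k]|k]; last by rewrite !elem_symN // mulr0 addr0.
  by rewrite !elem_sym0 elem_symN // mulr0 addr0.
have -> : k.+1%:Z - 1 = k%:Z by rewrite -addn1 PoszD addrK.
case: (ltngtP k (size s)) => [lt|gt|eq].
- rewrite !elem_sym_coef //= ?ltnS ?(ltnW lt) //.
  rewrite big_cons mulrBl coefB coefXM coefCM subSS subn_eq0 leqNgt lt /=.
  by rewrite subnS mulrBr exprS mulN1r mulrCA !mulNr mulrN opprK.
- by rewrite !elem_sym_geq ?mulr0 ?addr0 //= ltnW.
- rewrite eq [elem_sym s _.+1%:Z]elem_sym_geq // add0r !elem_sym_coef // subnn /=.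
  rewrite subnn big_cons mulrBl coefB coefXM coefCM /= sub0r exprS mulN1r.
  by rewrite mulrCA !mulNr mulrN opprK.
Qed.

Lemma elem_sym_perm s1 s2 i : perm_eq s1 s2 -> elem_sym s1 i = elem_sym s2 i.
Proof.
move=> E; case: i => // k; have szE := perm_size E.
case: (leqP k (size s1)) => lek; last by rewrite !elem_sym_geq // -szE.
by rewrite !elem_sym_coef -?szE // (perm_big _ E).
Qed.

End ElemSym.

Lemma rmorph_elem_sym (R S : idomainType) (f : {rmorphism R -> S}) (s : seq R) i :
  f (elem_sym s i) = elem_sym [seq f x | x <- s] i.
Proof.
elim: s i => [|x s IH] i; last by rewrite /= !elem_sym_cons rmorphD rmorphM !IH.
case: i => [k|k]; last exact: rmorph0.
by rewrite [RHS]elem_sym_nil (elem_sym_nil R) rmorph_nat.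
Qed.

Lemma rmorph_Qt2 (R S : idomainType) (f : {rmorphism R -> S}) (s : seq R) i j :
  f (Qt2 s i j) = Qt2 [seq f x | x <- s] i j.
Proof.
have E k : f (Qt1 s k) = Qt1 [seq f x | x <- s] k by exact: rmorph_elem_sym.
rewrite /Qt2 rmorphD !rmorphM !E rmorph_nat rmorph_sum; congr (_ + _ * _).
by apply: eq_bigr => k _; rewrite !rmorphM rmorphXn rmorphN1 !E.
Qed.

Lemma rmorph_Qt (R S : idomainType) (f : {rmorphism R -> S}) (s : seq R) lam :
  f (Qt s lam) = Qt [seq f x | x <- s] lam.
Proof.
rewrite /Qt /pfaffian rmorph_sum; apply: eq_bigr => p _.
rewrite rmorphM rmorphXn rmorphN1 rmorph_prod; congr (_ * _).
by apply: eq_bigr => k _; rewrite !mxE rmorph_Qt2.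
Qed.

Lemma Qt2_perm (R : idomainType) (s1 s2 : seq R) i j :
  perm_eq s1 s2 -> Qt2 s1 i j = Qt2 s2 i j.
Proof.
move=> E; have E1 k : Qt1 s1 k = Qt1 s2 k by exact: elem_sym_perm.
by rewrite /Qt2 !E1; congr (_ + _ * _); apply: eq_bigr => k _; rewrite !E1.
Qed.

Lemma Qt_perm (R : idomainType) (s1 s2 : seq R) lam :
  perm_eq s1 s2 -> Qt s1 lam = Qt s2 lam.
Proof.
move=> E; rewrite /Qt /pfaffian; apply: eq_bigr => p _; congr (_ * _).
by apply: eq_bigr => k _; rewrite !mxE (Qt2_perm _ _ E).
Qed.

(** * Expansion of a Pfaffian along its first row *)

Section PfaffianExpansion.
Variable R : comNzRingType.

Lemma lift_permP n (i j : 'I_n.+1) (s : 'S_n.+1) :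
  s i = j -> exists t : 'S_n, s = lift_perm i j t.
Proof.
(* The default value is never taken, see [uK]. *)
move=> sij; pose u k := odflt k (unlift j (s (lift i k))).
have uK k : lift j (u k) = s (lift i k).
  rewrite /u; case: unliftP => [k' ->|] //= /(canRL (permK s)).
  by rewrite -sij permK => /eqP; rewrite eq_sym (negbTE (neq_lift _ _)).
have u_inj : injective u.
  by move=> k l /(congr1 (lift j)); rewrite !uK => /perm_inj/lift_inj.
exists (perm u_inj); apply/permP => k; case: (unliftP i k) => [k'|] ->.
  by rewrite lift_perm_lift permE uK.
by rewrite lift_perm_id.
Qed.

Lemma lift_perm_inj n (i j : 'I_n.+1) : injective (lift_perm i j).
Proof.
move=> s t E; apply/permP => k; apply: (@lift_inj _ j).
by rewrite -!(lift_perm_lift i) E.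
Qed.

(** A permutation is its value [j] at [i] together with a permutation of what is left. *)
Lemma sum_lift_perm n (i : 'I_n.+1) (P : pred 'S_n.+1) (F : 'S_n.+1 -> R) :
  \sum_(s | P s) F s =
  \sum_j \sum_(t | P (lift_perm i j t)) F (lift_perm i j t).
Proof.
rewrite (partition_big (fun s : 'S_n.+1 => s i) predT) //=.
apply: eq_bigr => j _.
rewrite (reindex_omap (lift_perm i j) (fun s => [pick t | lift_perm i j t == s])).
  apply: eq_bigl => t; rewrite lift_perm_id eqxx andbT.
  case: pickP => [t' /eqP/lift_perm_inj->|/(_ t)]; last by rewrite eqxx.
  by rewrite eqxx andbT.
move=> s /andP[_ /eqP/lift_permP[t ->]].
by case: pickP => [t' /eqP/= ->|/(_ t)]; rewrite ?eqxx.
Qed.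

Lemma leq_lift n (j : 'I_n.+1) (a b : 'I_n) : (lift j a < lift j b)%N = (a < b)%N.
Proof. by rewrite /= !ltnNge leq_bump2. Qed.

Definition matching m (s : 'S_(m.*2)) : bool :=
  [forall k : 'I_m, (s (ord_evn k) < s (ord_odd k))%N] &&
  [forall k : 'I_m, forall l : 'I_m,
     (k < l)%N ==> (s (ord_evn k) < s (ord_evn l))%N].

Lemma ord_evn_lift m (k : 'I_m) :
  ord_evn (lift ord0 k) = lift ord0 (lift ord0 (ord_evn k)) :> 'I_(m.*2.+2).
Proof. exact: val_inj. Qed.

Lemma ord_odd_lift m (k : 'I_m) :
  ord_odd (lift ord0 k) = lift ord0 (lift ord0 (ord_odd k)) :> 'I_(m.*2.+2).
Proof. exact: val_inj. Qed.

Lemma ord_evn0 m : ord_evn (ord0 : 'I_m.+1) = ord0 :> 'I_(m.*2.+2).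
Proof. exact: val_inj. Qed.

Lemma ord_odd0 m : ord_odd (ord0 : 'I_m.+1) = lift ord0 ord0 :> 'I_(m.*2.+2).
Proof. exact: val_inj. Qed.

(** Once 0 has been matched with the index that [j] lifts to, what is left is a
    matching of the other indices. *)
Lemma matching_lift m (j : 'I_(m.*2.+1)) (t : 'S_(m.*2)) :
  @matching m.+1 (lift_perm ord0 ord0 (lift_perm ord0 j t)) = matching t.
Proof.
rewrite /matching; congr (_ && _).
  apply/forallP/forallP => H k.
    by have := H (lift ord0 k); rewrite ord_evn_lift ord_odd_lift !lift_perm_lift !leq_lift.
  case: (unliftP ord0 k) => [k'|] ->; rewrite ?ord_evn0 ?ord_odd0.
    by rewrite ord_evn_lift ord_odd_lift !lift_perm_lift !leq_lift.
  by rewrite lift_perm_lift !lift_perm_id.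
apply/forallP/forallP => H k; apply/forallP => l.
  have /forallP/(_ (lift ord0 l)) := H (lift ord0 k).
  by rewrite !ord_evn_lift !lift_perm_lift !leq_lift.
case: (unliftP ord0 k) => [k'|] ->; case: (unliftP ord0 l) => [l'|] -> //.
  have /forallP/(_ l') := H k'.
  by rewrite !ord_evn_lift !lift_perm_lift !leq_lift.
by rewrite ord_evn0 ord_evn_lift !lift_perm_lift !lift_perm_id.
Qed.

(** Pairs are increasing and sorted by their first elements, so 0 opens the first pair. *)
Lemma matching_min m (s : 'S_(m.*2.+2)) : @matching m.+1 s -> s ord0 = ord0.
Proof.
case/andP=> /forallP H1 /forallP H2.
have H k : (s ord0 <= s (@ord_evn m.+1 k))%N.
  case: (unliftP ord0 k) => [k'|] ->; last by rewrite ord_evn0.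
  by have /forallP/(_ (lift ord0 k')) := H2 ord0; rewrite ord_evn0 => /ltnW.
suff H0 x : (s ord0 <= s x)%N.
  by have := H0 (s^-1 ord0)%g; rewrite permKV leqn0 => /eqP E; exact: val_inj.
have xlt : (x./2 < m.+1)%N by rewrite ltn_half_double doubleS.
pose k := Ordinal xlt.
case ox : (odd x).
  have -> : x = @ord_odd m.+1 k.
    by apply: val_inj => /=; rewrite -[LHS]odd_double_half ox.
  exact: leq_trans (H k) (ltnW (H1 k)).
have -> : x = @ord_evn m.+1 k; last exact: H.
by apply: val_inj => /=; rewrite -[LHS]odd_double_half ox.
Qed.

(** The index 0 comes first in every matching; the sum is split according to its
    partner, which is removed together with 0. *)
Lemma pfaffian_row0 m (A : 'M[R]_(m.*2.+2)) :
  @pfaffian R m.+1 A =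
  \sum_(j < m.*2.+1) (-1) ^+ j * A ord0 (lift ord0 j) *
    @pfaffian R m (\matrix_(a, b) A (lift ord0 (lift j a)) (lift ord0 (lift j b))).
Proof.
rewrite /pfaffian (eq_bigl (@matching m.+1)) //.
rewrite (@sum_lift_perm m.*2.+1 ord0) (bigD1 ord0) //= [X in _ + X]big1 ?addr0.
  rewrite (@sum_lift_perm m.*2 ord0); apply: eq_bigr => j _.
  rewrite big_distrr /= (eq_bigl _ _ (matching_lift j)).
  apply: eq_bigr => t _; rewrite big_ord_recl ord_evn0 ord_odd0.
  have -> : (-1) ^+ lift_perm ord0 ord0 (lift_perm ord0 j t) = (-1) ^+ j * (-1) ^+ t :> R.
    by rewrite !odd_lift_perm /= signr_addb signr_odd.
  rewrite lift_perm_id lift_perm_lift lift_perm_id -!mulrA; congr (_ * _).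
  rewrite mulrCA; congr (_ * (_ * _)); apply: eq_bigr => k _.
  by rewrite mxE ord_evn_lift ord_odd_lift !lift_perm_lift.
move=> j j0; rewrite big1 // => t /matching_min; rewrite lift_perm_id => E.
by rewrite E eqxx in j0.
Qed.

End PfaffianExpansion.

Section AlternatingDeletion.
Variable R : comNzRingType.
Implicit Types (phi psi : nat -> R) (G H : seq nat -> R).

(** The alternating sum over the entries [i] of [s] of [phi i] times the value of [G]
    on [s] without [i], see [altdelE]: the contraction of an alternating form by [phi].
    The recursion is the rule for an antiderivation, from which anticommutation
    [altdelC] follows by induction without any index bookkeeping. *)
Fixpoint altdel phi G (s : seq nat) : R :=
  if s is i :: t then phi i * G t - altdel phi (fun t' => G (i :: t')) t else 0.

Lemma eq_altdel phi G H s :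
  (forall t, (size t).+1 = size s -> G t = H t) -> altdel phi G s = altdel phi H s.
Proof.
elim: s G H => //= i t IH G H E; rewrite E //; congr (_ - _).
by apply: IH => t' E'; apply: E; rewrite /= E'.
Qed.

Lemma eq_altdell phi psi G s : (forall i, i \in s -> phi i = psi i) ->
  altdel phi G s = altdel psi G s.
Proof.
elim: s G => //= i t IH G E; rewrite E ?mem_head //; congr (_ - _).
by apply: IH => j jt; apply: E; rewrite inE jt orbT.
Qed.

Lemma altdelD phi G H s :
  altdel phi (fun t => G t + H t) s = altdel phi G s + altdel phi H s.
Proof.
elim: s G H => [|i t IH] G H /=; first by rewrite addr0.
by rewrite (IH (fun t => G (i :: t))) mulrDr opprD addrACA.
Qed.

Lemma altdelZ phi c G s : altdel phi (fun t => c * G t) s = c * altdel phi G s.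
Proof.
elim: s G => [|i t IH] G /=; first by rewrite mulr0.
by rewrite (IH (fun t => G (i :: t))) mulrBr mulrCA.
Qed.

Lemma altdelN phi G s : altdel phi (fun t => - G t) s = - altdel phi G s.
Proof.
rewrite -mulN1r -altdelZ; apply: eq_altdel => t _; by rewrite mulN1r.
Qed.

Lemma altdelB phi G H s :
  altdel phi (fun t => G t - H t) s = altdel phi G s - altdel phi H s.
Proof. by rewrite (altdelD phi G (fun t => - H t)) altdelN. Qed.

Lemma altdelDl phi psi G s :
  altdel (fun i => phi i + psi i) G s = altdel phi G s + altdel psi G s.
Proof.
elim: s G => [|i t IH] G /=; first by rewrite addr0.
by rewrite IH mulrDl opprD addrACA.
Qed.

Lemma altdelZl phi c G s : altdel (fun i => c * phi i) G s = c * altdel phi G s.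
Proof.
elim: s G => [|i t IH] G /=; first by rewrite mulr0.
by rewrite IH mulrBr mulrA.
Qed.

Lemma altdelC phi psi G s :
  altdel phi (altdel psi G) s = - altdel psi (altdel phi G) s.
Proof.
elim: s G => [|i t IH] G /=; first by rewrite oppr0.
rewrite !altdelB !altdelZ (IH (fun t' => G (i :: t'))); ring.
Qed.

Lemma altdel2 phi G s : altdel phi (altdel phi G) s = 0.
Proof.
elim: s G => [|i t IH] G //=.
by rewrite altdelB altdelZ IH subr0 subrr.
Qed.

Lemma altdelE phi G s :
  altdel phi G s =
  \sum_(j < size s) (-1) ^+ j * phi (nth 0%N s j) * G (take j s ++ drop j.+1 s).
Proof.
elim: s G => [|i t IH] G /=; first by rewrite big_ord0.
rewrite big_ord_recl /= expr0 mul1r ?take0 ?drop0 IH -sumrN; congr (_ + _).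
by apply: eq_bigr => j _; rewrite /bump /= add1n exprS mulN1r !mulNr.
Qed.

End AlternatingDeletion.

(** * Pfaffians indexed by lists and their rank two perturbations *)

Section PfaffianOfList.
Variable R : comNzRingType.
Implicit Types F : nat -> nat -> R.

(** The number of pairs is a parameter, so that the first row expansion may lower it by
    one whatever the parity of the length; [nth] supplies the padding zero. *)
Definition pfl_pad F (s : seq nat) m : R :=
  @pfaffian R m (\matrix_(i, j) F (nth 0%N s i) (nth 0%N s j)).

Definition pfl F (s : seq nat) : R := pfl_pad F s (uphalf (size s)).

Lemma pfl_pad_cons F i (t : seq nat) m : (m.*2 <= size t)%N ->
  pfl_pad F (i :: t) m.+1 = \sum_(j < m.*2.+1)
    (-1) ^+ j * F i (nth 0%N t j) * pfl_pad F (take j t ++ drop j.+1 t) m.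
Proof.
move=> lemt; rewrite /pfl_pad pfaffian_row0; apply: eq_bigr => j _.
have jt : (j <= size t)%N by apply: leq_trans lemt; rewrite -ltnS.
rewrite mxE; congr (_ * _); congr pfaffian; apply/matrixP => a b; rewrite !mxE.
suff H c : nth 0%N (i :: t) (bump 0 (bump j c)) = nth 0%N (take j t ++ drop j.+1 t) c.
  by congr (F _ _); exact: H.
rewrite /bump /= nth_cat size_takel // nth_drop.
case: (leqP j c) => jc; last by rewrite nth_take.
by rewrite addSn subnKC.
Qed.

Lemma pfl_nil F : pfl F [::] = 1.
Proof.
rewrite /pfl /pfl_pad /pfaffian (bigD1 1%g) /=; last first.
  by apply/andP; split; apply/forallP => -[].
rewrite odd_perm1 expr0 big_ord0 mulr1 big1 ?addr0 // => s /andP[_ /eqP[]].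
by apply/permP => -[].
Qed.

(** When [t] has even length, the list [i :: t] is completed by a zero, which is one
    more possible partner of [i]. *)
Lemma pfl_cons F i t :
  pfl F (i :: t) = (if odd (size t) then 0 else F i 0%N * pfl F t) + altdel (F i) (pfl F) t.
Proof.
rewrite altdelE /pfl /=; have := odd_double_half (size t).
set m := (size t)./2; case: ifP => ot; rewrite ?add1n ?add0n => szt.
  rewrite pfl_pad_cons; last by rewrite -szt.
  rewrite add0r -/m -szt; apply: eq_bigr => j _; congr (_ * pfl_pad _ _ _).
  have jt : (j < size t)%N by rewrite -szt.
  rewrite size_cat size_takel ?(ltnW jt) // size_drop subnS -subn1.
  by rewrite addnBA ?subn_gt0 // subnKC ?(ltnW jt) // -szt subn1 /= uphalf_double.
rewrite pfl_pad_cons -/m -szt // big_ord_recr /= addrC.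
have les : (size t <= m.*2)%N by rewrite szt.
rewrite nth_default // -signr_odd odd_double expr0 mul1r.
rewrite take_oversize // drop_oversize ?(leqW les) // cats0 uphalf_double.
congr (_ + _); apply: eq_bigr => j _; congr (_ * pfl_pad _ _ _).
have jt : (j < size t)%N by rewrite -szt.
rewrite size_cat size_takel ?(ltnW jt) // size_drop subnS -subn1.
rewrite addnBA ?subn_gt0 // subnKC ?(ltnW jt) // -szt subn1.
by case: (m) => // k; rewrite doubleS /= half_double.
Qed.

Lemma altdel0 (phi : nat -> R) G s :
  (forall t, (size t).+1 = size s -> G t = 0) -> altdel phi G s = 0.
Proof.
move=> H; rewrite (@eq_altdel _ phi G (fun _ => 0 * 0)) ?altdelZ ?mul0r //.
Qed.

(** For odd length this is the expansion of the Pfaffian along the column of the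
    padding zero.  For even length the sum is the same expansion for the alternating
    matrix in which the zero is repeated, and this matrix has two equal columns. *)
Lemma altdel_col0 F t :
  altdel (F^~ 0%N) (pfl F) t = if odd (size t) then pfl F t else 0.
Proof.
have [m] := ubnP (size t); elim: m t => // m IH [|i t] //= szt.
set Q := F^~ 0%N; rewrite -/(Q i).
rewrite (@eq_altdel R _ _ (fun t' => (if odd (size t) then Q i * pfl F t' else 0)
  + altdel (F i) (pfl F) t')); last first.
  by move=> t' E; rewrite pfl_cons -E /=; case: odd.
(* By anticommutation the column may be contracted inside the expansion along the row
   of [i], where the induction hypothesis applies. *)
rewrite altdelD (altdelC Q).
rewrite (@eq_altdel R (F i) _ (fun t' => if odd (size t) then 0 else pfl F t'));
  last first.
  move=> t' E; rewrite IH; first by rewrite -E /=; case: odd.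
  by rewrite E -ltnS ltnW.
rewrite pfl_cons; case ot: (odd (size t)) => /=.
  rewrite altdelZ (IH t) // ot [altdel (F i) _ _]altdel0 //; ring.
rewrite [altdel Q _ _]altdel0 // -/(Q i); ring.
Qed.

(** The matrices differ by an alternating matrix of rank two, so the Pfaffian is affine
    in [y] and the coefficient is a double contraction, by [u] and by the column of
    the padding zero; [altdel_col0] turns the second one into the Pfaffian itself. *)
Lemma pfl_perturb F F' (u : nat -> R) (y : R) s :
  u 0%N = 0 -> F 0%N 0%N = 1 ->
  (forall i j, F' i j = F i j - y * (u i * F j 0%N - F i 0%N * u j)) ->
  pfl F s - pfl F' s = y * altdel u (pfl F) s.
Proof.
move=> u0 F00 FE; set Q := F^~ 0%N.
have [m] := ubnP (size s); elim: m s => // m IH [|i t] /= szt.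
  by rewrite !pfl_nil subrr mulr0.
have IH' t' : ((size t').+1 = size t \/ t' = t) ->
    pfl F' t' = pfl F t' - y * altdel u (pfl F) t'.
  move=> H; rewrite -IH; first by rewrite opprB addrC subrK.
  by case: H => [E|->] //; rewrite E -ltnS ltnW.
rewrite (pfl_cons F') (pfl_cons F).
rewrite (@eq_altdel R _ (pfl F') (fun t' => pfl F t' - y * altdel u (pfl F) t'));
  last by move=> t' E; apply: IH'; left.
rewrite (@eq_altdell R (F' i) (fun j => F i j + ((- (y * u i)) * Q j + y * Q i * u j)));
  last by move=> j _; rewrite FE /Q; ring.
(* The contraction of the same vector twice vanishes, and the one by the column of the
   padding zero is known. *)
rewrite !altdelDl !altdelZl !altdelB !altdelZ altdel2 altdel_col0.
rewrite (altdelC Q) FE u0 F00 (IH' t); last by right.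
rewrite (@eq_altdel R u (altdel Q _)
   (fun t' => if odd (size t) then 0 else pfl F t')); last first.
  by move=> t' E; rewrite altdel_col0 -E /=; case: odd.
rewrite (@eq_altdel R _ (fun t' => pfl F (i :: t'))
  (fun t' => (if odd (size t) then Q i * pfl F t' else 0)
                  + altdel (F i) (pfl F) t')); last first.
  by move=> t' E; rewrite pfl_cons -E /=; case: odd.
rewrite altdelD (altdelC (F i)) -/(Q i).
case: odd.
  by rewrite altdelZ [altdel u (fun=> 0) _]altdel0 //; ring.
by rewrite [altdel u (fun=> 0) _]altdel0 //; ring.
Qed.

End PfaffianOfList.

Lemma QtE (R : comNzRingType) (s : seq R) lam : Qt s lam = pfl (Qt2 s) lam.
Proof. by []. Qed.

Lemma Qt2_col0 (R : idomainType) (s : seq R) i : Qt2 s i 0 = elem_sym s i.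
Proof. by rewrite /Qt2 /Qt1 big_geq // elem_sym0 mulr1 mulr0 addr0. Qed.

Section Qt2Shift.
Variable R : idomainType.
Variable s : seq R.
Implicit Type x : R.

Local Notation e i := (elem_sym s i).

(** The sums contribute to the coefficient of [x] a telescoping sum, which leaves the
    two products displayed; only this coefficient changes sign with [x]. *)
Lemma Qt2_cons x i j :
  Qt2 (x :: s) i j = Qt2 s i j
    + x * (e (i%:Z - 1) * e j%:Z - e i%:Z * e (j%:Z - 1))
    + x ^+ 2 * (e (i%:Z - 1) * e (j%:Z - 1) + 2%:R * \sum_(1 <= k < j.+1) (-1) ^+ k *
        (e ((i + k)%:Z - 1) * e ((j - k)%N%:Z - 1))).
Proof.
rewrite /Qt2 /Qt1 !elem_sym_cons.
under eq_big_nat => k _ do rewrite !elem_sym_cons.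
have tele : \sum_(1 <= k < j.+1) (-1) ^+ k * (e (i + k)%N%:Z * e ((j - k)%N%:Z - 1)
     + e ((i + k)%N%:Z - 1) * e (j - k)%N%:Z) = - (e i%:Z * e (j%:Z - 1)) :> R.
  (* The summand is f(k) - f(k-1). *)
  pose f k := (-1) ^+ k * (e (i + k)%N%:Z * e ((j - k)%N%:Z - 1)).
  have Hf : forall k, (1 <= k < j.+1)%N -> (-1) ^+ k * (e (i + k)%N%:Z * e ((j - k)%N%:Z - 1)
     + e ((i + k)%N%:Z - 1) * e (j - k)%N%:Z) = f k - f k.-1.
    case=> // k /andP[_]; rewrite ltnS => kj; rewrite /f /= exprS addnS.
    have -> : (i + k).+1%:Z - 1 = (i + k)%N%:Z by rewrite -addn1 PoszD addrK.
    have -> : (j - k)%N%:Z - 1 = (j - k.+1)%N%:Z.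
      by rewrite -(subnSK kj) -addn1 PoszD addrK.
    ring.
  rewrite (eq_big_nat _ _ Hf) big_add1 /= big_mkord.
  under eq_bigr do rewrite -[_ - _]opprB.
  rewrite sumrN; have -> : \sum_(k < j) (f k - f k.+1) = f 0%N - f j.
    elim: (j) => [|m IH]; first by rewrite big_ord0 subrr.
    by rewrite big_ord_recr /= IH addrA subrK.
  by rewrite /f addn0 !subn0 subnn expr0 mul1r (@elem_symN _ s (0%N%:Z - 1)) // !mulr0 subr0.
under eq_big_nat => k _.
  rewrite (_ : _ * _ = (-1) ^+ k * (e (i + k)%N%:Z * e (j - k)%N%:Z) +
    (x * ((-1) ^+ k * (e (i + k)%N%:Z * e ((j - k)%N%:Z - 1)
     + e ((i + k)%N%:Z - 1) * e (j - k)%N%:Z)) +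
     x ^+ 2 * ((-1) ^+ k * (e ((i + k)%:Z - 1) * e ((j - k)%N%:Z - 1))))); last by ring.
  over.
rewrite !big_split /= -!big_distrr /= tele; ring.
Qed.

Lemma Qt2_cons_opp x i j :
  Qt2 (- x :: s) i j = Qt2 (x :: s) i j - 2%:R * x *
    (e (i%:Z - 1) * Qt2 (x :: s) j 0 - Qt2 (x :: s) i 0 * e (j%:Z - 1)).
Proof.
rewrite !Qt2_col0 (Qt2_cons (- x)) (Qt2_cons x) !elem_sym_cons; set S := \sum_(_ <= _ < _) _.
move: S => S; ring.
Qed.

End Qt2Shift.

Lemma Qt_cons_opp (R : idomainType) (x : R) s lam :
  Qt (x :: s) lam - Qt (- x :: s) lam =
  2%:R * x * altdel (fun i => elem_sym s (i%:Z - 1)) (Qt (x :: s)) lam.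
Proof.
rewrite !QtE (@pfl_perturb _ _ _ (fun i => elem_sym s (i%:Z - 1)) (2%:R * x)) //.
- by rewrite Qt2_col0 elem_sym0.
- by move=> i j; rewrite Qt2_cons_opp.
Qed.

(** * Braid relations between abstract divided differences *)

Section AbstractBraid.
Variables (R : idomainType) (s t : {rmorphism R -> R}) (d e : R -> R).

Lemma braid2 (a b : R) f : a != 0 -> b != 0 ->
  (forall f, a * d f = f - s f) -> (forall f, b * e f = f - t f) ->
  s b = b -> t a = a -> (forall f, s (t f) = t (s f)) -> d (e f) = e (d f).
Proof.
move=> a0 b0 dE eE sb ta st; apply: (mulfI a0); apply: (mulfI b0).
have -> : b * (a * d (e f)) = b * e f - s (b * e f).
  by rewrite dE rmorphM sb mulrBr.
rewrite mulrCA; have -> : a * (b * e (d f)) = a * d f - t (a * d f).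
  by rewrite eE rmorphM ta mulrBr.
by rewrite eE dE !rmorphB st /=; ring.
Qed.

Lemma divided_difference_fixed (a : R) f : a != 0 -> s a = - a -> (forall f, s (s f) = f) ->
  (forall f, a * d f = f - s f) -> s (d f) = d f.
Proof.
move=> a0 sa ss dE; apply: (mulfI a0); rewrite dE.
by rewrite -[a]opprK -sa mulNr -rmorphM dE rmorphB ss /= opprB.
Qed.

End AbstractBraid.

Section AbstractBraid3.
Variables (R : idomainType) (s t : {rmorphism R -> R}) (d e : R -> R) (a b : R).
Hypotheses (a0 : a != 0) (dE : forall f, a * d f = f - s f)
  (eE : forall f, b * e f = f - t f).

(** Multiplied by the product of the positive roots, the composite is the alternating
    sum over the group of order six, in which the two reflections play symmetric
    roles. *)
Lemma braid3_expand f : s a = - a -> s b = a + b -> t a = a + b ->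
  (forall f, s (s f) = f) ->
  a * b * (a + b) * d (e (d f)) =
  f - s f - t f + s (t f) + t (s f) - s (t (s f)).
Proof.
move=> sa sb ta ss; set g := d f; set h := e g.
have sg : s g = g by exact: divided_difference_fixed a0 sa ss dE.
have Eh : b * h = g - t g by exact: eE.
have Eg : a * g = f - s f by exact: dE.
have Esh : (a + b) * s h = g - s (t g) by rewrite -sb -rmorphM Eh rmorphB sg.
have Etg : (a + b) * t g = t f - t (s f) by rewrite -ta -rmorphM Eg rmorphB.
have Estg : b * s (t g) = s (t f) - s (t (s f)).
  by rewrite -!rmorphB -Eg !rmorphM ta rmorphD sa sb; ring.
have -> : a * b * (a + b) * d h = (a + b) * (b * h) - b * ((a + b) * s h).
  rewrite [LHS](_ : _ = b * (a + b) * (a * d h)); last by ring.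
    by rewrite dE; ring.
rewrite Eh Esh; transitivity (a * g - (a + b) * t g + b * s (t g)); first by ring.
by rewrite Eg Etg Estg; ring.
Qed.

End AbstractBraid3.

Lemma braid3 (R : idomainType) (s t : {rmorphism R -> R}) (d e : R -> R) (a b : R) f :
  a != 0 -> b != 0 -> a + b != 0 ->
  (forall f, a * d f = f - s f) -> (forall f, b * e f = f - t f) ->
  s a = - a -> t b = - b -> s b = a + b -> t a = a + b ->
  (forall f, s (s f) = f) -> (forall f, t (t f) = f) ->
  (forall f, s (t (s f)) = t (s (t f))) ->
  d (e (d f)) = e (d (e f)).
Proof.
move=> a0 b0 ab0 dE eE sa tb sb ta ss tt br.
apply: (mulfI (mulf_neq0 (mulf_neq0 a0 b0) ab0)).
rewrite (braid3_expand a0 dE eE f sa sb ta ss).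
have ba : b + a = a + b by rewrite addrC.
have := braid3_expand b0 eE dE f tb; rewrite ba => /(_ ta sb tt).
rewrite [b * a]mulrC => ->; rewrite br; ring.
Qed.

(** Both sides, multiplied by the product of the positive roots, are up to sign the
    alternating sum over the dihedral group of order eight. *)
Lemma braid4 (R : idomainType) (s t : {rmorphism R -> R}) (d e : R -> R) (x y : R) f :
  2%:R * x != 0 -> 2%:R * y != 0 -> x - y != 0 -> x + y != 0 ->
  (forall f, 2%:R * x * d f = f - s f) -> (forall f, (x - y) * e f = f - t f) ->
  s x = - x -> s y = y -> t x = y -> t y = x ->
  (forall f, s (s f) = f) -> (forall f, t (t f) = f) ->
  (forall f, s (t (s (t f))) = t (s (t (s f)))) ->
  d (e (d (e f))) = e (d (e (d f))).
Proof.
move=> x0 y0 xy0 xy1 dE eE sx sy tx ty ss tt br.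
have sa : s (2%:R * x) = - (2%:R * x) by rewrite rmorphM rmorph_nat sx mulrN.
have tb : t (x - y) = - (x - y) by rewrite rmorphB tx ty opprB.
have D0 := mulf_neq0 (mulf_neq0 (mulf_neq0 x0 y0) xy0) xy1.
have sd g : s (d g) = d g by exact: divided_difference_fixed x0 sa ss dE.
have te g : t (e g) = e g by exact: divided_difference_fixed xy0 tb tt eE.
apply: (mulfI D0).
transitivity (- f + t f + s f - s (t f) - t (s f) + t (s (t f)) + s (t (s f))
  - s (t (s (t f)))).
  set g := e f; set h := d g; set k := e h.
  have Eg : (x - y) * g = f - t f by exact: eE.
  have Eh : 2%:R * x * h = g - s g by exact: dE.
  have Ek : (x - y) * k = h - t h by exact: eE.
  have sh : s h = h by exact: sd.
  have tg : t g = g by exact: te.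
  have Esk : - (x + y) * s k = h - s (t h).
    by rewrite -{1}sh -!rmorphB -Ek rmorphM rmorphB sx sy; ring.
  have Eth : 2%:R * y * t h = g - t (s g).
    by rewrite -{1}tg -rmorphB -Eh !rmorphM tx rmorph_nat.
  have Esth : 2%:R * y * s (t h) = s g - s (t (s g)).
    by rewrite -rmorphB -Eth !rmorphM rmorph_nat sy.
  have Esg : - (x + y) * s g = s f - s (t f).
    by rewrite -rmorphB -Eg rmorphM rmorphB sx sy; ring.
  have Etsg : - (x + y) * t (s g) = t (s f) - t (s (t f)).
    by rewrite -rmorphB -Esg rmorphM rmorphN rmorphD tx ty; ring.
  have Estsg : (x - y) * s (t (s g)) = s (t (s f)) - s (t (s (t f))).
    by rewrite -rmorphB -Etsg rmorphM rmorphN rmorphD sx sy; ring.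
  transitivity (2%:R * y * ((x + y) * ((x - y) * k) + (x - y) * (- (x + y) * s k))).
    rewrite [LHS](_ : _ = 2%:R * y * (x - y) * (x + y) * (2%:R * x * d k)); last by ring.
    by rewrite dE; ring.
  rewrite Ek Esk.
  transitivity (2%:R * y * (2%:R * x * h) - (x + y) * (2%:R * y * t h)
    - (x - y) * (2%:R * y * s (t h))); first by ring.
  rewrite Eh Eth Esth.
  transitivity (- ((x - y) * g) + (- (x + y) * s g) - (- (x + y) * t (s g))
    + (x - y) * s (t (s g))); first by ring.
  by rewrite Eg Esg Etsg Estsg; ring.
rewrite br; symmetry.
set g := d f; set h := e g; set k := d h.
have Eg : 2%:R * x * g = f - s f by exact: dE.
have Eh : (x - y) * h = g - t g by exact: eE.
have Ek : 2%:R * x * k = h - s h by exact: dE.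
have sg : s g = g by exact: sd.
have th : t h = h by exact: te.
have Etk : 2%:R * y * t k = h - t (s h).
  by rewrite -{1}th -rmorphB -Ek !rmorphM tx rmorph_nat.
have Esh : - (x + y) * s h = g - s (t g).
  by rewrite -{1}sg -rmorphB -Eh rmorphM rmorphB sx sy; ring.
have Etsh : - (x + y) * t (s h) = t g - t (s (t g)).
  by rewrite -rmorphB -Esh rmorphM rmorphN rmorphD tx ty; ring.
have Etg : 2%:R * y * t g = t f - t (s f).
  by rewrite -rmorphB -Eg !rmorphM tx rmorph_nat.
have Estg : 2%:R * y * s (t g) = s (t f) - s (t (s f)).
  by rewrite -rmorphB -Etg !rmorphM sy rmorph_nat.
have Etstg : 2%:R * x * t (s (t g)) = t (s (t f)) - t (s (t (s f))).
  by rewrite -rmorphB -Estg !rmorphM ty rmorph_nat.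
transitivity ((x + y) * (2%:R * y * (2%:R * x * k) - 2%:R * x * (2%:R * y * t k))).
  rewrite [LHS](_ : _ = 2%:R * x * (2%:R * y) * (x + y) * ((x - y) * e k)); last by ring.
    by rewrite eE; ring.
rewrite Ek Etk.
transitivity (- 2%:R * (x + y) * ((x - y) * h) + 2%:R * y * (- (x + y) * s h)
   - 2%:R * x * (- (x + y) * t (s h))); first by ring.
rewrite Eh Esh Etsh.
transitivity (- (2%:R * x * g) + 2%:R * y * t g - 2%:R * y * s (t g)
   + 2%:R * x * t (s (t g))); first by ring.
by rewrite Eg Etg Estg Etstg; ring.
Qed.

(** * Reduced words of signed permutations *)

(** The simple reflections with these indices commute. *)
Definition far (k l : nat) : bool := ((k.+1 < l) || (l.+1 < k))%N.

Fixpoint swap_at (i : nat) (U : seq int) : seq int :=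
  match i, U with
  | 0, x :: y :: t => y :: x :: t
  | j.+1, x :: t => x :: swap_at j t
  | _, _ => U
  end.

Definition letter_act (i : nat) (U : seq int) : seq int :=
  if i is j.+1 then swap_at j U else if U is x :: t then - x :: t else [::].

Definition word_act (a : seq nat) (U : seq int) : seq int := foldr letter_act U a.

(** The length of a signed permutation: inversions, negative entries and pairs of
    entries with a negative sum. *)
Fixpoint inv_count (U : seq int) : nat :=
  if U is x :: t then
    ((x < 0)%R + \sum_(y <- t) ((y < x)%R + (x + y < 0)%R) + inv_count t)%N
  else 0%N.

Definition descent (i : nat) (U : seq int) : bool :=
  if i is j.+1 then nth 0 U i < nth 0 U j else nth 0 U 0 < 0.

Lemma swap_atK i : involutive (swap_at i).
Proof. by elim: i => [|i IH] [|x [|y t]] //=; rewrite ?IH //; case: i {IH}. Qed.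

Lemma letter_actK i : involutive (letter_act i).
Proof. by case: i => [|i]; [case=> //= x t; rewrite opprK|exact: swap_atK]. Qed.

Lemma perm_swap_at i U : perm_eq (swap_at i U) U.
Proof.
elim: i U => [|i IH] [|x t] //=; last by rewrite perm_cons.
case: t => // y t.
by rewrite -[y :: x :: t]/([:: y] ++ [:: x] ++ t) perm_catCA.
Qed.

Lemma size_letter_act i U : size (letter_act i U) = size U.
Proof. by case: i => [|i] /=; [case: U|rewrite (perm_size (perm_swap_at i U))]. Qed.

Lemma nth_swap_at i U k : (i.+1 < size U)%N ->
  nth 0 (swap_at i U) k = nth 0 U (if k == i then i.+1 else if k == i.+1 then i else k).
Proof.
elim: i U k => [|i IH] [|x [|y t]] [|[|k]] //= lt; rewrite IH //.
  by rewrite eqSS; case: eqP.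
by rewrite !eqSS; case: eqP => // _; case: eqP.
Qed.

Lemma swap_at_far i j U : (i.+1 < j)%N -> swap_at i (swap_at j U) = swap_at j (swap_at i U).
Proof.
elim: i j U => [|i IH] [|j] // U; rewrite ltnS => ij.
  by case: j ij => // j _; case: U => [|x [|y t]].
by case: U => // x t /=; rewrite IH.
Qed.

Lemma letter_act_far i j U : far i j -> letter_act i (letter_act j U) = letter_act j (letter_act i U).
Proof.
wlog ij : i j / (i <= j)%N.
  by move=> H; case: (leqP i j) => [/H//|/ltnW/H{}H]; rewrite /far orbC => /H.
rewrite /far => far; have {far} : (i.+1 < j)%N by lia.
case: i ij => [|i] _; case: j => // j; last by rewrite ltnS /= => /swap_at_far->.
by case: j => // j _; case: U.
Qed.

Lemma letter_act_braid3 k U : (0 < k)%N -> (k.+1 < size U)%N ->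
  letter_act k (letter_act k.+1 (letter_act k U)) = letter_act k.+1 (letter_act k (letter_act k.+1 U)).
Proof.
case: k => // k _ /=; elim: k U => [|k IH] [|x t] //=; last by move=> lt; rewrite IH.
by case: t => [|y [|z t]].
Qed.

Lemma inv_count_swap i U : (i.+1 < size U)%N -> nth 0 U i < nth 0 U i.+1 ->
  inv_count (swap_at i U) = (inv_count U).+1.
Proof.
elim: i U => [|i IH] [|x t] //=.
  case: t => //= y t _ xy; rewrite !big_cons.
  rewrite [y + x]addrC; move: (\sum_(_ <- t) _)%N (\sum_(_ <- t) _)%N (inv_count t) => A B C.
  lia.
by move=> lt nlt; rewrite (perm_big _ (perm_swap_at i t)) /= IH // addnS.
Qed.

Lemma inv_count_neg x t : 0 < x -> inv_count (- x :: t) = (inv_count (x :: t)).+1.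
Proof.
move=> x0 /=.
have -> : (\sum_(y <- t) ((y < - x)%R + (- x + y < 0)%R) =
  \sum_(y <- t) ((y < x)%R + (x + y < 0)%R))%N by apply: eq_bigr => y _; lia.
have -> : (- x < 0) = true by lia.
by have -> : (x < 0) = false by lia.
Qed.

Section SignedLists.
Variable n : nat.

Definition signed_list (U : seq int) : bool := perm_eq (map absz U) (iota 1 n).

Lemma signed_list_size U : signed_list U -> size U = n.
Proof. by move/perm_size; rewrite size_map size_iota. Qed.

Lemma signed_list_act i U : signed_list U -> signed_list (letter_act i U).
Proof.
rewrite /signed_list; case: i => [|i]; first by case: U => //= x t; rewrite abszN.
by apply: perm_trans; apply/perm_map/perm_swap_at.
Qed.

Lemma signed_list_neq U i j : signed_list U -> (i < n)%N -> (j < n)%N -> i != j ->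
  nth 0 U i != nth 0 U j.
Proof.
move=> sU iN jN; have sz := signed_list_size sU; apply: contra => /eqP E.
rewrite -(nth_uniq 0%N (s := map absz U)) ?size_map ?sz //.
  by rewrite !(nth_map 0) ?sz // E.
by rewrite (perm_uniq sU) iota_uniq.
Qed.

Lemma signed_list_neq0 U i : signed_list U -> (i < n)%N -> nth 0 U i != 0.
Proof.
move=> sU iN; have sz := signed_list_size sU; apply/eqP => E.
have : `|nth 0%R U i|%N \in map absz U.
  by rewrite -(nth_map 0%R 0%N) ?sz // mem_nth // size_map sz.
by rewrite (perm_mem sU) mem_iota E.
Qed.

Lemma inv_count_asc i U : signed_list U -> (i < n)%N -> ~~ descent i U ->
  inv_count (letter_act i U) = (inv_count U).+1.
Proof.
move=> sU iN; have sz := signed_list_size sU; case: i iN => [|i] iN /=.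
  move=> nd; have := signed_list_neq0 sU iN.
  by case: (U) nd => [|x t] //= nd x0; apply: inv_count_neg; lia.
move=> nd; apply: inv_count_swap; first by rewrite sz.
by rewrite lt_neqAle (signed_list_neq sU (ltnW iN) iN) ?leNgt ?ltn_eqF.
Qed.

Lemma descent_act i U : signed_list U -> (i < n)%N -> descent i (letter_act i U) = ~~ descent i U.
Proof.
move=> sU iN; have sz := signed_list_size sU; case: i iN => [|i] iN.
  have := signed_list_neq0 sU iN; rewrite /=; case: (U) => [|x t] //= x0.
  by rewrite oppr_lt0 lt_def x0 leNgt.
have H := signed_list_neq sU (ltnW iN) iN (negbT (ltn_eqF (ltnSn i))).
rewrite /= !nth_swap_at ?sz // eqxx gtn_eqF // eqxx.
by rewrite lt_neqAle H leNgt.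
Qed.

Lemma inv_count_desc i U : signed_list U -> (i < n)%N -> descent i U ->
  inv_count U = (inv_count (letter_act i U)).+1.
Proof.
move=> sU iN dU; rewrite -[in LHS](letter_actK i U) inv_count_asc //; first exact: signed_list_act.
by rewrite descent_act // negbK.
Qed.

Definition id_list : seq int := map Posz (iota 1 n).

Lemma signed_id_list : signed_list id_list.
Proof. by rewrite /signed_list /id_list -map_comp map_id. Qed.

Lemma inv_count_id : inv_count id_list = 0%N.
Proof.
rewrite /id_list; elim: n 1%N => //= m IH k.
rewrite IH addn0 big_map big_seq big1 => [|y].
  by [].
rewrite mem_iota => H; have -> : (y%:Z < k%:Z) = false by lia.
by have -> : (k%:Z + y%:Z < 0) = false by lia.
Qed.

(** Without descents the entries are positive and increasing. *)
Lemma no_descent_id U : signed_list U -> (forall i, (i < n)%N -> ~~ descent i U) ->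
  U = id_list.
Proof.
move=> sU nd; have sz := signed_list_size sU.
have pos i : (i < n)%N -> 0 <= nth 0 U i.
  elim: i => [|i IH] iN; first by have := nd 0%N iN; rewrite /= -leNgt.
  by have := nd i.+1 iN; rewrite /= -leNgt; apply: le_trans; exact/IH/ltnW.
have E : U = map Posz (map absz U).
  rewrite -map_comp -[LHS]map_id; apply/eq_in_map => x /(nthP 0)[i]; rewrite sz => iN <- /=.
  by rewrite gez0_abs ?pos.
rewrite E; congr (map Posz); apply: (irr_sorted_eq ltn_trans ltnn).
- apply/(sortedP 0%N) => i; rewrite size_map sz => iN.
  rewrite !(nth_map 0) ?sz ?(ltnW iN) // -ltz_nat !gez0_abs ?pos ?(ltnW iN) //.
  rewrite lt_neqAle (signed_list_neq sU) ?(ltnW iN) ?ltn_eqF //.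
  by have := nd i.+1 iN; rewrite /= -leNgt.
- exact: iota_ltn_sorted.
- exact: perm_mem.
Qed.

Definition letters (a : seq nat) : bool := all (fun i => i < n)%N a.
Definition reducedl (a : seq nat) : bool :=
  letters a && (size a == inv_count (word_act a id_list)).

Lemma signed_word_act a : signed_list (word_act a id_list).
Proof. by elim: a => [|i a IH]; [exact: signed_id_list|exact: signed_list_act]. Qed.

Lemma inv_count_word_act a : letters a -> (inv_count (word_act a id_list) <= size a)%N.
Proof.
elim: a => [|i a IH] /=; first by rewrite inv_count_id.
case/andP=> iN /IH le; have sU := signed_word_act a; case dU: (descent i (word_act a id_list)).
  by have := inv_count_desc sU iN dU; rewrite /word_act /= in le *; lia.
by have := inv_count_asc sU iN (negbT dU); rewrite /word_act /= in le *; lia.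
Qed.

Lemma reducedl_cons i a : reducedl (i :: a) ->
  [/\ (i < n)%N, reducedl a, descent i (word_act (i :: a) id_list)
    & letter_act i (word_act (i :: a) id_list) = word_act a id_list].
Proof.
case/andP=> /= /andP[iN la] /eqP sz; have sU := signed_word_act a; have := inv_count_word_act la.
case dU: (descent i (word_act a id_list)).
  by have := inv_count_desc sU iN dU; rewrite /word_act /= in sz *; lia.
have := inv_count_asc sU iN (negbT dU); rewrite /word_act /= in sz * => E le.
split=> //; last exact: letter_actK.
  by rewrite /reducedl la /word_act; apply/eqP; lia.
by rewrite descent_act // dU.
Qed.

(** A descent of [U] can be taken as the first letter of a reduced word. *)
Lemma cons_reducedl j c U : signed_list U -> (j < n)%N -> descent j U ->
  reducedl c -> word_act c id_list = letter_act j U ->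
  reducedl (j :: c) /\ word_act (j :: c) id_list = U.
Proof.
move=> sU jN dU /andP[lc /eqP sz] E.
have E' : word_act (j :: c) id_list = U by rewrite /word_act /= -/(word_act c _) E letter_actK.
by split=> //; rewrite /reducedl E' /= jN lc (inv_count_desc sU jN dU) sz E eqxx.
Qed.

Lemma exists_reducedl U : signed_list U ->
  exists2 c, reducedl c & word_act c id_list = U.
Proof.
have [m] := ubnP (inv_count U); elim: m U => // m IH U lt sU.
case: (pickP (fun i : 'I_n => descent i U)) => [i dU|nd].
  have Ed := inv_count_desc sU (ltn_ord i) dU.
  have [|c rc Ec] := IH (letter_act i U) _ (signed_list_act i sU); first by rewrite Ed in lt.
  by have [? ?] := cons_reducedl sU (ltn_ord i) dU rc Ec; exists (val i :: c).
exists [::]; first by rewrite /reducedl /= inv_count_id.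
by apply/esym/no_descent_id => // i iN; have := nd (Ordinal iN) => /= ->.
Qed.

Section Matsumoto.
Variables (T : Type) (op : nat -> T -> T).
Hypotheses (op_far : forall i j f, (i < n)%N -> (j < n)%N -> far i j ->
              op i (op j f) = op j (op i f))
  (op_braid3 : forall k f, (0 < k)%N -> (k.+1 < n)%N ->
     op k (op k.+1 (op k f)) = op k.+1 (op k (op k.+1 f)))
  (op_braid4 : forall f, (1 < n)%N ->
     op 0 (op 1 (op 0 (op 1 f))) = op 1 (op 0 (op 1 (op 0 f)))).

(** Induction on the length.  If the words begin with different letters i and j, both
    are descents of the element, which therefore has reduced words beginning with
    each of the two reduced words of the longest element of <s_i, s_j>.  The induction
    hypothesis identifies the first of these with [a] and the second with [b], and a
    braid relation identifies them with each other. *)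
Lemma matsumoto a b f : reducedl a -> reducedl b ->
  word_act a id_list = word_act b id_list -> foldr op f a = foldr op f b.
Proof.
have [m] := ubnP (size a); elim: m a b => // m IH a b lt ra rb E.
have szE : size a = size b.
  by case/andP: ra => _ /eqP ->; case/andP: rb => _ /eqP ->; rewrite E.
case: a b lt ra rb E szE => [|i a] [|j b] // lt ra rb E szE.
case: (eqVneq i j) => [ij|ij].
  rewrite -ij in rb E *; have [_ ra' _ Ea] := reducedl_cons ra.
  have [_ rb' _ Eb] := reducedl_cons rb; congr (op i _).
  by apply: IH; rewrite // -Ea -Eb E.
wlog {ij} ij : i j a b lt ra rb E szE / (i < j)%N.
  move=> H; case: (ltngtP i j) ij => [ij|ij|//] _; first exact: H.
  by apply/esym/H => //; rewrite -szE.
have [iN ra' da Ea] := reducedl_cons ra; have [jN rb' db Eb] := reducedl_cons rb.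
set U := word_act (i :: a) id_list in da Ea E; rewrite -E in db Eb.
have sU : signed_list U by exact: signed_word_act.
have szU := signed_list_size sU; clearbody U.
(* After its first letter, a word may be replaced by any other one for the same element. *)
have step k c c' V : size c = size a -> reducedl c -> reducedl c' ->
    word_act c id_list = V -> word_act c' id_list = V ->
    op k (foldr op f c) = op k (foldr op f c').
  by move=> szc rc rc' Ec Ec'; congr (op k _); apply: IH; rewrite // ?szc // Ec.
have szb : size b = size a by move: szE => [].
rewrite /=; case fij: (far i j).
  have dW1 : descent j (letter_act i U).
    case: (j) ij fij db jN => // j' ij fij /= db jN; case: (i) ij fij => [|i'] ij fij.
      move: fij; rewrite /far; case: (j') db => [|k] /=; first by lia.
      by case: (U).
    have i'U : (i'.+1 < size U)%N by rewrite szU; lia.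
    rewrite /= !nth_swap_at //.
    have -> : (j'.+1 == i') = false by move: fij; rewrite /far; lia.
    have -> : (j'.+1 == i'.+1) = false by move: fij; rewrite /far; lia.
    have -> : (j' == i') = false by move: fij; rewrite /far; lia.
    by have -> : (j' == i'.+1) = false by move: fij; rewrite /far; lia.
  have dW2 : descent i (letter_act j U).
    case: (j) ij fij jN => // j' _ fij jN /=.
    case: (i) fij da => [|i'] fij /= da; rewrite !nth_swap_at ?szU //.
      have -> : (0%N == j') = false by move: fij; rewrite /far; lia.
      by [].
    have -> : (i'.+1 == j') = false by move: fij; rewrite /far; lia.
    have -> : (i'.+1 == j'.+1) = false by move: fij; rewrite /far; lia.
    have -> : (i' == j') = false by move: fij; rewrite /far; lia.
    by have -> : (i' == j'.+1) = false by move: fij; rewrite /far; lia.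
  have sW1 := signed_list_act i sU; have sW2 := signed_list_act j sU.
  (* Commuting letters: both words continue with the other letter. *)
  have [c rc Ec] := exists_reducedl (signed_list_act j sW1).
  have [r1 E1] := cons_reducedl sW1 jN dW1 rc Ec.
  have [r2 E2] := cons_reducedl sW2 iN dW2 rc (etrans Ec (letter_act_far _ (etrans (orbC _ _) fij))).
  rewrite (step i a (j :: c) _ _ ra' r1 (esym Ea) E1) //.
  by rewrite (step j b (i :: c) _ szb rb' r2 (esym Eb) E2) //= op_far.
have {ij fij} jE : j = i.+1 by move: fij ij; rewrite /far; lia.
subst j; have iU : (i.+1 < size U)%N by rewrite szU.
have sW1 := signed_list_act i sU; have sW2 := signed_list_act i.+1 sU.
case: i => [|i] in lt ra rb E szE iN jN da db Ea Eb iU sW1 sW2 *.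
  (* The letters 0 and 1: the list starts with x, y, and they are both descents if and
     only if y < x < 0. *)
  have [x [y [t EU]]] : exists x y t, U = x :: y :: t.
    by case: (U) iU => [|x [|y t]] // _; exists x, y, t.
  rewrite EU /= in da db sW1 sW2 Ea Eb.
  have sW12 := signed_list_act 1 sW1; have sW21 := signed_list_act 0 sW2.
  have sW3 := signed_list_act 0 sW12; have sW4 := signed_list_act 1 sW21.
  rewrite /= in sW12 sW21 sW3 sW4.
  have [c rc Ec] := exists_reducedl (signed_list_act 1 sW3); rewrite /= in Ec.
  have y0 : y < 0 by exact: lt_trans da.
  have Nxy : - x < - y by rewrite ltrN2.
  have yNx : y < - x by apply: lt_trans y0 _; rewrite oppr_gt0.
  have xNy : x < - y by apply: lt_trans da _; rewrite oppr_gt0.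
  have [r1 E1] := @cons_reducedl 1%N c _ sW3 jN Nxy rc Ec.
  have [r2 E2] := @cons_reducedl 0%N _ _ sW12 iN y0 r1 E1.
  have [r3 E3] := @cons_reducedl 1%N _ _ sW1 jN yNx r2 E2.
  have [r4 E4] := @cons_reducedl 0%N c _ sW4 iN da rc Ec.
  have [r5 E5] := @cons_reducedl 1%N _ _ sW21 jN xNy r4 E4.
  have [r6 E6] := @cons_reducedl 0%N _ _ sW2 iN y0 r5 E5.
  rewrite (step 0%N a _ _ _ ra' r3 (esym Ea) E3) //.
  by rewrite (step 1%N b _ _ szb rb' r6 (esym Eb) E6) //= op_braid4.
(* The letters i + 1 and i + 2: the three entries concerned are decreasing. *)
have H1 : nth 0 U i.+1 < nth 0 U i by exact: da.
have H2 : nth 0 U i.+2 < nth 0 U i.+1 by exact: db.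
have H3 := lt_trans H2 H1.
have nth1 V k : size V = n -> nth 0 (letter_act i.+1 V) k = nth 0 V (if k == i then i.+1
  else if k == i.+1 then i else k) by move=> sV; apply: nth_swap_at; rewrite sV ltnW.
have nth2 V k : size V = n -> nth 0 (letter_act i.+2 V) k = nth 0 V (if k == i.+1 then i.+2
  else if k == i.+2 then i.+1 else k) by move=> sV; apply: nth_swap_at; rewrite sV.
have n1 : (i.+1 == i) = false by rewrite gtn_eqF.
have n2 : (i.+2 == i) = false by rewrite gtn_eqF.
have n3 : (i.+2 == i.+1) = false by rewrite gtn_eqF.
have n4 : (i == i.+1) = false by rewrite ltn_eqF.
have n5 : (i == i.+2) = false by rewrite ltn_eqF.
have n6 : (i.+1 == i.+2) = false by rewrite ltn_eqF.
have nE := (n1, n2, n3, n4, n5, n6, eqxx).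
have sW12 := signed_list_act i.+2 sW1; have sW21 := signed_list_act i.+1 sW2.
have z1 := signed_list_size sW1; have z2 := signed_list_size sW2.
have z12 := signed_list_size sW12; have z21 := signed_list_size sW21.
have [c rc Ec] := exists_reducedl (signed_list_act i.+1 sW12).
have Ec' := etrans Ec (@letter_act_braid3 i.+1 U isT iU).
have [|r1 E1] := @cons_reducedl i.+1 c _ sW12 iN _ rc Ec.
  by rewrite /descent !(nth1, nth2, nE).
have [|r2 E2] := @cons_reducedl i.+2 _ _ sW1 jN _ r1 E1.
  by rewrite /descent !(nth1, nth2, nE).
have [|r3 E3] := @cons_reducedl i.+2 c _ sW21 jN _ rc Ec'.
  by rewrite /descent !(nth1, nth2, nE).
have [|r4 E4] := @cons_reducedl i.+1 _ _ sW2 iN _ r3 E3.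
  by rewrite /descent !(nth1, nth2, nE).
rewrite (step i.+1 a _ _ _ ra' r2 (esym Ea) E2) //.
by rewrite (step i.+2 b _ _ szb rb' r4 (esym Eb) E4) //= op_braid3.
Qed.

End Matsumoto.
End SignedLists.

(** * A reduced word made of an insertion sort and cycles *)

Lemma word_act_cat a b U : word_act (a ++ b) U = word_act a (word_act b U).
Proof. exact: foldr_cat. Qed.

Lemma swap_at_cat (A : seq int) i U : swap_at (size A + i) (A ++ U) = A ++ swap_at i U.
Proof. by elim: A => //= x A ->. Qed.

Lemma swap_at_size (A : seq int) x y B : swap_at (size A) (A ++ x :: y :: B) = A ++ y :: x :: B.
Proof. by rewrite -[size A]addn0 swap_at_cat. Qed.

Lemma inv_count_swap_size A (x y : int) B : x < y ->
  inv_count (A ++ y :: x :: B) = (inv_count (A ++ x :: y :: B)).+1.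
Proof.
move=> xy; rewrite -swap_at_size inv_count_swap //; first by rewrite size_cat /=; lia.
by rewrite !nth_cat ltnn subnn ltnNge leqnSn subSnn.
Qed.

Lemma word_act_insert A t (m : int) B :
  word_act (iota (size A).+1 (size t)) (A ++ t ++ m :: B) = A ++ m :: t ++ B.
Proof.
elim: t A => [|x t IH] A //=.
have := IH (rcons A x); rewrite size_rcons !cat_rcons => ->.
exact: swap_at_size.
Qed.

(** Every letter of the move exchanges [m] with a smaller entry on its left. *)
Lemma inv_count_insert A t (m : int) B : all (fun x => x < m) t ->
  inv_count (A ++ m :: t ++ B) = (size t + inv_count (A ++ t ++ m :: B))%N.
Proof.
elim: t A => [|x t IH] A //= /andP[xm tm].
by rewrite (inv_count_swap_size _ _ xm) -!(cat_rcons x) IH.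
Qed.

Lemma word_act_sink A t (x : int) :
  word_act (rev (iota (size A).+1 (size t))) (A ++ x :: t) = A ++ rcons t x.
Proof.
elim: t A => [|y t IH] A //=.
rewrite rev_cons -cats1 word_act_cat /= swap_at_size.
by have := IH (rcons A y); rewrite size_rcons !cat_rcons => ->.
Qed.

Lemma inv_count_sink A t (x : int) : all (fun y => x < y) t ->
  inv_count (A ++ rcons t x) = (size t + inv_count (A ++ x :: t))%N.
Proof.
elim: t A => [|y t IH] A //= /andP[xy xt].
by rewrite -cat_rcons IH // cat_rcons (inv_count_swap_size _ _ xy) addnS.
Qed.

(** The word of s_{n-1} ... s_1 s_0, which changes the sign of the first entry and then
    moves it to the end. *)
Definition cycle_word (n : nat) : seq nat := rev (iota 0 n).

Lemma word_act_cycle (x : int) t :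
  word_act (cycle_word (size t).+1) (x :: t) = rcons t (- x).
Proof.
rewrite /cycle_word /= rev_cons -cats1 word_act_cat /=.
exact: (word_act_sink [::]).
Qed.

Lemma inv_count_cycle (x : int) t : 0 < x -> all (fun y => - x < y) t ->
  inv_count (rcons t (- x)) = ((size t).+1 + inv_count (x :: t))%N.
Proof. by move=> x0 /(inv_count_sink [::]) ->; rewrite !cat0s (inv_count_neg _ x0) addnS. Qed.

(** The entries of [q] are increasing, so the negated one that a cycle takes to the
    end is below all the others, including those negated before it; every letter
    therefore raises the length. *)
Lemma word_act_cycles (q : seq nat) (V : seq int) n :
  sorted ltn q -> all (ltn 0) q -> all (fun y => 0 < y) V ->
  n = (size q + size V)%N ->
  word_act (flatten (nseq (size q) (cycle_word n))) ([seq p%:Z | p <- q] ++ V)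
    = V ++ [seq - p%:Z | p <- q] /\
  inv_count (V ++ [seq - p%:Z | p <- q])
    = (size q * n + inv_count ([seq p%:Z | p <- q] ++ V))%N.
Proof.
move=> sq q0 V0 En.
(* [Z] holds the entries that have already been negated. *)
suff H Z : n = (size q + size V + size Z)%N ->
    all (fun z => all (fun p : nat => - p%:Z < z) q) Z ->
    word_act (flatten (nseq (size q) (cycle_word n))) ([seq p%:Z | p <- q] ++ V ++ Z)
      = V ++ Z ++ [seq - p%:Z | p <- q] /\
    inv_count (V ++ Z ++ [seq - p%:Z | p <- q])
      = (size q * n + inv_count ([seq p%:Z | p <- q] ++ V ++ Z))%N.
  by have := H [::]; rewrite !cats0 addn0 => /(_ En isT).
elim: q sq q0 {En} Z => [|p q IH] sq q0 Z En HZ; first by rewrite !cats0.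
rewrite /= in sq q0 En HZ.
have [p0 q0'] := andP q0.
have nE : n = (size ([seq p%:Z | p <- q] ++ V ++ Z)).+1.
  by rewrite !size_cat size_map En; lia.
have pq : all (fun r => p < r)%N q by apply: order_path_min sq; exact: ltn_trans.
have HZ' : all (fun z => all (fun p : nat => - p%:Z < z) q) (rcons Z (- p%:Z)).
  rewrite all_rcons; apply/andP; split.
    by apply/allP => r /(allP pq) pr; rewrite ltrN2 ltz_nat.
  by apply: sub_all HZ => z /andP[].
have [|E1 E2] := IH (path_sorted sq) q0' (rcons Z (- p%:Z)) _ HZ'.
  by rewrite size_rcons En !addSn !addnS.
have top : all (fun y => - p%:Z < y) ([seq p%:Z | p <- q] ++ V ++ Z).
  rewrite !all_cat; apply/and3P; split.
  - by apply/allP => y /mapP[r rq ->]; have := allP q0' r rq; lia.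
  - by apply/allP => y /(allP V0) y0; apply: lt_trans y0; rewrite oppr_lt0.
  - by apply: sub_all HZ => z /andP[].
split.
  (* The cycles are equal, so the one that acts first may be split off on the right. *)
  have fl : cycle_word n ++ flatten (nseq (size q) (cycle_word n)) =
            flatten (nseq (size q) (cycle_word n)) ++ cycle_word n.
    elim: (size q) => [|k IHk] /=; first by rewrite cats0.
    by rewrite -catA -IHk.
  rewrite /= fl word_act_cat {2}nE word_act_cycle -cats1 -!catA.
  by move: E1; rewrite -cats1 -!catA.
move: E2; rewrite -cats1 -!catA !map_cons !cat_cons => ->.
rewrite mulSn [(n + _)%N]addnC -addnA.
congr (_ + _)%N; rewrite {1}nE -inv_count_cycle //; congr inv_count.
by rewrite -cats1 -!catA.
Qed.

Section Insertion.
Variable Q : pred nat.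

Definition count_upto (m : nat) : nat := count Q (iota 1 m).

(** The values 1, ..., m are inserted one after the other: those satisfying [Q] are
    collected in front, increasing, the others after them, decreasing.  The value
    inserted is the largest so far and passes only entries that fail [Q]. *)
Fixpoint insertion_word (m : nat) : seq nat :=
  if m is m'.+1 then iota (count_upto m').+1 (m' - count_upto m') ++ insertion_word m' else [::].

Lemma count_upto_le a b : (a <= b)%N -> (count_upto a <= count_upto b)%N.
Proof.
move=> ab; rewrite /count_upto -(subnKC ab) iotaD count_cat; exact: leq_addr.
Qed.

Lemma count_upto_max a : (count_upto a <= a)%N.
Proof. by have := count_size Q (iota 1 a); rewrite size_iota. Qed.

Lemma letters_insertion_word n m : (m <= n)%N -> letters n (insertion_word m).
Proof.
elim: m => //= m IH mn; have Im := IH (ltnW mn).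
rewrite /letters all_cat; apply/andP; split; last exact: Im.
by apply/allP => i; rewrite mem_iota; have := count_upto_max m; lia.
Qed.

Definition insertion_state (m n : nat) : seq int :=
  [seq p%:Z | p <- filter Q (iota 1 m)] ++
  [seq p%:Z | p <- rev (filter (predC Q) (iota 1 m))] ++
  [seq p%:Z | p <- iota m.+1 (n - m)].

Lemma insertion_stateP m n : (m <= n)%N ->
  word_act (insertion_word m) (id_list n) = insertion_state m n /\
  inv_count (insertion_state m n) = size (insertion_word m).
Proof.
elim: m => [|m IH] mn; first by rewrite /insertion_state /= subn0 inv_count_id.
have [E1 E2] := IH (ltnW mn).
pose A := [seq p%:Z | p <- filter Q (iota 1 m)].
pose t := [seq p%:Z | p <- rev (filter (predC Q) (iota 1 m))].
pose B := [seq p%:Z | p <- iota m.+2 (n - m.+1)].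
have Em : insertion_state m n = A ++ t ++ m.+1%:Z :: B.
  by rewrite /insertion_state -(subnSK mn).
have Em1 : insertion_state m.+1 n = A ++ m.+1%:Z :: t ++ B.
  have iS : iota 1 m.+1 = rcons (iota 1 m) m.+1 by rewrite -(addn1 m) iotaD cats1 addnC.
  rewrite /insertion_state iS !filter_rcons /=; case: (Q m.+1) => /=.
    by rewrite map_rcons cat_rcons.
  by rewrite rev_rcons.
have szA : size A = count_upto m by rewrite size_map size_filter.
have szt : size t = (m - count_upto m)%N.
  rewrite size_map size_rev size_filter.
  by have := count_predC Q (iota 1 m); rewrite size_iota /count_upto; lia.
rewrite /= word_act_cat E1 Em1 Em size_cat size_iota -szt -szA.
split; first exact: word_act_insert.
rewrite inv_count_insert -?Em ?E2 //.
apply/allP => x /mapP[p]; rewrite mem_rev mem_filter mem_iota => H ->; lia.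
Qed.

End Insertion.

(** A reduced word of w_lam^{-1} w_0: the sort puts the parts of lam' in front of those
    of lam, and each cycle negates one of them; see [colongest_wordP]. *)
Definition colongest_word n lam : seq nat :=
  flatten (nseq (size (pcompl n lam)) (cycle_word n)) ++
  insertion_word (fun p => p \notin lam) n.

(** * Rings with an action of the group of type B *)

(** The index to which s_k takes j, for k > 0. *)
Definition swapn (k j : nat) : nat :=
  if j == k.-1 then k else if j == k then k.-1 else j.

(** What the computation uses of the polynomial ring.  The elements [xv 0], ..., [xv N]
    are the variables; [sv k] exchanges [xv k.-1] and [xv k] when k > 0, [sv 0] changes
    the sign of [xv 0], and [dv k] are the divided differences.  Over an abstract domain
    no term carries the construction of the polynomial ring along. *)
Record typeB_action (R : idomainType) (N : nat) := TypeBAction {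
  xv : nat -> R;
  sv : nat -> {rmorphism R -> R};
  dv : nat -> R -> R;
  typeB_x2 : forall j, (j <= N)%N -> 2%:R * xv j != 0;
  typeB_xB : forall i j, (i < j <= N)%N -> xv i - xv j != 0;
  typeB_xD : forall i j, (i < j <= N)%N -> xv i + xv j != 0;
  typeB_s0 : forall j, (j <= N)%N -> sv 0 (xv j) = if j == 0%N then - xv 0 else xv j;
  typeB_sx : forall k j, (0 < k <= N)%N -> (j <= N)%N -> sv k (xv j) = xv (swapn k j);
  typeB_sK : forall k f, (k <= N)%N -> sv k (sv k f) = f;
  typeB_s2 : forall k l f, (k <= N)%N -> (l <= N)%N -> far k l ->
    sv k (sv l f) = sv l (sv k f);
  typeB_s3 : forall k f, (0 < k < N)%N ->
    sv k (sv k.+1 (sv k f)) = sv k.+1 (sv k (sv k.+1 f));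
  typeB_s4 : forall f, (0 < N)%N ->
    sv 0 (sv 1 (sv 0 (sv 1 f))) = sv 1 (sv 0 (sv 1 (sv 0 f)));
  typeB_d0 : forall f, 2%:R * xv 0 * dv 0 f = f - sv 0 f;
  typeB_d : forall k f, (0 < k <= N)%N -> (xv k.-1 - xv k) * dv k f = f - sv k f
}.

Section TypeBAction.
Variables (R : idomainType) (N : nat) (W : typeB_action R N).
Implicit Types (f g : R) (k j : nat).

Local Notation X := (xv W).
Local Notation s := (sv W).
Local Notation d := (dv W).

Definition den k : R := if k is k'.+1 then X k' - X k else 2%:R * X 0.

Lemma den_neq0 k : (k <= N)%N -> den k != 0.
Proof.
case: k => [|k] kN; first exact: typeB_x2.
by apply: typeB_xB; rewrite ltnSn.
Qed.

Lemma dE k f : (k <= N)%N -> den k * d k f = f - s k f.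
Proof.
case: k => [|k] kN; first exact: typeB_d0.
by have := typeB_d W f (_ : 0 < k.+1 <= N)%N; exact.
Qed.

Lemma d_unique k f g : (k <= N)%N -> den k * g = f - s k f -> g = d k f.
Proof. by move=> kN; rewrite -dE // => /(mulfI (den_neq0 kN)). Qed.

Lemma s_den k : (k <= N)%N -> s k (den k) = - den k.
Proof.
case: k => [|k] kN; first by rewrite rmorphM rmorph_nat typeB_s0 // mulrN.
rewrite rmorphB !typeB_sx; try lia.
by rewrite /swapn /= eqxx gtn_eqF // eqxx opprB.
Qed.

Lemma s_d k f : (k <= N)%N -> s k (d k f) = d k f.
Proof.
move=> kN; apply: (@divided_difference_fixed _ (s k) (d k) _ _ (den_neq0 kN)); first exact: s_den.
  by move=> g; exact: typeB_sK.
by move=> g; exact: dE.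
Qed.

Lemma dM k f g : (k <= N)%N -> d k (f * g) = d k f * g + s k f * d k g.
Proof.
move=> kN; apply/esym/d_unique => //.
by rewrite mulrDr mulrA dE // [den k * _]mulrCA dE // rmorphM; ring.
Qed.

Lemma d_invl k f g : (k <= N)%N -> s k f = f -> d k (f * g) = f * d k g.
Proof.
by move=> kN sf; apply/esym/d_unique; rewrite // mulrCA dE // rmorphM sf mulrBr.
Qed.

Lemma d_inv k f : (k <= N)%N -> s k f = f -> d k f = 0.
Proof. by move=> kN sf; apply/esym/d_unique; rewrite // sf subrr mulr0. Qed.

Lemma dD k f g : (k <= N)%N -> d k (f + g) = d k f + d k g.
Proof. by move=> kN; apply/esym/d_unique; rewrite // mulrDr !dE // rmorphD; ring. Qed.

Lemma dN k f : (k <= N)%N -> d k (- f) = - d k f.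
Proof. by move=> kN; apply/esym/d_unique; rewrite // mulrN !dE // rmorphN; ring. Qed.

Lemma d0 k : (k <= N)%N -> d k 0 = 0.
Proof. by move=> kN; apply: d_inv; rewrite // rmorph0. Qed.

Lemma d_s k f : (k <= N)%N -> d k (s k f) = - d k f.
Proof. by move=> kN; apply/esym/d_unique; rewrite // mulrN !dE // typeB_sK // opprB. Qed.

Lemma d_far k l f : (k <= N)%N -> (l <= N)%N -> far k l ->
  d k (d l f) = d l (d k f).
Proof.
have sden k' l' : (k' <= N)%N -> (l' <= N)%N -> far k' l' -> s k' (den l') = den l'.
  move=> k'N; case: l' => [|l'] l'N fkl /=.
    case: k' k'N fkl => // k' k'N fkl.
    rewrite rmorphM rmorph_nat typeB_sx //= /swapn.
    by do 2![case: eqP => [E|_]; first by move: fkl; rewrite /far; lia].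
  rewrite rmorphB; case: k' k'N fkl => [|k'] k'N fkl.
    rewrite !typeB_s0; try lia.
    by case: eqP => // E; move: fkl; rewrite /far; lia.
  rewrite !typeB_sx; try lia.
  rewrite /swapn.
  by do 4![case: eqP => [E|_]; first by move: fkl; rewrite /far; lia].
move=> kN lN fkl; apply: (@braid2 _ (s k) (s l) _ _ _ _ f (den_neq0 kN) (den_neq0 lN)).
- by move=> g; exact: dE.
- by move=> g; exact: dE.
- exact: sden.
- by apply: sden => //; rewrite /far orbC.
- by move=> g; exact: typeB_s2.
Qed.

Lemma d_braid3 k f : (0 < k < N)%N ->
  d k (d k.+1 (d k f)) = d k.+1 (d k (d k.+1 f)).
Proof.
case/andP; case: k => // k _ kN.
have E : den k.+1 + den k.+2 = X k - X k.+2 by rewrite /= addrA subrK.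
have sw (a b c e : nat) : (0 < a <= N)%N -> (b <= N)%N -> (c <= N)%N ->
    s a (X b - X c) = X (swapn a b) - X (swapn a c).
  by move=> *; rewrite rmorphB !typeB_sx.
apply: (@braid3 _ (s k.+1) (s k.+2) _ _ (den k.+1) (den k.+2)).
- exact/den_neq0/ltnW.
- exact: den_neq0.
- by rewrite E; apply: typeB_xB; rewrite kN andbT.
- by move=> g; exact/dE/ltnW.
- by move=> g; exact: dE.
- exact/s_den/ltnW.
- exact: s_den.
- rewrite E /= sw //; [|lia..]; congr (X _ - X _); rewrite /swapn /=; repeat (case: eqP => ?); lia.
- rewrite E /= sw //; [|lia..]; congr (X _ - X _); rewrite /swapn /=; repeat (case: eqP => ?); lia.
- by move=> g; apply: typeB_sK; lia.
- by move=> g; apply: typeB_sK; lia.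
- by move=> g; apply: typeB_s3; lia.
Qed.

Lemma d_braid4 f : (0 < N)%N ->
  d 0 (d 1 (d 0 (d 1 f))) = d 1 (d 0 (d 1 (d 0 f))).
Proof.
move=> N0; apply: (@braid4 _ (s 0%N) (s 1%N) _ _ (X 0%N) (X 1%N)).
- exact: typeB_x2.
- exact: typeB_x2.
- exact: typeB_xB.
- exact: typeB_xD.
- by move=> g; exact: typeB_d0.
- by move=> g; exact: (@typeB_d _ _ W 1%N).
- by rewrite typeB_s0.
- by rewrite typeB_s0.
- by rewrite typeB_sx.
- by rewrite typeB_sx.
- by move=> g; apply: typeB_sK; lia.
- by move=> g; apply: typeB_sK; lia.
- by move=> g; apply: typeB_s4; lia.
Qed.

Lemma d2 k f : (k <= N)%N -> d k (d k f) = 0.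
Proof. by move=> kN; apply: d_inv => //; exact: s_d. Qed.

End TypeBAction.

(** * The composite of all the divided differences *)

Section Cycle.
Variables (R : idomainType) (N : nat) (W : typeB_action R N).
Implicit Types (f g h : R) (i j k l : nat).

Local Notation X := (xv W).
Local Notation s := (sv W).
Local Notation d := (dv W).

(** For i > 0 this is symmetry in the variables X_{i-1}, ..., X_N. *)
Definition inv_from i f := forall j, (i <= j <= N)%N -> s j f = f.

Lemma inv_fromM i f g : inv_from i f -> inv_from i g -> inv_from i (f * g).
Proof. by move=> If Ig j jN; rewrite rmorphM If ?Ig. Qed.

Lemma inv_fromX i f m : inv_from i f -> inv_from i (f ^+ m).
Proof. by move=> If j jN; rewrite rmorphXn /= If. Qed.

Lemma inv_from1 i : inv_from i 1.
Proof. by move=> j _; rewrite rmorph1. Qed.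

Lemma inv_fromN i f : inv_from i f -> inv_from i (- f).
Proof. by move=> If j jN; rewrite rmorphN /= If. Qed.

Lemma inv_from_sign i m : inv_from i ((-1) ^+ m).
Proof. exact/inv_fromX/inv_fromN/inv_from1. Qed.

Lemma inv_from_le i j f : (i <= j)%N -> inv_from i f -> inv_from j f.
Proof. by move=> ij If k /andP[jk kN]; apply: If; rewrite (leq_trans ij jk). Qed.

Lemma inv_from_prod i I (r : seq I) (P : pred I) F :
  (forall a, P a -> inv_from i (F a)) -> inv_from i (\prod_(a <- r | P a) F a).
Proof.
move=> H; apply: (big_ind (inv_from i)) => //; [exact: inv_from1|exact: inv_fromM].
Qed.

Lemma sX_low j r : (0 < j <= N)%N -> (r.+1 < j)%N -> s j (X r) = X r.
Proof.
move=> jN rj; rewrite typeB_sx //; last by lia.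
by rewrite /swapn; do 2![case: eqP => [E|_]; first by lia].
Qed.

Lemma sX_high j r : (j < r <= N)%N -> s j (X r) = X r.
Proof.
move=> rN; case: j rN => [|j] rN.
  by rewrite typeB_s0; [case: eqP rN => // ->|lia].
rewrite typeB_sx; [|lia..].
by rewrite /swapn; do 2![case: eqP => [E|_]; first by lia].
Qed.

Lemma sXl j : (0 < j <= N)%N -> s j (X j.-1) = X j.
Proof. by move=> jN; rewrite typeB_sx ?/swapn ?eqxx //; lia. Qed.

Lemma sXr j : (0 < j <= N)%N -> s j (X j) = X j.-1.
Proof.
move=> jN; rewrite typeB_sx ?/swapn ?eqxx //; last by lia.
by case: eqP => [E|//]; lia.
Qed.

Lemma inv_fromX_low i r m : (r.+1 < i)%N -> inv_from i (X r ^+ m).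
Proof. by move=> ri; apply: inv_fromX => j jN; apply: sX_low; lia. Qed.

Lemma s_d_far j i f : (j <= N)%N -> (i <= N)%N -> far j i -> s j (d i f) = d i (s j f).
Proof.
move=> jN iN ji; apply: d_unique => //.
have sd : s j (den W i) = den W i.
  have H r : (r <= N)%N -> (r == i) || (r.+1 == i) -> s j (X r) = X r.
    move=> rN ri; case: (ltnP j r) => jr; first by apply: sX_high; lia.
    by apply: sX_low; move: ji; rewrite /far; lia.
  case: i iN ji H => [|i] iN ji H /=; first by rewrite rmorphM rmorph_nat H.
  by rewrite rmorphB !H ?eqxx ?orbT //; lia.
by rewrite -{1}sd -rmorphM dE // rmorphB typeB_s2 // /far orbC.
Qed.

(** The composite d_{i+l-1} ... d_{i+1} d_i. *)
Fixpoint down l i f := if l is l'.+1 then down l' i.+1 (d i f) else f.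

Lemma downD l i f g : (i + l <= N.+1)%N -> down l i (f + g) = down l i f + down l i g.
Proof.
elim: l i f g => //= l IH i f g iN; rewrite dD; last by lia.
by rewrite IH; last by lia.
Qed.

Lemma downN l i f : (i + l <= N.+1)%N -> down l i (- f) = - down l i f.
Proof.
elim: l i f => //= l IH i f iN; rewrite dN; last by lia.
by rewrite IH; last by lia.
Qed.

Lemma down0 l i : (i + l <= N.+1)%N -> down l i 0 = 0.
Proof. by elim: l i => //= l IH i iN; rewrite d0 ?IH //; lia. Qed.

Lemma down_sum l i I (r : seq I) (P : pred I) F : (i + l <= N.+1)%N ->
  down l i (\sum_(a <- r | P a) F a) = \sum_(a <- r | P a) down l i (F a).
Proof.
by move=> iN; apply: (big_morph (down l i)) => [f g|]; [exact: downD|exact: down0].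
Qed.

Lemma down_invl l i f g : (i + l <= N.+1)%N -> inv_from i f ->
  down l i (f * g) = f * down l i g.
Proof.
elim: l i g => //= l IH i g iN If.
rewrite d_invl ?IH //; [by lia|exact: inv_from_le If|by lia|apply: If; lia].
Qed.

Lemma down_cat l1 l2 i f : down (l1 + l2) i f = down l2 (i + l1) (down l1 i f).
Proof. by elim: l1 i f => [|l1 IH] i f /=; rewrite ?addn0 // IH addSnnS. Qed.

Lemma down_d l i j f : (i + l <= N.+1)%N -> (j <= N)%N ->
  (j.+1 < i)%N || (i + l < j)%N -> down l i (d j f) = d j (down l i f).
Proof.
elim: l i f => //= l IH i f iN jN ij.
by rewrite -d_far ?IH //; rewrite /far; lia.
Qed.

(** Both exponents of every monomial of the result are below the bound [L]: the two
    exponents are brought together, the total degree dropping by one. *)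
Lemma d_mono i a b L : (0 < i <= N)%N -> (a <= L)%N -> (b <= L)%N ->
  exists e lo c, (lo + c <= L)%N /\ d i (X i.-1 ^+ a * X i ^+ b) =
    (-1) ^+ e * \sum_(q < c) X i.-1 ^+ (lo + (c.-1 - q)) * X i ^+ (lo + q).
Proof.
move=> iN aL bL; have iN' : (i <= N)%N by lia.
(* The common power of the two variables is symmetric and factors out. *)
have diag lo c : d i (X i.-1 ^+ (lo + c) * X i ^+ lo) =
    \sum_(q < c) X i.-1 ^+ (lo + (c.-1 - q)) * X i ^+ (lo + q).
  have -> : X i.-1 ^+ (lo + c) * X i ^+ lo = (X i.-1 * X i) ^+ lo * X i.-1 ^+ c.
    by rewrite exprD exprMn; ring.
  rewrite d_invl //; last by rewrite rmorphXn rmorphM /= sXl // sXr // mulrC.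
  have -> : d i (X i.-1 ^+ c) = \sum_(q < c) X i.-1 ^+ (c.-1 - q) * X i ^+ q.
    apply/esym/d_unique => //; rewrite rmorphXn /= sXl //.
    have -> : den W i = X i.-1 - X i by case: (i) iN.
    rewrite subrXX; congr (_ * _); apply: eq_bigr => q _; congr (_ ^+ _ * _).
  rewrite big_distrr /=; apply: eq_bigr => q _.
  by rewrite exprMn !exprD; ring.
case: (leqP b a) => ab.
  by exists 0%N, b, (a - b)%N; split; [lia|rewrite -diag expr0 mul1r subnKC].
(* If b > a the exponents are exchanged by s_i, at the cost of a sign. *)
exists 1%N, a, (b - a)%N; split; first by lia.
rewrite -diag subnKC ?(ltnW ab) // expr1 mulN1r -d_s // rmorphM !rmorphXn /= sXl // sXr //.
by rewrite mulrC.
Qed.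

(** By [d_mono] every operator leaves on the next variable an exponent whose bound is
    one lower, so the [l] operators, against an exponent less than [l], give zero. *)
Lemma down_low l i a (m : nat -> nat) g : (i + l)%N = N.+1 -> (0 < i)%N -> (a < l)%N ->
  (forall r, (i <= r <= N)%N -> (m r <= N - r)%N) -> inv_from i g ->
  down l i (g * (X i.-1 ^+ a * \prod_(i <= r < N.+1) X r ^+ m r)) = 0.
Proof.
elim: l i a g => //= l IH i a g iN i0 al mN Ig.
have iN' : (i <= N)%N by lia.
have lN : (N - i)%N = l by lia.
rewrite big_ltn; last by lia.
set P := \prod_(_ <= _ < _) _.
have IP : s i P = P.
  by rewrite rmorph_prod; apply: eq_big_nat => r rN; rewrite rmorphXn /= sX_high //; lia.
have -> : g * (X i.-1 ^+ a * (X i ^+ m i * P)) = (g * P) * (X i.-1 ^+ a * X i ^+ m i).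
  by ring.
rewrite d_invl //; last by rewrite rmorphM IP Ig //; lia.
have [|||e [lo [c [lc ->]]]] := @d_mono i a (m i) l; [lia|lia|by rewrite -lN; apply: mN; lia|].
rewrite !big_distrr /= down_sum; last by lia.
apply: big1 => q _; pose g' := g * (-1) ^+ e * X i.-1 ^+ (lo + (c.-1 - q)).
rewrite [X in down _ _ X](_ : _ = g' * (X i ^+ (lo + q) * P)); last by rewrite /g'; ring.
(* The bound [l] has become one for the exponent of X_i. *)
apply: IH; [lia|lia|have := ltn_ord q; lia|by move=> r rN; apply: mN; lia|].
apply: inv_fromM; first apply: inv_fromM.
- by apply: inv_from_le Ig.
- exact: inv_from_sign.
- by apply: inv_fromX_low; lia.
Qed.

(** In the product rule for d_i, the term where the power of X_i is differentiated is
    too low in degree for the remaining operators ([down_low]); in the other term this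
    power has become one of X_{i-1}, on which they do not act. *)
Lemma down_shift l i (m : nat -> nat) h : (i + l)%N = N.+1 -> (0 < i)%N ->
  (forall r, (i <= r <= N)%N -> (m r <= N - r)%N) -> inv_from i.+1 h ->
  down l i (h * \prod_(i <= r < N.+1) X r ^+ m r) =
  \prod_(i <= r < N.+1) X r.-1 ^+ m r * down l i h.
Proof.
elim: l i h => [|l IH] i h iN i0 mN Ih.
  by rewrite !big_geq ?mulr1 ?mul1r //; lia.
have iN' : (i <= N)%N by lia.
have lN : (N - i)%N = l by lia.
have mi : (m i <= l)%N by rewrite -lN; apply: mN; lia.
rewrite /= !(big_ltn (m := i)); [|lia..].
set P := \prod_(_ <= _ < _) _.
have IP : s i P = P.
  by rewrite rmorph_prod; apply: eq_big_nat => r rN; rewrite rmorphXn /= sX_high //; lia.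
have -> : h * (X i ^+ m i * P) = X i ^+ m i * (P * h) by ring.
rewrite dM // d_invl // rmorphXn /= sXr; last by lia.
rewrite downD; last by lia.
rewrite [X in X + _](_ : _ = 0) ?add0r.
  rewrite down_invl; [|lia|by apply: inv_fromX_low; lia].
  rewrite [P * _]mulrC IH; [by rewrite mulrA|lia|lia| |].
    by move=> r rN; apply: mN; lia.
  move=> j jN; rewrite s_d_far ?Ih //; rewrite /far; lia.
(* The other term of the product rule. *)
have [|||e [lo [c [lc]]]] := @d_mono i 0%N (m i) l; [lia|lia|lia|].
rewrite expr0 mul1r => ->; rewrite big_distrr /= big_distrl /= down_sum; last by lia.
apply: big1 => q _; pose g' := h * (-1) ^+ e * X i.-1 ^+ (lo + (c.-1 - q)).
rewrite [X in down _ _ X](_ : _ = g' * (X i ^+ (lo + q) * P)); last by rewrite /g'; ring.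
apply: (@down_low l i.+1); [lia|lia|have := ltn_ord q; lia|by move=> r rN; apply: mN; lia|].
apply: inv_fromM; first apply: inv_fromM.
- exact: Ih.
- exact: inv_from_sign.
- by apply: inv_fromX_low; lia.
Qed.

(** The composite of all the divided differences, without the signs of the d'_i. *)
Definition cyc f := down N.+1 0 f.

Lemma cyc0 : cyc 0 = 0.
Proof. exact: down0. Qed.

Lemma cycD f g : cyc (f + g) = cyc f + cyc g.
Proof. exact: downD. Qed.

(** The operators after d_0 move the power of each variable to the previous one
    ([down_shift]). *)
Lemma cyc_shift (m : nat -> nat) S : (forall r, (1 <= r <= N)%N -> (m r <= N - r)%N) ->
  inv_from 1 S ->
  cyc (\prod_(0 <= r < N.+1) X r ^+ m r * S) =
  \prod_(1 <= r < N.+1) X r.-1 ^+ m r * cyc (X 0 ^+ m 0 * S).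
Proof.
move=> mN IS; rewrite /cyc /= big_ltn // -down_shift //.
  congr down; set P := \prod_(_ <= _ < _) _.
  rewrite mulrAC [X in d 0 X]mulrC [RHS]mulrC (@d_invl _ _ W 0%N P) // rmorph_prod.
  by apply: eq_big_nat => r rN; rewrite rmorphXn /= sX_high //; lia.
move=> j jN; rewrite s_d_far //; [|lia|rewrite /far; lia].
by rewrite rmorphM rmorphXn /= sX_low ?IS //; lia.
Qed.

(** The letter i commutes with the letters below i - 1, and the braid relation of i - 1
    and i turns it into i - 1 before it commutes with the others. *)
Lemma cyc_d i f : (1 < i <= N)%N -> cyc (d i f) = d i.-1 (cyc f).
Proof.
case/andP; case: i => [|[|i]] // _ iN /=.
rewrite /cyc; have -> : N.+1 = (i.+1 + (2 + (N - i.+2)))%N by lia.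
rewrite !(down_cat i.+1) down_d; [|lia..].
rewrite !down_cat /= add0n -[in RHS]down_d; [|lia..].
congr down; rewrite -d_braid3 //; lia.
Qed.

(** Moved next to each other, the first letters of the two cycles and the letter 1 are
    1, 0, 1, 0, 1; the braid relation of length four makes two letters 1 adjacent. *)
Lemma cyc_cyc_d1 f : (0 < N)%N -> cyc (cyc (d 1 f)) = 0.
Proof.
move=> N0; have cdown l i u : (1 < i)%N -> (i + l <= N.+1)%N ->
    cyc (down l i u) = down l i.-1 (cyc u).
  elim: l i u => //= l IH i u i1 iN; rewrite IH; [|lia|lia].
  by rewrite cyc_d; [case: (i) i1|lia].
have cE u : cyc u = down (N - 1) 2 (d 1 (d 0 u)).
  by rewrite /cyc; have -> : N.+1 = (N - 1).+2 by lia.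
rewrite (cE (d 1 f)) cdown //; last by lia.
rewrite [cyc _]cE -d_braid4 // d2 // !d0 //.
rewrite !down0 //; lia.
Qed.

Lemma iter_cyc0 k : iter k cyc 0 = 0.
Proof. by elim: k => //= k ->; exact: cyc0. Qed.

Lemma iter_cycD k f g : iter k cyc (f + g) = iter k cyc f + iter k cyc g.
Proof. by elim: k => //= k ->; exact: cycD. Qed.

(** Each cycle lowers the index by one ([cyc_d]) until it is 1, with at least two
    cycles left. *)
Lemma iter_cyc_d k i f : (0 < i < k)%N -> (i <= N)%N -> iter k cyc (d i f) = 0.
Proof.
elim: k i f => [|k IH] i f ik iN; first by lia.
case: (ltnP 1 i) => i1.
  by rewrite iterSr cyc_d ?IH //; lia.
have -> : i = 1%N by lia.
have -> : k = k.-1.+1 by lia.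
by rewrite !iterSr cyc_cyc_d1 ?iter_cyc0 //; lia.
Qed.

(** f + s_i f is in the image of d_i, since d_i (X_{i-1} g) = g if g is fixed by s_i. *)
Lemma iter_cyc_s k i f : (0 < i < k)%N -> (i <= N)%N ->
  iter k cyc (s i f) = - iter k cyc f.
Proof.
move=> ik iN; apply/eqP; rewrite -addr_eq0 -iter_cycD; apply/eqP.
have sym : s i (s i f + f) = s i f + f by rewrite rmorphD typeB_sK // addrC.
suff <- : d i (X i.-1 * (s i f + f)) = s i f + f by exact: iter_cyc_d.
apply/esym/d_unique => //; rewrite rmorphM sym sXl; last by lia.
by rewrite -mulrBl; congr (_ * _); case: (i) ik.
Qed.

End Cycle.

(** * Divided differences of Q-tilde polynomials *)

Lemma altdel_pred1 (R : comNzRingType) (b : nat) (G : seq nat -> R) lam : uniq lam ->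
  altdel (fun j => (j == b)%:R) G lam =
  if b \in lam then (-1) ^+ index b lam * G (rem b lam) else 0.
Proof.
elim: lam G => //= i t IH G /andP[it ut]; rewrite inE [b == i]eq_sym IH //.
case: eqVneq => [<-|ib] /=; first by rewrite (negbTE it) subr0 mul1r.
by rewrite mul0r sub0r; case: ifP => _; rewrite ?oppr0 // exprS mulN1r mulNr.
Qed.

Local Arguments elem_sym : simpl never.

Section EvaluationQt.
Variables (R : idomainType) (N : nat) (W : typeB_action R N).
Implicit Types (f g h : R) (i j k l : nat).

Local Notation X := (xv W).
Local Notation s := (sv W).
Local Notation d := (dv W).

Definition Xfrom i : seq R := [seq X r | r <- iota i (N.+1 - i)].

Lemma Xfrom_cons i : (i <= N)%N -> Xfrom i = X i :: Xfrom i.+1.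
Proof. by move=> iN; rewrite /Xfrom subSn //. Qed.

Lemma map_s_high j i : (j < i)%N -> [seq s j x | x <- Xfrom i] = Xfrom i.
Proof.
move=> ji; rewrite /Xfrom -map_comp; apply/eq_in_map => r; rewrite mem_iota => H /=.
by apply: sX_high; lia.
Qed.

Lemma map_s0 : [seq s 0 x | x <- Xfrom 0] = - X 0 :: Xfrom 1.
Proof. by rewrite Xfrom_cons //= map_s_high // typeB_s0. Qed.

Lemma map_s_perm j i : (i < j <= N)%N -> perm_eq [seq s j x | x <- Xfrom i] (Xfrom i).
Proof.
move=> ij; have [k Ek] : exists k, j = (i + k).+1 by exists (j - i).-1; lia.
elim: k i ij Ek => [|k IH] i ij Ek; rewrite (@Xfrom_cons i) /=; try lia.
  rewrite (@Xfrom_cons i.+1) /=; last by lia.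
  rewrite map_s_high; last by lia.
  have -> : i = j.-1 by lia.
  have -> : j.-1.+1 = j by lia.
  rewrite sXl; last by lia.
  rewrite sXr; last by lia.
  by rewrite (perm_catCA [:: X j] [:: X j.-1]).
by rewrite sX_low ?perm_cons ?IH //; lia.
Qed.

Lemma Qt_inv lam : inv_from W 1 (Qt (Xfrom 0) lam).
Proof.
by move=> j jN; rewrite rmorph_Qt (Qt_perm _ (map_s_perm _)).
Qed.

Lemma elem_sym_inv i c : inv_from W i.+1 (elem_sym (Xfrom i) c).
Proof.
move=> j jN; rewrite rmorph_elem_sym; apply: elem_sym_perm; exact: map_s_perm.
Qed.

(** The function is linear in its first variable, so each operator, up to sign, lowers
    both the degree and the number of variables by one. *)
Lemma down_elem_sym l i c : (i + l)%N = N.+1 -> (0 < i)%N ->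
  down W l i (elem_sym (Xfrom i) c%:Z) = (-1) ^+ l * (c == l)%:R.
Proof.
elim: l i c => [|l IH] i c iN i0.
  have -> : Xfrom i = [::] by rewrite /Xfrom (_ : N.+1 - i = 0)%N //; lia.
  by rewrite elem_sym_nil mul1r.
rewrite Xfrom_cons ?elem_sym_cons /=; last by lia.
have iN' : (i <= N)%N by lia.
have fx c' : s i (elem_sym (Xfrom i.+1) c') = elem_sym (Xfrom i.+1) c'.
  by rewrite rmorph_elem_sym map_s_high.
rewrite dD // d_inv // add0r mulrC d_invl //.
have -> : d i (X i) = -1.
  apply/esym/d_unique => //; rewrite sXr; last by lia.
  by case: (i) i0 => //= i' _; rewrite mulrN1 opprB.
rewrite mulrN1; case: c => [|c].
  by rewrite elem_symN // oppr0 down0 ?mulr0 //; lia.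
have -> : c.+1%:Z - 1 = c%:Z by rewrite -addn1 PoszD addrK.
rewrite downN; last by lia.
rewrite IH; [|lia|lia].
by rewrite eqSS exprS mulN1r mulNr.
Qed.

Lemma down_X0 a : (a < N)%N -> down W N 1 (X 0 ^+ a) = 0.
Proof.
move=> aN; have := @down_low _ _ W N 1 a (fun _ => 0%N) 1 (add1n N) isT aN.
rewrite mul1r big1 ?mulr1 => [|r _]; last by rewrite expr0.
by apply => //; exact: inv_from1.
Qed.

(** The identity e_{c+1}(X_0, ..., X_N) = e_{c+1}(X_1, ..., X_N) + X_0 e_c(X_1, ..., X_N)
    exchanges a power of X_0 for a degree of e: its left hand side is symmetric and
    passes through the operators, which annihilate low powers of X_0. *)
Lemma down_X0_elem_sym a c : (a <= N)%N ->
  down W N 1 (X 0 ^+ a * elem_sym (Xfrom 1) c%:Z) = (-1) ^+ (a + N) * (a + c == N)%N%:R.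
Proof.
elim: a c => [|a IH] c aN; first by rewrite mul1r down_elem_sym ?add1n.
have -> : X 0 ^+ a.+1 * elem_sym (Xfrom 1) c%:Z =
    elem_sym (Xfrom 0) c.+1%:Z * X 0 ^+ a - X 0 ^+ a * elem_sym (Xfrom 1) c.+1%:Z.
  rewrite (@Xfrom_cons 0) // elem_sym_cons exprS.
  have -> : c.+1%:Z - 1 = c%:Z by rewrite -addn1 PoszD addrK.
  by ring.
rewrite downD ?add1n // down_invl ?add1n //; last exact: elem_sym_inv.
rewrite down_X0 // mulr0 add0r downN ?add1n //.
by rewrite IH 1?ltnW // addnS !addSn exprS mulN1r mulNr.
Qed.

Lemma down_altdel (u : nat -> R) (G : seq nat -> R) Z lam :
  (forall t, inv_from W 1 (G t)) ->
  down W N 1 (Z * altdel u G lam) = altdel (fun i => down W N 1 (Z * u i)) G lam.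
Proof.
elim: lam G => [|i t IH] G IG /=; first by rewrite mulr0 down0 ?add1n.
rewrite mulrBr downD ?add1n // downN ?add1n //.
rewrite (IH (fun t' => G (i :: t'))) //; congr (_ - _).
by rewrite mulrA mulrC down_invl ?add1n // mulrC.
Qed.

(** The rank two perturbation [Qt_cons_opp], divided by 2 X_0. *)
Lemma d0_Qt lam : d 0 (Qt (Xfrom 0) lam) =
  altdel (fun i => elem_sym (Xfrom 1) (i%:Z - 1)) (Qt (Xfrom 0)) lam.
Proof.
apply/esym/d_unique => //; rewrite /den rmorph_Qt map_s0.
by rewrite (@Xfrom_cons 0) // Qt_cons_opp.
Qed.

Lemma d0_X0 a : d 0 (X 0 ^+ a) = (if odd a then X 0 ^+ a.-1 else 0).
Proof.
apply/esym/d_unique => //; rewrite /den rmorphXn /= typeB_s0 // exprNn.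
rewrite -signr_odd; case: a => [|a] /=; first by rewrite mulr0 mul1r subrr.
by case: odd; rewrite /= ?expr0 ?expr1 exprS; ring.
Qed.

(** In the product rule for d_0, the term where the power of X_0 is differentiated
    vanishes: Q~_lam is symmetric and the power is then too low.  In the other term,
    [d0_Qt] expands d_0 Q~_lam, and [down_X0_elem_sym] selects the part equal to [b]. *)
Lemma cyc_Qt b lam : (0 < b <= N.+1)%N -> 0%N \notin lam ->
  cyc W (X 0 ^+ (N.+1 - b) * Qt (Xfrom 0) lam) =
  (-1) ^+ N * altdel (fun j => (j == b)%:R) (Qt (Xfrom 0)) lam.
Proof.
move=> bN lam0; rewrite /cyc /= dM // downD ?add1n //.
rewrite [X in X + _](_ : _ = 0) ?add0r.
  rewrite d0_Qt down_altdel; last exact: Qt_inv.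
  rewrite -altdelZl; apply: eq_altdell => j jlam.
  have j0 : (0 < j)%N by rewrite lt0n; apply: contraNneq lam0 => <-.
  have -> : j%:Z - 1 = j.-1%:Z by rewrite -[in LHS](prednK j0) -addn1 PoszD addrK.
  rewrite rmorphXn /= typeB_s0 // eqxx (exprNn (X 0)) -mulrA down_invl ?add1n //; last first.
    exact: inv_from_sign.
  rewrite down_X0_elem_sym; last by lia.
  rewrite exprD !mulrA -exprMn mulrNN mulr1 expr1n mul1r.
  by have -> : (N.+1 - b + j.-1 == N)%N = (j == b) by lia.
rewrite d0_X0; case: ifP => oa; last by rewrite mul0r down0 ?add1n.
rewrite mulrC down_invl ?add1n //; last exact: Qt_inv.
rewrite down_X0 ?mulr0 //; move: oa; case E: (N.+1 - b)%N => [|a] //= _; lia.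
Qed.

End EvaluationQt.

(** * Signed divided differences *)

Lemma ltn_nth_succ (b : seq nat) r : sorted ltn b -> all (ltn 0) b ->
  (r < size b)%N -> (r < nth 0 b r)%N.
Proof.
move=> sb b0; elim: r => [|r IH] rb; first by apply: (allP b0); exact: mem_nth.
apply: leq_ltn_trans (IH (ltnW rb)) _.
exact: (sortedP 0%N sb).
Qed.

Lemma index_rem_gt (x b : nat) (lam : seq nat) : sorted gtn lam -> (b < x)%N ->
  x \in lam -> index x (rem b lam) = index x lam.
Proof.
elim: lam => //= i t IH pt bx; rewrite inE => /predU1P xt.
case: eqP => [ib|ib].
  case: xt => [xi|xt]; first by lia.
  by have := allP (order_path_min gtn_trans pt) x xt; rewrite /= ib; lia.
rewrite /=; case: eqP => // ix; case: xt => [/esym//|xt].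
by rewrite IH // (path_sorted pt).
Qed.

Section SignedDividedDifferences.
Variables (R : idomainType) (N : nat) (W : typeB_action R N).
Implicit Types (f g h : R) (i j k l : nat).

Local Notation X := (xv W).
Local Notation s := (sv W).
Local Notation d := (dv W).

Definition sdd k f : R := if k == 0%N then d k f else - d k f.

Lemma sdd_far i j f : (i < N.+1)%N -> (j < N.+1)%N -> far i j ->
  sdd i (sdd j f) = sdd j (sdd i f).
Proof.
rewrite !ltnS => iN jN ij; rewrite /sdd.
by case: eqP => _; case: eqP => _; rewrite ?dN ?opprK // d_far.
Qed.

Lemma sdd_braid3 k f : (0 < k)%N -> (k.+1 < N.+1)%N ->
  sdd k (sdd k.+1 (sdd k f)) = sdd k.+1 (sdd k (sdd k.+1 f)).
Proof.
case: k => // k _ kN; rewrite /sdd /= !dN ?d_braid3 //; lia.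
Qed.

Lemma sdd_braid4 f : (1 < N.+1)%N ->
  sdd 0 (sdd 1 (sdd 0 (sdd 1 f))) = sdd 1 (sdd 0 (sdd 1 (sdd 0 f))).
Proof. by move=> N0; rewrite /sdd /= !dN // ?d_braid4. Qed.

Definition scyc f := foldr sdd f (cycle_word N.+1).

Lemma foldr_down l i f : (0 < i)%N -> (i + l <= N.+1)%N ->
  foldr sdd f (rev (iota i l)) = (-1) ^+ l * down W l i f.
Proof.
elim: l i f => [|l IH] i f i0 iN; first by rewrite mul1r.
rewrite /= rev_cons foldr_rcons IH //; last by lia.
by rewrite /sdd gtn_eqF // downN ?exprS ?mulN1r ?mulNr ?mulrN //; lia.
Qed.

Lemma scycE f : scyc f = (-1) ^+ N * cyc W f.
Proof. by rewrite /scyc /cycle_word /= rev_cons foldr_rcons foldr_down. Qed.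

Lemma cyc_invl f g : inv_from W 0 f -> cyc W (f * g) = f * cyc W g.
Proof. exact: down_invl. Qed.

Lemma scyc_invl f g : inv_from W 0 f -> scyc (f * g) = f * scyc g.
Proof. by move=> If; rewrite !scycE cyc_invl // mulrCA. Qed.

Lemma iter_scyc k f : iter k scyc f = (-1) ^+ (N * k) * iter k (cyc W) f.
Proof.
elim: k => [|k IH]; first by rewrite muln0 mul1r.
rewrite !iterS IH scyc_invl; last exact: inv_from_sign.
by rewrite scycE mulrA -exprD mulnS addnC.
Qed.

Lemma iter_scyc_invl k f g : inv_from W 0 f -> iter k scyc (f * g) = f * iter k scyc g.
Proof. by move=> If; elim: k => //= k ->; rewrite scyc_invl. Qed.

Lemma iter_scycD k f g : iter k scyc (f + g) = iter k scyc f + iter k scyc g.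
Proof. by rewrite !iter_scyc iter_cycD mulrDr. Qed.

Lemma iter_scyc0 k : iter k scyc 0 = 0.
Proof. by rewrite iter_scyc iter_cyc0 mulr0. Qed.

Lemma iter_scyc_s k i f : (0 < i < k)%N -> (i <= N)%N ->
  iter k scyc (s i f) = - iter k scyc f.
Proof. by move=> ik iN; rewrite !iter_scyc iter_cyc_s // mulrN. Qed.

Local Notation Q lam := (Qt (Xfrom W 0) lam).

Definition mono (e : nat -> nat) : R := \prod_(0 <= r < N.+1) X r ^+ e r.

Lemma scyc_shift (m : nat -> nat) S : (forall r, (1 <= r <= N)%N -> (m r <= N - r)%N) ->
  m N.+1 = 0%N -> inv_from W 1 S ->
  scyc (mono m * S) = mono (fun r => m r.+1) * scyc (X 0 ^+ m 0 * S).
Proof.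
move=> mN mN1 IS; rewrite !scycE cyc_shift // mulrCA; congr (_ * _).
by rewrite /mono big_add1 /= [in RHS]big_nat_recr //= mN1 expr0 mulr1.
Qed.

Lemma scyc_Qt b lam : (0 < b <= N.+1)%N -> uniq lam -> 0%N \notin lam ->
  scyc (X 0 ^+ (N.+1 - b) * Q lam) =
  if b \in lam then (-1) ^+ index b lam * Q (rem b lam) else 0.
Proof.
move=> bN ul l0; rewrite scycE cyc_Qt // mulrA -exprMn mulrNN mulr1 expr1n mul1r.
exact: altdel_pred1.
Qed.

(** The parts are removed in increasing order: the positions in [lam] of those still to
    be removed do not change, and the r-th part exceeds r, which puts the exponents
    under the staircase required by [scyc_shift]. *)
Lemma iter_scyc_Qt (b lam : seq nat) : sorted ltn b -> all (fun x => 0 < x <= N.+1)%N b ->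
  sorted gtn lam -> 0%N \notin lam ->
  iter (size b) scyc (mono (fun r => nth 0%N [seq (N.+1 - x)%N | x <- b] r) * Q lam) =
  if all (fun x => x \in lam) b
  then (-1) ^+ (\sum_(x <- b) index x lam) * Q [seq x <- lam | x \notin b] else 0.
Proof.
elim: b lam => [|b0 b IH] lam sb bN sl l0.
  rewrite /= /mono big1 => [|r _]; last by rewrite nth_nil expr0.
  by rewrite big_nil !mul1r filter_predT.
have ul := sorted_uniq gtn_trans gtn_irr sl.
have pos : all (ltn 0) (b0 :: b) by apply: sub_all bN => x /andP[].
have nthN r : (r < size (b0 :: b))%N -> (r < nth 0 (b0 :: b) r <= N.+1)%N.
  move=> rb; rewrite ltn_nth_succ //=.
  by have /andP[] := allP bN _ (mem_nth 0%N rb).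
have szN : (size (b0 :: b) <= N.+1)%N.
  case: (leqP (size (b0 :: b)) N.+1) => // /nthN; lia.
rewrite [size _]/= iterSr scyc_shift; last exact: Qt_inv.
- rewrite [X 0 ^+ _](_ : _ = X 0 ^+ (N.+1 - b0)) // scyc_Qt //; last first.
    by move: bN => /= /andP[].
  have /= /andP[_ bN'] := bN.
  case: ifP => b0l; last by rewrite mulr0 iter_scyc0.
  rewrite mulrCA iter_scyc_invl; last exact: inv_from_sign.
  have b0b : all (fun x => b0 < x)%N b by exact: order_path_min ltn_trans sb.
  rewrite IH ?(path_sorted sb) // ?rem_filter ?sorted_filter ?mem_filter ?(negbTE l0) ?andbF //;
    try exact: gtn_trans.
  have -> : all (fun x => x \in [seq y <- lam | predC1 b0 y]) b = all (fun x => x \in lam) b.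
    apply: eq_in_all => x xb; rewrite mem_filter /= gtn_eqF ?(allP b0b) //.
  case: ifP => bl; last by rewrite mulr0.
  rewrite mulrA -exprD big_cons; congr ((-1) ^+ (_ + _)%N * _).
    apply: eq_big_seq => x xb; rewrite -rem_filter //.
    by apply: index_rem_gt => //; [exact: (allP b0b)|exact: (allP bl)].
  congr (Qt _ _); rewrite -filter_predI; apply: eq_filter => x.
  by rewrite /= inE negb_or andbC.
- move=> r rN; case: (ltnP r (size (b0 :: b))) => rb.
    by rewrite (nth_map 0%N) //; have := nthN r rb; lia.
  by rewrite nth_default // size_map.
- by rewrite nth_default // size_map.
Qed.

End SignedDividedDifferences.

(** * Antisymmetric sums and determinants *)

Lemma strictDE n beta :
  (beta \in strictD n) = sorted gtn beta && all (fun x => 0 < x <= n)%N beta.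
Proof.
rewrite mem_strictD /strict_partition -andbA; case sb: (sorted gtn beta) => //=.
apply/andP/idP => [[b0 /forallP ct]|/allP H].
  apply/allP => x xb; rewrite lt0n; apply/andP; split; first by apply: contraNneq b0 => <-.
  have ix : (index x beta < size beta)%N by rewrite index_mem.
  by have := ct (Ordinal ix); rewrite /= nth_index // nth_rho; lia.
split; first by apply/negP => /H.
apply/forallP => -[i ilt] /=; rewrite nth_rho.
suff : (nth 0 beta i + i <= n)%N by lia.
elim: i ilt => [|i IH] ilt.
  by have /andP[_] := H _ (mem_nth 0%N ilt); rewrite addn0.
have := sortedP 0%N sb _ ilt; have := IH (ltnW ilt) => /=; lia.
Qed.

Section Antisymmetric.
Variables (R : idomainType) (k : nat) (F : ('I_k -> nat) -> R).
Hypotheses (Fext : forall b b', b =1 b' -> F b = F b')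
  (Fadj : forall (i j : 'I_k) b, j = i.+1 :> nat -> F (fun l => b (tperm i j l)) = - F b)
  (two_neq0 : 2%:R != 0 :> R).

(** Adjacent transpositions generate: conjugating by the transposition of j - 1 and j
    brings (i j) to (i j-1). *)
Lemma antisym_perm (t : 'S_k) b : F (fun l => b (t l)) = (-1) ^+ t * F b.
Proof.
pose H (t : 'S_k) := forall b, F (fun l => b (t l)) = (-1) ^+ t * F b.
have H1 : H 1%g.
  by move=> c; rewrite odd_perm1 mul1r; apply: Fext => l; rewrite perm1.
have HM t1 t2 : H t1 -> H t2 -> H (t1 * t2)%g.
  move=> h1 h2 c; rewrite odd_permM signr_addb -mulrA -h2 -(h1 (fun l => c (t2 l))).
  by apply: Fext => l; rewrite permM.
have Hlt (i j : 'I_k) : (i < j)%N -> H (tperm i j).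
  have [m] := ubnP (j - i); elim: m j => // m IH j jm ij.
  case: (eqVneq (j : nat) i.+1) => [ji|ji].
    by move=> c; rewrite Fadj // odd_tperm -val_eqE /= ltn_eqF // mulN1r.
  have clt : (j.-1 < k)%N by apply: leq_ltn_trans (ltn_ord j); exact: leq_pred.
  pose c := Ordinal clt.
  have cj : H (tperm c j).
    move=> e; rewrite Fadj /=; last by lia.
    by rewrite odd_tperm -val_eqE /= (_ : j.-1 == j = false) ?mulN1r //; lia.
  have ic : H (tperm i c) by apply: IH => /=; lia.
  have -> : tperm i j = (tperm c j * tperm i c * tperm c j)%g; last by apply: (HM) => //; apply: (HM).
  have E : (tperm i c ^ tperm c j)%g = tperm i j.
    by rewrite tpermJ tpermL tpermD // -val_eqE /=; lia.
  by rewrite -E conjgE tpermV mulgA.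
have Hneq (i j : 'I_k) : i != j -> H (tperm i j).
  rewrite -val_eqE neq_ltn => /orP[]; first exact: Hlt.
  by rewrite tpermC; exact: Hlt.
suff : H t by exact.
have [ts -> dts] := prod_tpermP t; elim: ts dts => [|p ts IH] /=.
  by rewrite big_nil.
by case/andP=> dp /IH Hts; rewrite big_cons; apply: (HM) => //; exact: Hneq.
Qed.

Lemma antisym_noninj b (i j : 'I_k) : i != j -> b i = b j -> F b = 0.
Proof.
move=> ij bij; have E : F b = - F b.
  have := antisym_perm (tperm i j) b; rewrite odd_tperm ij expr1 mulN1r => <-.
  by apply: Fext => l; case: tpermP => [->|->|].
have : 2%:R * F b = 0 by rewrite mulr_natl mulr2n {2}E subrr.
by move/eqP; rewrite mulf_eq0 (negbTE two_neq0) => /eqP.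
Qed.

(** The terms in which [b] repeats a value or takes the value 0 vanish.  The others are
    grouped by the set of their values, which is a strict partition [beta]; the terms
    of one group differ by permutations, and their signs make up the determinant. *)
Lemma antisym_sum n (c : 'I_k -> nat -> R) : (forall j, c j 0%N = 0) ->
  \sum_(b : {ffun 'I_k -> 'I_n.+1}) (\prod_j c j (b j)) * F (fun j => b j) =
  \sum_(beta <- strictD n | size beta == k)
    \det (\matrix_(i < k, j < k) c j (nth 0%N beta i)) * F (fun j => nth 0%N beta j).
Proof.
move=> c0; pose vals (b : {ffun 'I_k -> 'I_n.+1}) := [seq val (b j) | j <- enum 'I_k].
have szv b : size (vals b) = k by rewrite size_map size_enum_ord.
have nth_vals b (j : 'I_k) : nth 0%N (vals b) j = b j.
  by rewrite (nth_map j) ?size_enum_ord // nth_ord_enum.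
pose G (b : {ffun 'I_k -> 'I_n.+1}) := (\prod_j c j (b j)) * F (fun j => b j).
(* Group the functions by the strict partition formed by their values. *)
transitivity (\sum_(beta <- strictD n | size beta == k)
    \sum_(b | perm_eq (vals b) beta) G b).
  rewrite (exchange_big_dep xpredT) //=; apply: eq_bigr => b _; rewrite -/(G b).
  pose beta := sort geq (vals b).
  have pb : perm_eq (vals b) beta by rewrite perm_sym perm_sort.
  have szb : size beta == k by rewrite size_sort szv.
  have uniq_beta beta' : beta' \in strictD n -> perm_eq (vals b) beta' -> beta' = beta.
    rewrite strictDE => /andP[sb' _] pb'.
    have pbb : perm_eq beta' beta by rewrite -(permPl pb').
    apply: (irr_sorted_eq gtn_trans gtn_irr sb'); last exact: perm_mem.
    rewrite gtn_sorted_uniq_geq -(perm_uniq pbb) (sorted_uniq gtn_trans gtn_irr sb') /=.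
    by apply: sort_sorted => x y; exact: leq_total.
  case: (boolP (beta \in strictD n)) => betaD.
    rewrite big_mkcond (bigD1_seq beta) ?uniq_strictD //= szb pb /=.
    rewrite big1_seq ?addr0 // => beta' /andP[ne b'D].
    case: ifP => // /andP[_ /(uniq_beta _ b'D) E].
    by rewrite E eqxx in ne.
  rewrite [RHS]big1_seq => [|beta' /andP[/andP[_ pb'] b'D]]; last first.
    by rewrite -(uniq_beta _ b'D pb') b'D in betaD.
  case: (pickP (fun j => val (b j) == 0%N)) => [j /eqP bj0|nz].
    by rewrite /G (bigD1 j) //= bj0 c0 !mul0r.
  rewrite /G; suff -> : F (fun j => b j) = 0 by rewrite mulr0.
  have : ~~ injectiveb b.
    apply: contra betaD => /injectiveP binj; rewrite strictDE gtn_sorted_uniq_geq.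
    rewrite -(perm_uniq pb) map_inj_uniq ?enum_uniq; last first.
      by move=> i j /val_inj /binj.
    rewrite (sort_sorted (leT := geq)) => [|x y]; last exact: leq_total.
    apply/allP => x; rewrite -(perm_mem pb) => /mapP[j _ ->].
    by rewrite lt0n -ltnS ltn_ord andbT; apply/negbT/nz.
  case/injectivePn => i [j ij bij]; apply: (@antisym_noninj _ i j) => //.
  by rewrite bij.
rewrite big_seq_cond [RHS]big_seq_cond; apply: eq_bigr => beta /andP[].
rewrite strictDE => /andP[sb bN] szb'; have szb := eqP szb'.
(* The group of [beta] is parametrized by permutations; [inord] is exact since the parts
   are at most n. *)
pose h (t : 'S_k) : {ffun 'I_k -> 'I_n.+1} := [ffun j => inord (nth 0%N beta (t j))].
have hE t j : h t j = nth 0%N beta (t j) :> nat.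
  rewrite ffunE inordK // ltnS.
  have tb : (t j < size beta)%N by rewrite szb.
  by have /andP[] := allP bN _ (mem_nth 0%N tb).
have valsh t : vals (h t) = [tuple tnth (Tuple szb') (t j) | j < k].
  apply: (@eq_from_nth _ 0%N) => [|j]; first by rewrite szv size_tuple.
  rewrite szv => jk; rewrite (nth_map (Ordinal jk)) ?size_enum_ord //.
  rewrite (nth_ord_enum _ (Ordinal jk)); apply: etrans (hE _ _) _.
  by rewrite -[j in RHS]/(val (Ordinal jk)) -tnth_nth tnth_mktuple (tnth_nth 0%N).
have h_inj : injective h.
  move=> t u E; apply/permP => j; apply/val_inj/eqP.
  rewrite -(nth_uniq 0%N (s := beta)) ?szb ?ltn_ord ?(sorted_uniq gtn_trans gtn_irr sb) //.
  by rewrite -!hE E.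
rewrite (reindex_omap h (fun b => [pick t | h t == b])) /=; last first.
  move=> b pb; have /tuple_permP[t Et] : perm_eq (vals b) (Tuple szb') by [].
  have hb : h t = b.
    have Ev : vals (h t) = vals b by rewrite valsh Et.
    apply/ffunP => j; apply: val_inj.
    by have := congr1 (fun z => nth 0%N z j) Ev; rewrite !nth_vals.
  by case: pickP => [u /eqP/= ->//|/(_ t)]; rewrite hb eqxx.
rewrite -det_tr /determinant mulr_suml; apply: eq_big => [t|t _].
  have pt : perm_eq (vals (h t)) (Tuple szb') by apply/tuple_permP; exists t.
  rewrite [perm_eq _ _]pt.
  by case: pickP => [u /eqP/h_inj ->|/(_ t)]; rewrite eqxx.
rewrite /G [RHS]mulrAC [RHS]mulrC; congr (_ * _).
  by apply: eq_bigr => j _; rewrite !mxE hE.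
rewrite -(antisym_perm t (fun j => nth 0%N beta j)).
by apply: Fext => j; rewrite hE.
Qed.

End Antisymmetric.

(** * Strict partitions and signs *)

Lemma gtn_sorted_ltn_nth (s : seq nat) b i : sorted gtn s ->
  (b < nth 0 s i)%N = (i < count (fun z => b < z)%N s)%N.
Proof.
elim: s i => [|a t IH] i /=; first by rewrite nth_nil !ltn0.
move=> pt; have := order_path_min gtn_trans pt => /allP ta.
case: (ltnP b a) => ab.
  by case: i => [|i] /=; rewrite ?ab // IH ?(path_sorted pt).
have c0 : count (fun z => b < z)%N t = 0%N.
  by apply/eqP; rewrite -leqn0 leqNgt -has_count; apply/hasPn => z /ta /=; lia.
rewrite c0 ltn0; case: i => [|i] /=; first by rewrite ltnNge ab.
by rewrite IH ?(path_sorted pt) // c0.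
Qed.

Lemma gtn_sorted_index (s : seq nat) x : sorted gtn s -> x \in s ->
  index x s = count (fun z => x < z)%N s.
Proof.
elim: s => //= a t IH pt; have := order_path_min gtn_trans pt => /allP ta.
rewrite inE; case: (eqVneq a x) => [<- _|ax /= xt].
  rewrite ltnn add0n; apply/esym/eqP; rewrite -leqn0 leqNgt -has_count.
  by apply/hasPn => z /ta /=; lia.
by rewrite IH ?(path_sorted pt) //; have -> : (x < a)%N by exact: ta.
Qed.

(** The only nonzero term is the one of the gap of [alpha] that contains [b]. *)
Lemma sum_count_gap (alpha : seq nat) b : sorted gtn alpha -> (0 < b)%N -> b \notin alpha ->
  (\sum_(1 <= i < (size alpha).+1) i * (nth 0 alpha i < b < nth 0 alpha i.-1))%N =
  count (fun z => b < z)%N alpha.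
Proof.
move=> sa b0 ba; set c := count _ _.
have cs : (c <= size alpha)%N by exact: count_size.
have E i : (0 < i)%N -> (nth 0 alpha i < b < nth 0 alpha i.-1)%N = (i == c).
  move=> i0; rewrite gtn_sorted_ltn_nth // -/c.
  have -> : (nth 0 alpha i < b)%N = (c <= i)%N; last by lia.
  rewrite [RHS]leqNgt -gtn_sorted_ltn_nth // -leqNgt [RHS]leq_eqVlt.
  case: eqP => // nb; case: (ltnP i (size alpha)) => il.
    by move: ba; rewrite -nb mem_nth.
  by move: b0; rewrite -nb nth_default.
rewrite (eq_big_nat _ _ (F2 := fun i => i * (i == c))%N); last first.
  by move=> i /andP[i0 _]; rewrite E.
case: (posnP c) => [c0|c0].
  by rewrite c0; apply: big1_seq => i; rewrite mem_index_iota => /andP[_ /andP[i0 _]]; rewrite gtn_eqF ?muln0.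
rewrite (bigD1_seq c) ?iota_uniq ?mem_index_iota ?c0 ?ltnS //= eqxx muln1.
by rewrite big1 ?addn0 // => i /negbTE ->; rewrite muln0.
Qed.

(** A part of beta that lies in the i-th gap of alpha has exactly i parts of alpha above
    it ([sum_count_gap]). *)
Lemma excess2E alpha beta n : alpha \in strictD n -> beta \in strictD n ->
  pdisjoint alpha beta ->
  excess2 alpha beta = (\sum_(b <- beta) count (fun z => b < z)%N alpha)%N.
Proof.
rewrite !strictDE => /andP[sa _] /andP[_ /allP bN] /hasPn dis.
have -> : (\sum_(b <- beta) count (fun z => b < z) alpha =
    \sum_(b <- beta) \sum_(1 <= i < (size alpha).+1)
      i * (nth 0 alpha i < b < nth 0 alpha i.-1))%N.
  apply: eq_big_seq => b bb; rewrite sum_count_gap //; last exact: dis.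
  by have /andP[] := bN b bb.
rewrite exchange_big /excess2; apply: eq_bigr => i _.
rewrite -big_distrr /= /gapcount; congr (_ * _)%N.
by rewrite -sum1_count big_mkcond; apply: eq_bigr => b _; case: ifP.
Qed.

Lemma pcup_perm alpha beta : perm_eq (pcup alpha beta) (alpha ++ beta).
Proof. by rewrite perm_sort. Qed.

Lemma mem_pcup alpha beta x : (x \in pcup alpha beta) = (x \in alpha) || (x \in beta).
Proof. by rewrite (perm_mem (pcup_perm _ _)) mem_cat. Qed.

Lemma pcup_strictD n alpha beta : alpha \in strictD n -> beta \in strictD n ->
  pdisjoint alpha beta -> pcup alpha beta \in strictD n.
Proof.
rewrite !strictDE => /andP[sa aN] /andP[sb bN] dis.
rewrite gtn_sorted_uniq_geq (perm_uniq (pcup_perm _ _)) cat_uniq.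
rewrite (sorted_uniq gtn_trans gtn_irr sa) (sorted_uniq gtn_trans gtn_irr sb).
have -> : ~~ has (mem alpha) beta by [].
rewrite (perm_all _ (pcup_perm _ _)) all_cat aN bN /= !andbT.
by apply: sort_sorted => x y; exact: leq_total.
Qed.

Lemma strictD_eq n alpha beta : alpha \in strictD n -> beta \in strictD n ->
  alpha =i beta -> alpha = beta.
Proof.
rewrite !strictDE => /andP[sa _] /andP[sb _].
exact: irr_sorted_eq gtn_trans gtn_irr _ _ sa sb.
Qed.

Lemma filter_strictD n (P : pred nat) lam : lam \in strictD n ->
  [seq x <- lam | P x] \in strictD n.
Proof.
rewrite !strictDE => /andP[sl lN]; rewrite sorted_filter //=; last exact: gtn_trans.
by rewrite all_filter; apply: sub_all lN => x /= ->; rewrite implybT.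
Qed.

Lemma pcup_filter n alpha beta : alpha \in strictD n -> beta \in strictD n ->
  pdisjoint alpha beta -> [seq x <- pcup alpha beta | x \notin beta] = alpha.
Proof.
move=> aD bD dis; apply: (@strictD_eq n) => //.
  exact/filter_strictD/pcup_strictD.
move=> x; rewrite mem_filter mem_pcup; case xb: (x \in beta) => /=; last by rewrite orbF.
by apply/esym/negbTE; have /hasPn/(_ x xb) := dis.
Qed.

Lemma filter_pcup n lam beta : lam \in strictD n -> beta \in strictD n ->
  {subset beta <= lam} -> pcup [seq x <- lam | x \notin beta] beta = lam.
Proof.
move=> lD bD sub; apply: (@strictD_eq n) => //.
  apply: pcup_strictD; rewrite ?filter_strictD //.
  by apply/hasPn => x xb /=; rewrite mem_filter xb.
move=> x; rewrite mem_pcup mem_filter; case xb: (x \in beta) => /=.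
  by rewrite ?orbT sub.
by rewrite orbF.
Qed.

(** Removing and adjoining the parts of [beta] are inverse bijections. *)
Lemma sum_strictD_pcup (V : nmodType) n beta (F : seq nat -> V) : beta \in strictD n ->
  \sum_(lam <- strictD n | all (fun x => x \in lam) beta) F lam =
  \sum_(alpha <- strictD n | pdisjoint alpha beta) F (pcup alpha beta).
Proof.
move=> bD; rewrite -big_filter -[RHS]big_filter.
rewrite -(big_map (fun alpha => pcup alpha beta) xpredT F).
apply/perm_big/uniq_perm.
- by rewrite filter_uniq // uniq_strictD.
- rewrite map_inj_in_uniq ?filter_uniq ?uniq_strictD // => a1 a2.
  rewrite !mem_filter => /andP[d1 D1] /andP[d2 D2] E.
  by rewrite -(pcup_filter D1 bD d1) E (pcup_filter D2 bD d2).
move=> lam; rewrite mem_filter; apply/andP/mapP.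
  case=> /allP sub lD; exists [seq x <- lam | x \notin beta]; last by rewrite (filter_pcup lD bD sub).
  rewrite mem_filter filter_strictD // andbT.
  by apply/hasPn => x xb /=; rewrite mem_filter xb.
case=> alpha; rewrite mem_filter => /andP[dis aD] ->; split; last exact: pcup_strictD.
by apply/allP => x xb; rewrite mem_pcup xb orbT.
Qed.

Lemma sum_index (s : seq nat) : uniq s -> (\sum_(x <- s) index x s = 'C(size s, 2))%N.
Proof.
move=> us; rewrite (big_nth 0%N) -bin2_sum; apply: eq_big_nat => i /andP[_ isz].
by rewrite index_uniq.
Qed.

(** The parts that precede a part of [beta] come from [alpha], which gives the excess,
    or from [beta] itself. *)
Lemma sum_index_pcup n alpha beta : alpha \in strictD n -> beta \in strictD n ->
  pdisjoint alpha beta ->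
  (\sum_(x <- beta) index x (pcup alpha beta) = excess2 alpha beta + 'C(size beta, 2))%N.
Proof.
move=> aD bD dis; have pD := pcup_strictD aD bD dis.
move: (pD) (bD); rewrite !strictDE => /andP[sp _] /andP[sb _].
rewrite (excess2E aD bD dis) -(sum_index (sorted_uniq gtn_trans gtn_irr sb)) -big_split.
apply: eq_big_seq => x xb; rewrite gtn_sorted_index ?mem_pcup ?xb ?orbT //.
by rewrite (seq.permP (pcup_perm _ _)) count_cat (gtn_sorted_index sb xb).
Qed.

Lemma pcompl_strictD n lam : pcompl n lam \in strictD n.
Proof.
apply: filter_strictD; rewrite strictDE sorted_rho /=.
by apply/allP => x; rewrite mem_rho.
Qed.

Lemma strictD_filter_rho n lam : lam \in strictD n -> [seq x <- rho n | x \in lam] = lam.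
Proof.
move=> lD; apply: (@strictD_eq n) => //.
  apply: filter_strictD; rewrite strictDE sorted_rho /=.
  by apply/allP => x; rewrite mem_rho.
move=> x; rewrite mem_filter; case xl: (x \in lam) => //=.
by move: lD; rewrite strictDE mem_rho => /andP[_ /allP/(_ x xl)].
Qed.

Lemma perm_pcompl n lam : lam \in strictD n -> perm_eq (lam ++ pcompl n lam) (rho n).
Proof.
by move=> lD; rewrite -[X in X ++ _](strictD_filter_rho lD) perm_filterC.
Qed.

Lemma sumn_rho n : sumn (rho n) = 'C(n.+1, 2).
Proof.
rewrite /rho sumn_rev; elim: n => // n IH.
have -> : iota 1 n.+1 = iota 1 n ++ [:: n.+1] by rewrite -(addn1 n) iotaD addnC.
by rewrite sumn_cat IH /= addn0 [RHS]binS bin1.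
Qed.

Lemma strictD_sumn n lam : lam \in strictD n -> ('C((size lam).+1, 2) <= sumn lam)%N.
Proof.
rewrite strictDE => /andP[sl /sub_all]; move/(_ (ltn 0)) => H.
have {H} : all (ltn 0) lam by apply: H => x /andP[].
suff : all (ltn 0) lam -> ('C((size lam).+1, 2) <= sumn lam)%N /\ (size lam <= nth 0 lam 0)%N.
  by move=> H /H[].
elim: lam sl => //= a t IH pt /andP[a0 t0].
have [IH1 IH2] := IH (path_sorted pt) t0.
have ha : (size t < a)%N.
  by case: t pt IH2 {IH IH1 t0} => //= c t /andP[ca _] IH2; exact: leq_ltn_trans IH2 ca.
by rewrite binS bin1; split; [lia|].
Qed.

(** Here [w] is the number of insertion letters.  With a = n(n-1)/2, b = k(k-1)/2 and
    l = n - k, both sides are reduced to the identity a = l(l-1)/2 + b + l k. *)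
Lemma sign_parity n lam w : lam \in strictD n ->
  (w + size (pcompl n lam) * n = 'C(n, 2) + sumn (pcompl n lam))%N ->
  odd ((n * n.-1)./2 + w + 'C(size (pcompl n lam), 2)) = odd (excess lam).
Proof.
move=> lD; have pp := perm_pcompl lD; set P := pcompl n lam; set k := size P => Ew.
have szE : (size lam + k = n)%N by have := perm_size pp; rewrite size_cat size_rho.
have smE : (sumn lam + sumn P = 'C(n.+1, 2))%N.
  by have := perm_sumn pp; rewrite sumn_cat sumn_rho.
have le := strictD_sumn lD.
have El : ((size lam * (size lam).+1)./2 = 'C((size lam).+1, 2))%N by rewrite bin2 mulnC.
rewrite /excess El -bin2; have C2 m : ('C(m.+1, 2) = 'C(m, 2) + m)%N by rewrite binS bin1.
have Cd m : ('C(m, 2).*2 + m = m * m)%N.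
  by rewrite bin2; elim: m => // m IHm; rewrite -bin2 C2 doubleD bin2; lia.
rewrite !C2 in smE le *; have := Cd n; have := Cd k; have := Cd (size lam).
move: szE Ew smE le; clearbody k; move: (size lam) (sumn lam) (sumn P) => l sl sP.
move: ('C(n, 2)) ('C(k, 2)) ('C(l, 2)) => a b c nE; rewrite -nE => Ew smE le Hl Hk Hn.
have Ea : a = (c + b + l * k)%N by lia.
lia.
Qed.

(** * Values on products of a monomial and the kernel *)

Lemma prod_sub_elem_sym (R : idomainType) (x : R) (s : seq R) :
  \prod_(c <- s) (x - c) =
  \sum_(t < (size s).+1) (-1) ^+ t * elem_sym s t%:Z * x ^+ (size s - t).
Proof.
pose p := \prod_(c <- s) ('X - c%:P).
have szp : size p = (size s).+1 by rewrite size_prod_XsubC.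
have -> : \prod_(c <- s) (x - c) = p.[x].
  by rewrite horner_prod; apply: eq_bigr => c _; rewrite hornerXsubC.
rewrite horner_coef szp (reindex_inj rev_ord_inj) /=; apply: eq_bigr => t _.
have ts : (t <= size s)%N by rewrite -ltnS.
by rewrite subSS elem_sym_coef // mulrA -exprMn mulrNN mulr1 expr1n mul1r.
Qed.

(** The summation index is the complement of the exponent, so that all rows are
    expanded over the same range; the terms with b < p vanish. *)
Lemma prod_sub_elem_sym_shift (R : idomainType) (x : R) (s : seq R) n p :
  (size s + p = n)%N ->
  \prod_(c <- s) (x - c) =
  \sum_(b < n.+1) (-1) ^+ (b + p) * elem_sym s (b%:Z - p%:Z) * x ^+ (n - b).
Proof.
move=> En; rewrite prod_sub_elem_sym -(big_mkord xpredT (fun t => (-1) ^+ t * elem_sym s t%:Z * x ^+ (size s - t))).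
rewrite -(big_mkord xpredT (fun b => (-1) ^+ (b + p) * elem_sym s (b%:Z - p%:Z) * x ^+ (n - b))).
rewrite [RHS](@big_cat_nat _ _ _ p) //=; last by lia.
rewrite [X in _ = X + _]big1_seq ?add0r; last first.
  move=> b /andP[_]; rewrite mem_index_iota => bp.
  by rewrite elem_symN ?mulr0 ?mul0r //; lia.
rewrite -{1}[p]add0n big_addn; have -> : (n.+1 - p)%N = (size s).+1 by lia.
apply: eq_big_nat => t ts; rewrite -addnA exprD addnn -[(-1) ^+ p.*2]signr_odd odd_double mulr1.
rewrite PoszD addrK; congr (_ * _ ^+ _); lia.
Qed.

(** If a part of [P] exceeds the corresponding part of [beta], the matrix has a block of
    zeros which is too large for any permutation to avoid. *)
Lemma det_not_contained (R : comNzRingType) n k (P beta : seq nat) (c : nat -> nat -> R) :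
  beta \in strictD n -> P \in strictD n -> size P = k -> size beta == k ->
  (forall p b, (b < p)%N -> c p b = 0) -> ~~ pcontained P beta ->
  \det (\matrix_(i < k, j < k) c (nth 0%N P j) (nth 0%N beta i)) = 0.
Proof.
rewrite !strictDE => /andP[sb _] /andP[sP _] szP /eqP szb c0.
case/forallPn => -[i0 i0P] /=; rewrite -ltnNge => lt.
have i0k : (i0 < k)%N by rewrite -szP.
have mono_nth (s : seq nat) a b : sorted gtn s -> (a <= b)%N -> (nth 0 s b <= nth 0 s a)%N.
  move=> ss ab; rewrite leqNgt gtn_sorted_ltn_nth //; apply/negP => bc.
  have := leq_ltn_trans ab bc.
  by rewrite -(gtn_sorted_ltn_nth (nth 0%N s a) a ss) ltnn.
rewrite /determinant big1 // => t _.
suff [i ii0 ti0] : exists2 i : 'I_k, (i0 <= i)%N & (t i <= i0)%N.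
  rewrite (bigD1 i) //= mxE c0 ?mul0r ?mulr0 //.
  apply: leq_ltn_trans (mono_nth _ _ _ sb ii0) _; apply: leq_trans lt _.
  exact: mono_nth.
(* Otherwise t would map the k - i0 indices i >= i0 into the k - i0 - 1 indices > i0. *)
apply/exists_inP; apply: contraT; rewrite negb_exists_in => /forall_inP H.
pose A := [set i : 'I_k | (i0 <= i)%N]; pose B := [set i : 'I_k | (i0 < i)%N].
have sub : t @: A \subset B.
  by apply/subsetP => _ /imsetP[i + ->]; rewrite !inE => /H; rewrite -ltnNge.
have := subset_leq_card sub; rewrite card_imset; last exact: perm_inj.
have -> : A = Ordinal i0k |: B.
  by apply/setP => i; rewrite !inE -val_eqE /= leq_eqVlt eq_sym.
by rewrite cardsU1 inE /= ltnn add1n ltnn.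
Qed.

Section KernelEvaluation.
Variables (R : idomainType) (N : nat) (W : typeB_action R N) (y : nat -> R).
Hypothesis y_const : forall j, inv_from W 0 (y j).

Local Notation X := (xv W).
Local Notation s := (sv W).
Local Notation n := N.+1.

Definition Ysq : seq R := [seq y j | j <- iota 0 n].
Definition Xsq : seq R := Xfrom W 0.

Lemma const_map j l : (j <= N)%N -> [seq s j x | x <- [seq y i | i <- l]] = [seq y i | i <- l].
Proof. by move=> jN; rewrite -map_comp; apply: eq_map => i /=; rewrite y_const. Qed.

Lemma take_Ysq m : (m <= n)%N -> take m Ysq = [seq y j | j <- iota 0 m].
Proof. by move=> mn; rewrite /Ysq -map_take take_iota (minn_idPl mn). Qed.

Lemma Qt_Ysq_const lam : inv_from W 0 (Qt Ysq lam).
Proof. by move=> j jN; rewrite rmorph_Qt const_map //; case/andP: jN. Qed.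

Lemma elem_sym_const m c : (m <= n)%N -> inv_from W 0 (elem_sym (take m Ysq) c).
Proof.
by move=> mn j /andP[_ jN]; rewrite rmorph_elem_sym take_Ysq // const_map.
Qed.

Definition Qt_kernel : R := \sum_(lam <- strictD n) Qt Xsq lam * Qt Ysq (pcompl n lam).

Lemma Qt_kernel_inv : inv_from W 1 Qt_kernel.
Proof.
move=> j jN; rewrite rmorph_sum; apply: eq_bigr => lam _.
by rewrite rmorphM (Qt_inv W lam jN) Qt_Ysq_const //; lia.
Qed.

(** The first variable goes with the smallest part. *)
Definition rev_mono (beta : seq nat) : R :=
  mono W (fun r => nth 0%N [seq (n - x)%N | x <- rev beta] r).

Lemma iter_scyc_sum k I (r : seq I) (P : pred I) (F : I -> R) :
  iter k (scyc W) (\sum_(i <- r | P i) F i) = \sum_(i <- r | P i) iter k (scyc W) (F i).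
Proof. by apply: (big_morph (iter k (scyc W))) => [f g|]; [exact: iter_scycD|exact: iter_scyc0]. Qed.

Lemma iter_scyc_Qt_kernel beta : beta \in strictD n ->
  iter (size beta) (scyc W) (rev_mono beta * Qt_kernel) =
  \sum_(alpha <- strictD n | pdisjoint alpha beta)
    (-1) ^+ (excess2 alpha beta + 'C(size beta, 2)) *
      (Qt Xsq alpha * Qt Ysq (pcompl n (pcup alpha beta))).
Proof.
move=> bD; have := bD; rewrite strictDE => /andP[sb bN].
rewrite /Qt_kernel big_distrr /= iter_scyc_sum.
transitivity (\sum_(lam <- strictD n | all (fun x => x \in lam) beta)
  (-1) ^+ (\sum_(x <- beta) index x lam) *
  (Qt Xsq [seq x <- lam | x \notin beta] * Qt Ysq (pcompl n lam))).
  rewrite [RHS]big_mkcond /=; apply: eq_big_seq => lam lD.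
  move: (lD); rewrite strictDE => /andP[sl lN].
  have -> : rev_mono beta * (Qt Xsq lam * Qt Ysq (pcompl n lam)) =
     Qt Ysq (pcompl n lam) * (rev_mono beta * Qt Xsq lam) by ring.
  rewrite iter_scyc_invl; last exact: Qt_Ysq_const.
  rewrite -(size_rev beta) iter_scyc_Qt ?all_rev ?rev_sorted //; last first.
    by apply/negP => /(allP lN).
  case: ifP => _; last by rewrite mulr0.
  rewrite mulrC -mulrA (perm_big beta) ?perm_rev //=; congr (_ * (Qt _ _ * _)).
  by apply: eq_filter => x; rewrite mem_rev.
rewrite sum_strictD_pcup // big_seq_cond [RHS]big_seq_cond.
apply: eq_bigr => alpha /andP[aD dis].
by rewrite (sum_index_pcup aD bD dis) (pcup_filter aD bD dis).
Qed.

(** The exponent of the variable X_{k-1-j} is given by [b j], in the order of the parts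
    of a partition. *)
Definition rev_mono_ord k (b : 'I_k -> nat) : R := \prod_(j < k) X (k - j.+1) ^+ (n - b j).

Lemma rev_mono_ordE k beta : size beta = k -> (k <= n)%N ->
  rev_mono_ord (fun j : 'I_k => nth 0%N beta j) = rev_mono beta.
Proof.
move=> szb kn; rewrite /rev_mono /mono (@big_cat_nat _ _ _ k) //=.
rewrite [X in _ * X]big1_seq ?mulr1; last first.
  move=> r /andP[_]; rewrite mem_index_iota => /andP[kr _].
  by rewrite nth_default ?expr0 // size_map size_rev szb.
rewrite big_mkord (reindex_inj rev_ord_inj) /=; apply: eq_bigr => j _.
have jk := ltn_ord j.
rewrite (nth_map 0%N) ?size_rev ?szb; last by lia.
rewrite nth_rev ?szb; last by lia.
by congr (_ ^+ (_ - nth _ _ _)); lia.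
Qed.

Section MonomialAntisymmetry.
Variables (k : nat) (S : R).
Hypotheses (kn : (k <= n)%N) (S_inv : inv_from W 1 S).

Definition iter_scyc_monomial (b : 'I_k -> nat) : R :=
  (\prod_j (-1) ^+ b j) * iter k (scyc W) (rev_mono_ord b * S).

Lemma iter_scyc_monomial_ext b b' : b =1 b' -> iter_scyc_monomial b = iter_scyc_monomial b'.
Proof.
move=> E; rewrite /iter_scyc_monomial /rev_mono_ord; congr (_ * iter _ _ (_ * _)).
  by apply: eq_bigr => j _; rewrite E.
by apply: eq_bigr => j _; rewrite E.
Qed.

(** The exchange of two neighbouring exponents is the action of a reflection s_m with
    0 < m < k, to which [iter_scyc_s] applies. *)
Lemma iter_scyc_monomial_adj (i j : 'I_k) b : j = i.+1 :> nat ->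
  iter_scyc_monomial (fun l => b (tperm i j l)) = - iter_scyc_monomial b.
Proof.
move=> ji; have jk := ltn_ord j; rewrite /iter_scyc_monomial -mulrN.
have <- : \prod_l (-1) ^+ b (tperm i j l) = \prod_l (-1) ^+ b l :> R.
  by rewrite [RHS](reindex_inj (@perm_inj _ (tperm i j))).
(* The exponents indexed by i and j = i + 1 belong to X_m and X_{m-1}. *)
pose m := (k - j)%N; have mN : (m <= N)%N by rewrite /m; lia.
rewrite -(@iter_scyc_s _ _ _ k m) ?rmorphM ?S_inv //; try (rewrite /m; lia).
congr (_ * iter _ _ (_ * _)).
rewrite /rev_mono_ord rmorph_prod [RHS](reindex_inj (@perm_inj _ (tperm i j))) /=.
apply: eq_bigr => l _; rewrite rmorphXn /=; congr (_ ^+ _).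
case: tpermP => [->|->|/eqP li /eqP lj].
- by rewrite (_ : k - j.+1 = m.-1)%N ?sXl ?/m; [congr X| |]; lia.
- by rewrite (_ : k - i.+1 = m)%N ?sXr ?/m; [congr X| |]; lia.
have lk := ltn_ord l; move: li lj; rewrite -!val_eqE /= => li lj.
case: (ltnP l i) => lti.
  by rewrite sX_high //; rewrite /m; lia.
by rewrite sX_low //; rewrite /m; lia.
Qed.

End MonomialAntisymmetry.

(** Each row product is expanded in powers of its variable; the value of the operators
    on the monomials is antisymmetric in the exponents. *)
Lemma iter_scyc_prod (P : seq nat) : P \in strictD n ->
  iter (size P) (scyc W) ((\prod_(j < size P) \prod_(c <- take (n - nth 0%N P j) Ysq)
      (X (size P - j.+1) - c)) * Qt_kernel) =
  \sum_(beta <- strictD n | size beta == size P)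
    (-1) ^+ (sumn P + sumn beta) *
    \det (\matrix_(i < size P, j < size P)
       elem_sym (take (n - nth 0%N P j) Ysq) ((nth 0%N beta i)%:Z - (nth 0%N P j)%:Z)) *
    iter (size P) (scyc W) (rev_mono beta * Qt_kernel).
Proof.
move=> PD; set k := size P; move: (PD); rewrite strictDE => /andP[sP /allP PN].
have Pj (j : 'I_k) : (0 < nth 0%N P j <= n)%N by apply/PN/mem_nth.
have kn : (k <= n)%N.
  rewrite -(size_rho n); apply: uniq_leq_size; first exact: sorted_uniq gtn_trans gtn_irr _ sP.
  by move=> x /PN; rewrite mem_rho.
pose c (j : 'I_k) b := elem_sym (take (n - nth 0%N P j) Ysq) (b%:Z - (nth 0%N P j)%:Z).
have E (j : 'I_k) : \prod_(a <- take (n - nth 0%N P j) Ysq) (X (k - j.+1) - a) =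
    \sum_(b < n.+1) (-1) ^+ (b + nth 0%N P j) * c j b * X (k - j.+1) ^+ (n - b).
  apply: prod_sub_elem_sym_shift; have := Pj j.
  by rewrite size_takel ?size_map ?size_iota; lia.
under eq_bigr => j _ do rewrite E.
rewrite bigA_distr_bigA /= big_distrl /= iter_scyc_sum.
transitivity ((-1) ^+ sumn P * \sum_(b : {ffun 'I_k -> 'I_n.+1})
   (\prod_j c j (b j)) * iter_scyc_monomial Qt_kernel (fun j => b j)).
  rewrite big_distrr; apply: eq_bigr => b _; rewrite /iter_scyc_monomial.
  have -> : \prod_(j < k) ((-1) ^+ (b j + nth 0%N P j) * c j (b j) * X (k - j.+1) ^+ (n - b j))
      = ((-1) ^+ sumn P * (\prod_(j < k) c j (b j)) * \prod_(j < k) (-1) ^+ b j)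
        * rev_mono_ord (fun j => b j) :> R.
    rewrite /rev_mono_ord !big_split /=; congr (_ * _); rewrite mulrAC; congr (_ * _).
    have -> : (-1) ^+ sumn P = \prod_(j < k) (-1) ^+ nth 0%N P j :> R.
      by rewrite sumnE (big_nth 0%N) big_mkord expr_sum.
    by rewrite -big_split /=; apply: eq_bigr => j _; rewrite exprD mulrC.
  rewrite -[_ * rev_mono_ord _ * _]mulrA iter_scyc_invl; first by rewrite -!mulrA.
  apply: inv_fromM; first apply: inv_fromM.
  - exact: inv_from_sign.
  - by apply: inv_from_prod => j _; apply: elem_sym_const; rewrite leq_subr.
  - by apply: inv_from_prod => j _; apply: inv_from_sign.
(* The characteristic is not 2, since 2 X_0 is not zero. *)
have two0 : 2%:R != 0 :> R.
  by have := typeB_x2 W (leq0n N); apply: contraNneq => ->; rewrite mul0r.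
rewrite (antisym_sum (iter_scyc_monomial_ext _) (iter_scyc_monomial_adj kn Qt_kernel_inv) two0); last first.
  by move=> j; apply: elem_symN; have := Pj j; lia.
rewrite big_distrr /=; apply: eq_bigr => beta /eqP szb.
rewrite /iter_scyc_monomial rev_mono_ordE // exprD.
have -> : \prod_(j < k) (-1) ^+ nth 0%N beta j = (-1) ^+ sumn beta :> R.
  by rewrite sumnE (big_nth 0%N) big_mkord szb expr_sum.
by rewrite -[X in \det X]/(\matrix_(i < k, j < k) c j (nth 0%N beta i)); ring.
Qed.

End KernelEvaluation.

(** * Divided differences of the staircase product *)

Lemma size_insertion_word (Q : pred nat) m :
  (size (insertion_word Q m) + count_upto Q m * m = 'C(m, 2) + sumn (filter Q (iota 1 m)))%N.
Proof.
elim: m => // m IH; rewrite [insertion_word Q m.+1]/= size_cat size_iota.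
have iS : iota 1 m.+1 = rcons (iota 1 m) m.+1 by rewrite -(addn1 m) iotaD cats1 addnC.
have cm : (count_upto Q m <= m)%N by have := count_size Q (iota 1 m); rewrite size_iota.
have -> : count_upto Q m.+1 = (count_upto Q m + Q m.+1)%N.
  by rewrite /count_upto iS -cats1 count_cat /= addn0.
rewrite iS filter_rcons binS bin1.
case: (Q m.+1); rewrite ?sumn_rcons; move: IH cm; move: (count_upto Q m) => c IH cm; lia.
Qed.

Lemma count_upto_compl (Q : pred nat) n M : (M <= n)%N ->
  (count_upto Q M + count (fun z => M < z) [seq x <- rho n | Q x] = size [seq x <- rho n | Q x])%N.
Proof.
move=> Mn; rewrite size_filter count_filter /rho !count_rev /count_upto.
have -> : iota 1 n = iota 1 M ++ iota M.+1 (n - M) by rewrite -add1n -iotaD subnKC.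
rewrite !count_cat.
have -> : count (predI (fun z => M < z)%N Q) (iota 1 M) = 0%N.
  apply/eqP; rewrite -leqn0 leqNgt -has_count; apply/hasPn => z; rewrite mem_iota /=; lia.
congr (_ + _)%N; apply: eq_in_count => z; rewrite mem_iota /= => /andP[-> _].
by [].
Qed.

Section Delta.
Variables (R : idomainType) (N : nat) (W : typeB_action R N) (y : nat -> R).
Hypothesis y_const : forall j, inv_from W 0 (y j).

Local Notation X := (xv W).
Local Notation s := (sv W).
Local Notation d := (dv W).
Local Notation n := N.+1.

(** With h = N - j, the factors of Delta that involve y_j. *)
Definition column h j : R := \prod_(0 <= i < h) (X i - y j).

Lemma s_y h j : (h <= N)%N -> s h (y j) = y j.
Proof. by move=> hN; apply: y_const. Qed.

(** A column contains both of the variables exchanged by s_h or neither, unless it has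
    exactly h boxes. *)
Lemma column_inv h h' j : (0 < h <= N)%N -> (h' <= n)%N -> h != h' -> s h (column h' j) = column h' j.
Proof.
move=> hN h'N hh'; rewrite /column rmorph_prod /=.
case: (ltnP h' h) => lt.
  by apply: eq_big_nat => i ih; rewrite rmorphB sX_low ?s_y //; lia.
rewrite !(@big_cat_nat _ _ _ h.-1 0 h') //=; try lia.
congr (_ * _).
  by apply: eq_big_nat => i ih; rewrite rmorphB sX_low ?s_y //; lia.
have -> : h.-1 = (h - 1)%N by lia.
rewrite !(@big_ltn _ _ _ (h - 1)%N); try lia.
have -> : (h - 1).+1%N = h by lia.
rewrite !(@big_ltn _ _ _ h); try lia.
rewrite !rmorphB !s_y; try lia.
rewrite subn1 sXl // sXr // mulrCA; congr (_ * (_ * _)).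
by apply: eq_big_nat => i ih; rewrite rmorphB sX_high ?s_y //; lia.
Qed.

Lemma sdd_invl k f g : (k <= N)%N -> inv_from W 0 f -> sdd W k (f * g) = f * sdd W k g.
Proof.
move=> kN If; rewrite /sdd; case: ifP => _; rewrite d_invl ?mulrN //; exact: If.
Qed.

Lemma foldr_sdd_invl a f g : letters n a -> inv_from W 0 f ->
  foldr (sdd W) (f * g) a = f * foldr (sdd W) g a.
Proof.
move=> + If; elim: a => //= i a IH /andP[iN /IH ->].
by rewrite sdd_invl.
Qed.

(** The divided difference is 1 on the last factor of the column. *)
Lemma sdd_column h j S : (0 < h <= N)%N -> s h S = S ->
  sdd W h (column h j * S) = - (column h.-1 j * S).
Proof.
move=> hN sS; have h0 : (0 < h)%N by lia.
rewrite /sdd gtn_eqF //; congr (- _).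
have -> : column h j = column h.-1 j * (X h.-1 - y j).
  by rewrite /column -{1}(prednK h0) big_nat_recr.
have cs : s h (column h.-1 j) = column h.-1 j by apply: column_inv; lia.
rewrite mulrAC d_invl ?rmorphM ?cs ?sS //; last by lia.
suff <- : 1 = d h (X h.-1 - y j) by rewrite mulr1.
apply: d_unique; first by lia.
rewrite rmorphB s_y ?sXl // ?mulr1; last by lia.
by case: (h) h0 => // h1 _ /=; ring.
Qed.

Lemma foldr_column c l j S : (c + l <= N)%N ->
  (forall h, (c < h <= c + l)%N -> s h S = S) ->
  foldr (sdd W) (column (c + l) j * S) (iota c.+1 l) = (-1) ^+ l * (column c j * S).
Proof.
elim: l c => [|l IH] c clN sS; first by rewrite addn0 mul1r.
rewrite /= -addSnnS IH; [|lia|by move=> h hc; apply: sS; lia].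
rewrite sdd_invl; [|lia|exact: inv_from_sign].
by rewrite sdd_column ?sS ?exprS ?mulN1r ?mulNr ?mulrN //; lia.
Qed.

Section Columns.
Variables (Q : pred nat) (S : R).
Hypothesis S_inv : inv_from W 1 S.

(** The height of the column j after m insertions: that of m' + 1 shortens the column
    N - m', from m' boxes to the number of values up to m' that satisfy [Q]. *)
Definition height m j : nat := if (j < n - m)%N then (N - j)%N else count_upto Q (N - j).

(** Letter by letter, a column loses its last box.  The other columns are never of the
    height that the letter acts on, so they pass through the operators. *)
Lemma foldr_insertion_word m : (m <= n)%N ->
  foldr (sdd W) (\prod_(j < n) column (N - j) j * S) (insertion_word Q m) =
  (-1) ^+ size (insertion_word Q m) * (\prod_(j < n) column (height m j) j * S).
Proof.
elim: m => [|m IH] mn.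
  rewrite mul1r /=; congr (_ * _); apply: eq_bigr => j _.
  by rewrite /height subn0 ltn_ord.
rewrite /= foldr_cat IH ?(ltnW mn) // size_cat size_iota.
have cm := count_upto_max Q m.
rewrite foldr_sdd_invl; [| |exact: inv_from_sign]; last first.
  by apply/allP => i; rewrite mem_iota; lia.
have j0n : (N - m < n)%N by lia.
(* The column shortened by this step. *)
pose j0 := Ordinal j0n.
have h0 : height m j0 = (count_upto Q m + (m - count_upto Q m))%N.
  by rewrite /height /=; case: ifP; lia.
rewrite (bigD1 j0) //= -mulrA h0 foldr_column; last first.
- move=> h hc; rewrite rmorphM S_inv; last by lia.
  congr (_ * _); rewrite rmorph_prod; apply: eq_bigr => j; rewrite -val_eqE /= => jj0.
  have jn := ltn_ord j.
  rewrite column_inv //; [lia| |].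
    by rewrite /height; case: ifP => _; have := count_upto_max Q (N - j); lia.
  rewrite /height; case: ltnP => jm; first by lia.
  have : (count_upto Q (N - j) <= count_upto Q m)%N by apply: count_upto_le; lia.
  lia.
- by lia.
rewrite [LHS]mulrA -exprD addnC; congr (_ * _).
rewrite [in RHS](bigD1 j0) //= -mulrA; congr (column _ _ * (_ * _)).
  by rewrite /height; case: ltnP => [|_]; [lia|congr count_upto; lia].
apply: eq_bigr => j; rewrite -val_eqE /= => jj0; congr column.
by rewrite /height; case: ltnP => jm; case: ltnP => jm'; lia.
Qed.

End Columns.

(** The same boxes read by rows: the box (i, j) is present if and only if j is less
    than n minus the i-th smallest value satisfying [Q]. *)
Lemma prod_column_rows Q : let P := [seq x <- rho n | Q x] in
  \prod_(j < n) column (count_upto Q (N - j)) j =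
  \prod_(i < size P) \prod_(c <- take (n - nth 0%N P i) (Ysq N y)) (X (size P - i.+1) - c).
Proof.
move=> P; set k := size P.
have sP : sorted gtn P by apply: sorted_filter; [exact: gtn_trans|exact: sorted_rho].
transitivity (\prod_(j < n) \prod_(i < k | (i < count_upto Q (N - j))%N) (X i - y j)).
  apply: eq_bigr => j _; rewrite /column big_mkord.
  have cj : (count_upto Q (N - j) <= k)%N.
    have := @count_upto_compl Q n (N - j); rewrite -/P -/k; lia.
  by rewrite (big_ord_widen_cond k xpredT (fun i => X i - y j) cj).
rewrite (exchange_big_dep xpredT) //= (reindex_inj rev_ord_inj) /=.
apply: eq_bigr => i _; rewrite take_Ysq ?leq_subr // big_map.
have -> : iota 0 (n - nth 0%N P i) = index_iota 0 (n - nth 0%N P i) by rewrite /index_iota subn0.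
rewrite big_mkord (big_ord_widen_cond n xpredT (fun j => X (k - i.+1) - y j)) ?leq_subr //=.
apply: eq_bigl => j; have ik := ltn_ord i; have jn := ltn_ord j.
have := @count_upto_compl Q n (N - j); rewrite -/P -/k => /(_ (leq_trans (leq_subr _ _) (leqnSn _))) E.
have F := gtn_sorted_ltn_nth (N - j) i sP; move: E F; set c := count _ _ => E F.
have Pn : (nth 0 P i <= n)%N.
  have /(mem_subseq (filter_subseq _ _)) : nth 0%N P i \in P by exact: mem_nth.
  by rewrite mem_rho => /andP[].
lia.
Qed.

Definition Delta : R := \prod_(i < n) \prod_(j < n | (i.+1 + j.+1 <= n)%N) (X i - y j).

Lemma Delta_columns : Delta = \prod_(j < n) column (N - j) j.
Proof.
rewrite /Delta (exchange_big_dep xpredT) //=; apply: eq_bigr => j _.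
rewrite /column big_mkord (big_ord_widen_cond n xpredT (fun i => X i - y j)) /=; last by lia.
by apply: eq_bigl => i; have := ltn_ord i; have := ltn_ord j; lia.
Qed.

Lemma foldr_cycles k f : foldr (sdd W) f (flatten (nseq k (cycle_word n))) = iter k (scyc W) f.
Proof. by elim: k f => //= k IH f; rewrite foldr_cat IH. Qed.

Lemma foldr_colongest_word lam : lam \in strictD n ->
  (-1) ^+ (n * n.-1)./2 * foldr (sdd W) (Delta * Qt_kernel W y) (colongest_word n lam) =
  (-1) ^+ (excess lam + sumn (pcompl n lam)) *
  \sum_(alpha <- strictD n)
    Qt (Xsq W) alpha *
    \sum_(beta <- strictD n |
            [&& pcontained (pcompl n lam) beta,
                size beta == size (pcompl n lam) &
                pdisjoint alpha beta])
      (-1) ^+ (excess2 alpha beta + sumn beta) *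
      Qt (Ysq N y) (pcompl n (pcup alpha beta)) *
      \det (\matrix_(i < size (pcompl n lam), j < size (pcompl n lam))
              elem_sym (take (n - nth 0%N (pcompl n lam) j) (Ysq N y))
                   ((nth 0%N beta i)%:Z - (nth 0%N (pcompl n lam) j)%:Z)).
Proof.
move=> lD; set P := pcompl n lam; set k := size P; set M := (n * n.-1)./2.
have PD : P \in strictD n by exact: pcompl_strictD.
pose w := size (insertion_word (fun p => p \notin lam) n).
rewrite /colongest_word foldr_cat Delta_columns foldr_insertion_word //; last exact: Qt_kernel_inv.
rewrite -/w foldr_cycles iter_scyc_invl; last exact: inv_from_sign.
have -> : \prod_(j < n) column (height (fun p => p \notin lam) n j) j =
    \prod_(i < k) \prod_(c <- take (n - nth 0%N P i) (Ysq N y)) (X (k - i.+1) - c).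
  rewrite -(prod_column_rows (fun p => p \notin lam)); apply: eq_bigr => j _.
  by rewrite /height subnn.
rewrite iter_scyc_prod // mulrA -exprD.
pose E beta := \det (\matrix_(i < k, j < k)
   elem_sym (take (n - nth 0%N P j) (Ysq N y)) ((nth 0%N beta i)%:Z - (nth 0%N P j)%:Z)).
pose G alpha beta := Qt (Xsq W) alpha * ((-1) ^+ (excess2 alpha beta + sumn beta) *
      Qt (Ysq N y) (pcompl n (pcup alpha beta)) * E beta).
have Ew : (w + k * n = 'C(n, 2) + sumn P)%N.
  have := size_insertion_word (fun p => p \notin lam) n; rewrite -/w.
  have -> : count_upto (fun p => p \notin lam) n = k.
    by rewrite /k /P /pcompl size_filter /rho count_rev.
  by rewrite -sumn_rev -filter_rev.
have sgn := sign_parity lD Ew; rewrite -/P -/k -/M in sgn.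
transitivity (\sum_(beta <- strictD n | size beta == k)
  \sum_(alpha <- strictD n | pdisjoint alpha beta)
  (-1) ^+ (excess lam + sumn P) * G alpha beta).
  rewrite big_distrr big_seq_cond [RHS]big_seq_cond /=; apply: eq_bigr => beta.
  case/andP=> bD /eqP szb; rewrite -[X in iter X _ _]szb iter_scyc_Qt_kernel // szb.
  rewrite -/(E beta) [LHS]mulrA big_distrr /=; apply: eq_bigr => alpha _; rewrite /G.
  have -> : (-1) ^+ (excess lam + sumn P) = (-1) ^+ (M + w + 'C(k, 2)) * (-1) ^+ sumn P :> R.
    by rewrite exprD -[(-1) ^+ excess lam]signr_odd -sgn signr_odd.
  rewrite -/P -/k !exprD; ring.
transitivity (\sum_(beta <- strictD n | size beta == k)
  \sum_(alpha <- strictD n | pdisjoint alpha beta)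
  (if pcontained P beta then (-1) ^+ (excess lam + sumn P) * G alpha beta else 0)).
  rewrite big_seq_cond [RHS]big_seq_cond; apply: eq_bigr => beta /andP[bD szb].
  apply: eq_bigr => alpha _; case: ifP => // /negbT nc; rewrite /G.
  have -> : E beta = 0; last by rewrite !mulr0.
  apply: (@det_not_contained _ n k P beta
    (fun p b => elem_sym (take (n - p) (Ysq N y)) (b%:Z - p%:Z))) => // p b bp.
  by apply: elem_symN; lia.
rewrite (exchange_big_dep xpredT) //= big_distrr /=; apply: eq_bigr => alpha _.
rewrite !big_distrr /= big_mkcond [RHS]big_mkcond; apply: eq_bigr => beta _.
by case: (pcontained P beta); case: (size beta == k); case: (pdisjoint alpha beta).
Qed.

End Delta.

(** * One-line notation and reduced words *)

Section OneLine.
Variable n : nat.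
Implicit Types (w u v : {perm (sgnval n)}).

Lemma size_one_line w : size (one_line w) = n.
Proof. by rewrite size_map size_enum_ord. Qed.

Lemma nth_one_line w (k : 'I_n) : nth 0 (one_line w) k = sgnval_int (w (k, false)).
Proof. by rewrite (nth_map k) ?size_enum_ord // nth_ord_enum. Qed.

Lemma sgnval_int_inj : injective (@sgnval_int n).
Proof.
move=> [k b] [l c]; rewrite /sgnval_int /= => E.
have kl : k = l.
  have : absz ((-1) ^+ b * k.+1%:Z) = absz ((-1) ^+ c * l.+1%:Z) by rewrite E.
  by rewrite !abszM !abszX /= !exp1n !mul1n => -[] /val_inj.
by move: E; rewrite kl; case: b; case: c => //=; rewrite ?expr0 ?expr1; lia.
Qed.

Lemma one_line_inj u v : u \in signed_perms n -> v \in signed_perms n ->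
  one_line u = one_line v -> u = v.
Proof.
move=> uS vS E; have E0 k : u (k, false) = v (k, false).
  by apply: sgnval_int_inj; rewrite -!nth_one_line E.
apply/permP => -[k []]; last exact: E0.
by rewrite -[true]/(~~ false) (signed_permsN uS) (signed_permsN vS) E0.
Qed.

Lemma sgnval_intN w (k : 'I_n) : w \in signed_perms n ->
  sgnval_int (w (k, true)) = - sgnval_int (w (k, false)).
Proof.
move=> wS; rewrite -[true]/(~~ false) (signed_permsN wS) /sgnval_int /=.
by case: (w (k, false)).2; rewrite /= ?expr0 ?expr1 ?mul1r ?mulN1r ?opprK.
Qed.

Lemma one_line_sgen (i : 'I_n) w : w \in signed_perms n ->
  one_line (sgen i * w)%g = letter_act i (one_line w).
Proof.
move=> wS; apply: (@eq_from_nth _ 0); rewrite ?size_letter_act !size_one_line // => k kn.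
pose k' := Ordinal kn; rewrite -[k]/(val k') nth_one_line permM permE /sgen_fun /=.
have i_n := ltn_ord i; case: eqP => i0.
  rewrite i0 /=; have n0 : (0 < n)%N by lia.
  have hd := nth_one_line w (Ordinal n0); have nk := nth_one_line w k'.
  have ki : (k' == i) = (k == 0%N) by rewrite -val_eqE /= i0.
  rewrite ki; have := size_one_line w; case: (one_line w) hd nk => [|x t] /= hd nk sz.
    by have := leq_trans n0 (eq_leq (esym sz)).
  case: (posnP k) => k0.
    have -> : nth 0 (- x :: t) k = - x by rewrite k0.
    rewrite /= sgnval_intN // hd; congr (- sgnval_int (w (_, _))).
    by apply: val_inj; rewrite /= k0.
  have -> : nth 0 (- x :: t) k = nth 0 (x :: t) k by case: (k) k0.
  by rewrite -[k in nth _ _ k]/(val k') nk.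
case im: (nat_of_ord i) i0 => [|m] // _; rewrite /letter_act.
have mn : (m.+1 < n)%N by rewrite -im.
rewrite nth_swap_at ?size_one_line //.
have [a Ea] : exists a : 'I_n, a = (if k == m then m.+1 else if k == m.+1 then m else k) :> nat.
  have lt : ((if k == m then m.+1 else if k == m.+1 then m else k) < n)%N.
    by case: eqP => _ //; case: eqP => _ //; exact: ltnW.
  by exists (Ordinal lt).
rewrite -Ea nth_one_line; congr (sgnval_int (w (_, _))); apply: val_inj; apply: etrans (esym Ea).
rewrite -[k]/(val k'); case: tpermP => [->|->|/eqP ki /eqP kj] /=.
- by rewrite im /= eqxx.
- by rewrite im gtn_eqF // eqxx.
by move: ki kj; rewrite -!val_eqE /= im /= => /negbTE -> /negbTE ->.
Qed.

(** Adding a letter in front multiplies the inverse on the right, that is, acts on the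
    positions of its one-line notation. *)
Lemma word_elt_inv (a : seq 'I_n) :
  (word_elt a)^-1%g \in signed_perms n /\
  one_line (word_elt a)^-1%g = word_act (map val a) (id_list n).
Proof.
elim: a => [|i a [IH1 IH2]] /=.
  rewrite invg1; split; first by rewrite inE; apply/forallP => k; rewrite !perm1.
  apply: (@eq_from_nth _ 0); rewrite size_one_line ?size_map ?size_iota // => k kn.
  rewrite -[k]/(val (Ordinal kn)) nth_one_line perm1 /sgnval_int /= mul1r.
  by rewrite (nth_map 0%N) ?size_iota // nth_iota // add1n.
have sV : (sgen i)^-1%g = sgen i.
  apply/eqP; rewrite eq_invg_mul; apply/eqP/permP => v.
  by rewrite permM !permE sgen_funK.
by rewrite invMg sV signed_permsM // one_line_sgen // IH2.
Qed.

(** A word whose size is [inv_count] has minimal length among the words of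
    its element, so all words of minimal length have this size. *)
Lemma reduced_wordE w (a b : seq 'I_n) : reduced_word w a -> word_elt b = w ->
  reducedl n (map val b) -> reducedl n (map val a) /\
  word_act (map val a) (id_list n) = word_act (map val b) (id_list n).
Proof.
case=> aw amin bw rb.
have E : word_act (map val a) (id_list n) = word_act (map val b) (id_list n).
  have [_ <-] := word_elt_inv a; have [_ <-] := word_elt_inv b.
  by rewrite aw bw.
split=> //; have la (c : seq 'I_n) : letters n (map val c).
  by apply/allP => x /mapP[i _ ->]; exact: ltn_ord.
rewrite /reducedl la eqn_leq inv_count_word_act // andbT E.
by case/andP: rb => _ /eqP <-; rewrite !size_map; exact: amin.
Qed.

Lemma one_line_colongest lam : lam \in strictD n ->
  (colongest (wmax n lam))^-1%g \in signed_perms n /\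
  one_line (colongest (wmax n lam))^-1%g =
    [seq p%:Z | p <- lam] ++ [seq - p%:Z | p <- rev (pcompl n lam)].
Proof.
move=> lD; have [wS wE] := wmaxP lD.
have LV : (longest n)^-1%g = longest n.
  apply/eqP; rewrite eq_invg_mul; apply/eqP/permP => v.
  by rewrite permM !permE longest_funK.
rewrite /colongest invMg invgK LV; split.
  rewrite inE; apply/forallP => k; rewrite !permM !permE /=.
  by rewrite -[true]/(~~ false) (signed_permsN wS) /= eqxx.
have -> : one_line (wmax n lam * longest n)%g = map -%R (one_line (wmax n lam)).
  rewrite /one_line -[RHS]map_comp; apply/eq_in_map => k _ /=.
  rewrite permM permE /sgnval_int /=; case: (_.2); rewrite /= ?expr0 ?expr1; lia.
have E : map -%R [seq - p%:Z | p <- lam] = [seq p%:Z | p <- lam].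
  by rewrite -map_comp; apply: eq_map => p /=; rewrite opprK.
by rewrite wE map_cat E -map_comp.
Qed.

End OneLine.

(** The letters of the sort and of the cycles all raise the length, so their number is
    the length of the element. *)
Lemma colongest_wordP n lam : lam \in strictD n ->
  reducedl n (colongest_word n lam) /\
  word_act (colongest_word n lam) (id_list n) =
    [seq p%:Z | p <- lam] ++ [seq - p%:Z | p <- rev (pcompl n lam)].
Proof.
move=> lD; have [I1 I2] := @insertion_stateP (fun p => p \notin lam) n n (leqnn n).
set P := pcompl n lam; move: (pcompl_strictD n lam); rewrite -/P strictDE => /andP[sP PN].
have St : insertion_state (fun p => p \notin lam) n n =
    [seq p%:Z | p <- rev P] ++ [seq p%:Z | p <- lam].
  rewrite /insertion_state subnn cats0 /P /pcompl /rho filter_rev revK; congr (_ ++ map _ _).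
  rewrite -filter_rev -[in RHS](strictD_filter_rho lD); apply: eq_filter => x.
  by rewrite /= negbK.
have := lD; rewrite strictDE => /andP[sl lN].
have [||||E1 E2] := @word_act_cycles (rev P) [seq p%:Z | p <- lam] n.
- by rewrite rev_sorted.
- by rewrite all_rev; apply: sub_all PN => x /andP[].
- by rewrite all_map; apply: sub_all lN => x /andP[].
- by have := perm_size (perm_pcompl lD); rewrite size_cat size_rho size_rev size_map addnC.
rewrite size_rev in E1 E2.
have E : word_act (colongest_word n lam) (id_list n) =
    [seq p%:Z | p <- lam] ++ [seq - p%:Z | p <- rev P].
  by rewrite /colongest_word word_act_cat I1 St E1.
split=> //; rewrite /reducedl E E2 -St I2; apply/andP; split.
  rewrite /letters /colongest_word all_cat; apply/andP; split.
    apply/allP => x /flattenP[c /nseqP[-> _]]; rewrite mem_rev mem_iota; lia.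
  exact: letters_insertion_word.
rewrite /colongest_word size_cat; apply/eqP; congr (_ + _)%N.
rewrite -/P; elim: (size P) => //= k IH.
by rewrite size_cat size_rev size_iota IH mulSn.
Qed.

(** * The action on polynomials *)

HB.instance Definition _ n (i : 'I_n) :=
  GRing.isZmodMorphism.Build _ _ (@sact n i) (fun f g => raddfB _ f g).
HB.instance Definition _ n (i : 'I_n) :=
  GRing.isMonoidMorphism.Build _ _ (@sact n i) (@sact1 n i, @sactM n i).

Local Ltac swapn_cases :=
  rewrite /swapn;
  repeat match goal with |- context [?a == ?b] =>
    lazymatch a with
    | context [if _ then _ else _] => fail
    | _ => case: (@eqP _ a b) => ?
    end end; lia.

Section ReflectionsOnVariables.
Variables (R : nzRingType) (N : nat) (X : nat -> R) (s : nat -> R -> R).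
Hypothesis sN : forall k x, s k (- x) = - s k x.
Hypothesis sX : forall k j, (k <= N)%N -> (j <= N)%N -> s k (X j) =
  if k == 0%N then (if j == 0%N then - X 0 else X j) else X (swapn k j).

Lemma swapn_le k j : (0 < k <= N)%N -> (j <= N)%N -> (swapn k j <= N)%N.
Proof. by move=> kN jN; rewrite /swapn; case: eqP => _; [|case: eqP => _]; lia. Qed.

Lemma sXK k j : (k <= N)%N -> (j <= N)%N -> s k (s k (X j)) = X j.
Proof.
move=> kN jN; rewrite (sX kN jN); case: (eqVneq k 0%N) => [k0|k0].
  case: (eqVneq j 0%N) => [->|j0]; last by rewrite sX // k0 (negbTE j0).
  by rewrite sN sX // k0 opprK.
have sk : (swapn k j <= N)%N by apply: swapn_le; lia.
by rewrite sX // (negbTE k0); congr X; swapn_cases.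
Qed.

Lemma sX2 k l j : (k.+1 < l)%N -> (l <= N)%N -> (j <= N)%N ->
  s k (s l (X j)) = s l (s k (X j)).
Proof.
move=> kl lN jN; have kN : (k <= N)%N by lia.
have l0 : (l == 0%N) = false by lia.
have sl : (swapn l j <= N)%N by apply: swapn_le; lia.
rewrite (sX lN jN) l0 (sX kN sl) (sX kN jN).
case: (eqVneq k 0%N) => k0.
  have -> : (swapn l j == 0%N) = (j == 0%N) by apply/eqP/eqP; swapn_cases.
  case: (eqVneq j 0%N) => [_|_]; last by rewrite (sX lN jN) l0.
  by rewrite sN (sX lN (leq0n N)) l0; congr (- X _); swapn_cases.
have sk : (swapn k j <= N)%N by apply: swapn_le; lia.
by rewrite (sX lN sk) l0; congr X; swapn_cases.
Qed.

Lemma sX3 k j : (0 < k < N)%N -> (j <= N)%N ->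
  s k (s k.+1 (s k (X j))) = s k.+1 (s k (s k.+1 (X j))).
Proof.
move=> kN jN; have H a i : (0 < a <= N)%N -> (i <= N)%N -> s a (X i) = X (swapn a i).
  by move=> aN iN; rewrite sX ?gtn_eqF //; lia.
rewrite !H ?swapn_le //; try lia.
by congr X; swapn_cases.
Qed.

Lemma sX4 j : (0 < N)%N -> (j <= N)%N ->
  s 0 (s 1 (s 0 (s 1 (X j)))) = s 1 (s 0 (s 1 (s 0 (X j)))).
Proof.
move=> N0 jN.
have s00 : s 0%N (X 0%N) = - X 0%N by rewrite sX.
have s01 : s 0%N (X 1%N) = X 1%N by rewrite sX.
have s10 : s 1%N (X 0%N) = X 1%N by rewrite sX.
have s11 : s 1%N (X 1%N) = X 0%N by rewrite sX.
case: j jN => [|[|j]] jN.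
- by rewrite !(s00, s01, s10, s11, sN).
- by rewrite !(s00, s01, s10, s11, sN).
have t0 : s 0%N (X j.+2) = X j.+2 by rewrite sX.
have t1 : s 1%N (X j.+2) = X j.+2 by rewrite sX.
by rewrite !(t0, t1).
Qed.

End ReflectionsOnVariables.

Section PolynomialAction.
Variable N : nat.
Local Notation n := N.+1.

Definition Xn (j : nat) : PolXY n := xvar (inord j).
Definition Yn (j : nat) : PolXY n := yvar (inord j).
Definition sn (k : nat) : PolXY n -> PolXY n := sact (inord k).
Definition dn (k : nat) : PolXY n -> PolXY n := dd (inord k).

Lemma opred_inord k : (0 < k <= N)%N -> opred (inord k : 'I_n) = inord k.-1.
Proof. by move=> kN; apply: val_inj; rewrite /= !inordK //; lia. Qed.

Lemma sn0 j : (j <= N)%N -> sn 0 (Xn j) = if j == 0%N then - Xn 0 else Xn j.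
Proof.
move=> jN; rewrite /sn /Xn sactX inordK //= -val_eqE /= !inordK //.
by case: eqP => [->|].
Qed.

Lemma snX k j : (0 < k <= N)%N -> (j <= N)%N -> sn k (Xn j) = Xn (swapn k j).
Proof.
move=> kN jN; have kN' : (k < n)%N by lia.
rewrite /sn /Xn sactX inordK // gtn_eqF; last by lia.
congr xvar; rewrite opred_inord // /swapn.
have inE a b : (a <= N)%N -> (b <= N)%N -> (inord a == inord b :> 'I_n) = (a == b).
  by move=> aN bN; rewrite -val_eqE /= !inordK.
case: tpermP => [/eqP|/eqP|/eqP + /eqP]; rewrite ?inE; try lia.
- by move=> ->.
- by move=> jk; rewrite jk; case: eqP => // E; congr inord; lia.
- by move=> /negbTE -> /negbTE ->.
Qed.

(** A composite of reflections is a ring morphism that fixes the constants, so it is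
    determined by the images of the variables. *)
Lemma sn_word_ext (a b : seq nat) f :
  (forall j, (j <= N)%N -> foldr sn (Xn j) a = foldr sn (Xn j) b) ->
  foldr sn f a = foldr sn f b.
Proof.
move=> EX; pose P (f : PolXY n) := foldr sn f a = foldr sn f b.
have wC c (w : seq nat) : foldr sn c%:MP w = c%:MP.
  by elim: w => //= k w ->; exact: sactC.
have wD f1 f2 (w : seq nat) : foldr sn (f1 + f2) w = foldr sn f1 w + foldr sn f2 w.
  by elim: w => //= k w ->; exact: sactD.
have wM f1 f2 (w : seq nat) : foldr sn (f1 * f2) w = foldr sn f1 w * foldr sn f2 w.
  by elim: w => //= k w ->; exact: sactM.
have PC c : P c%:MP by rewrite /P !wC.
have PM f1 f2 : P f1 -> P f2 -> P (f1 * f2) by rewrite /P !wM => -> ->.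
have PX j : P (xvar j) by have := EX j (ltn_ord j); rewrite /Xn inord_val.
suff H h : P h by exact: (H f).
rewrite [h]mpolyE; apply: (big_ind P) => [|f1 f2|m _].
- exact: (PC 0).
- by rewrite /P !wD => -> ->.
rewrite -mul_mpolyC mpolyXE_id; apply: (PM); first exact: PC.
apply: (big_ind P) => [||j _]; [exact: (PC 1)|exact: PM|].
elim: (m j) => [|e IH]; first exact: (PC 1).
by rewrite exprS; exact: (PM _ _ (PX j) IH).
Qed.

Lemma snE k j : (k <= N)%N -> (j <= N)%N ->
  sn k (Xn j) = if k == 0%N then (if j == 0%N then - Xn 0 else Xn j) else Xn (swapn k j).
Proof.
move=> kN jN; case: eqP => [->|k0]; first exact: sn0.
by apply: snX => //; lia.
Qed.

Lemma snN k f : sn k (- f) = - sn k f.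
Proof. exact: raddfN. Qed.

Lemma snK k f : (k <= N)%N -> sn k (sn k f) = f.
Proof.
by move=> kN; apply: (@sn_word_ext [:: k; k] [::]) => j; exact: (sXK snN snE).
Qed.

Lemma sn2 k l f : (k <= N)%N -> (l <= N)%N -> far k l -> sn k (sn l f) = sn l (sn k f).
Proof.
wlog kl : k l / (k <= l)%N.
  by move=> H kN lN kl; case: (leqP k l) => [/H->//|/ltnW/H->//]; rewrite /far orbC.
move=> kN lN fkl; have {fkl}kl2 : (k.+1 < l)%N by move: fkl; rewrite /far; lia.
by apply: (@sn_word_ext [:: k; l] [:: l; k]) => j; exact: (sX2 snN snE).
Qed.

Lemma sn3 k f : (0 < k < N)%N -> sn k (sn k.+1 (sn k f)) = sn k.+1 (sn k (sn k.+1 f)).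
Proof.
move=> kN; apply: (@sn_word_ext [:: k; k.+1; k] [:: k.+1; k; k.+1]) => j.
exact: (sX3 snE kN).
Qed.

Lemma sn4 f : (0 < N)%N -> sn 0 (sn 1 (sn 0 (sn 1 f))) = sn 1 (sn 0 (sn 1 (sn 0 f))).
Proof.
move=> N0; apply: (@sn_word_ext [:: 0; 1; 0; 1]%N [:: 1; 0; 1; 0]%N) => j.
exact: (sX4 snN snE N0).
Qed.

Lemma dn0 f : 2%:R * Xn 0 * dn 0 f = f - sn 0 f.
Proof. by rewrite -ddE /ddden inordK. Qed.

Lemma dnE k f : (0 < k <= N)%N -> (Xn k.-1 - Xn k) * dn k f = f - sn k f.
Proof.
by move=> kN; rewrite -ddE /ddden inordK ?gtn_eqF ?opred_inord //; lia.
Qed.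

Lemma Xn_coef i j : (i <= N)%N -> (j <= N)%N ->
  (Xn i)@_(U_(inord j)%MM) = (i == j)%:R.
Proof. by move=> iN jN; rewrite mcoeffXU -val_eqE /= !inordK. Qed.

Lemma Xn2 j : (j <= N)%N -> 2%:R * Xn j != 0.
Proof.
move=> jN; apply/eqP => /(congr1 (fun p : PolXY n => p@_(U_(inord j)%MM))) /eqP.
rewrite mulr_natl mcoeffMn Xn_coef // eqxx mcoeff0 -mpolyC1 -mpolyCMn mpolyC_eq0.
by [].
Qed.

Lemma XnB i j : (i < j <= N)%N -> Xn i - Xn j != 0.
Proof.
move=> ij; apply/eqP => /(congr1 (fun p : PolXY n => p@_(U_(inord j)%MM))) /eqP.
rewrite mcoeffB !Xn_coef; [|lia..].
by rewrite eqxx ltn_eqF ?mcoeff0 ?sub0r ?oppr_eq0 ?oner_eq0 //; lia.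
Qed.

Lemma XnD i j : (i < j <= N)%N -> Xn i + Xn j != 0.
Proof.
move=> ij; apply/eqP => /(congr1 (fun p : PolXY n => p@_(U_(inord j)%MM))) /eqP.
rewrite mcoeffD !Xn_coef; [|lia..].
by rewrite eqxx ltn_eqF ?mcoeff0 ?add0r ?oner_eq0 //; lia.
Qed.

(** Fixes one choice of the structure of integral domain, by which the operations of
    the ring are found below. *)
Definition PolXY_idomain : idomainType := {mpoly {mpoly int[n]}[n]}.
Definition snP (k : nat) : {rmorphism PolXY_idomain -> PolXY_idomain}.
(* The two sides are convertible; they differ only in the path by which the
   operations of the ring are found. *)
Proof. exact_no_check (sact (inord k) : {rmorphism PolXY n -> PolXY n}). Defined.

Definition PolXY_action : typeB_action PolXY_idomain N.
Proof.
refine (@TypeBAction PolXY_idomain N (Xn : nat -> PolXY_idomain) snP (dn : nat -> PolXY_idomain -> PolXY_idomain)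
  _ _ _ _ _ _ _ _ _ _ _).
(* Each law is the corresponding one of the polynomial ring, up to conversion of the
   paths by which the operations are found. *)
- exact_no_check Xn2.
- exact_no_check XnB.
- exact_no_check XnD.
- exact_no_check sn0.
- exact_no_check snX.
- exact_no_check snK.
- exact_no_check sn2.
- exact_no_check sn3.
- exact_no_check sn4.
- exact_no_check dn0.
- exact_no_check dnE.
Defined.

End PolynomialAction.

(** * Double Schubert polynomials *)

Section SchubertPolynomial.
Variable N : nat.
Local Notation n := N.+1.

Lemma dv_PolXY_action k : dv (PolXY_action N) k = @dn N k. Proof. by []. Qed.
Lemma xv_PolXY_action k : xv (PolXY_action N) k = @Xn N k. Proof. by []. Qed.
Lemma sv_PolXY_action k f : sv (PolXY_action N) k f = @sn N k f. Proof. by []. Qed.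

Opaque PolXY_action.

Lemma dd'_wordE (a : seq 'I_n) (f : PolXY n) :
  dd'_word a f = foldr (sdd (PolXY_action N)) f (map val a).
Proof.
elim: a => [|i a IH]; first by [].
transitivity (sdd (PolXY_action N) i (foldr (sdd (PolXY_action N)) f (map val a))); last by [].
rewrite [dd'_word _ _]/(dd' i (dd'_word a f)) IH.
rewrite /dd' /sdd dv_PolXY_action /dn inord_val; reflexivity.
Qed.

(** The reduced word chosen in the definition is unknown, but the operators satisfy the
    braid relations. *)
Lemma dd'_perm_colongest lam (f : PolXY n) : lam \in strictD n ->
  dd'_perm (colongest (wmax n lam)) f = foldr (sdd (PolXY_action N)) f (colongest_word n lam).
Proof.
move=> lD; have [wS _] := wmaxP lD; have [rb Eb] := colongest_wordP lD.
have [cS cE] := one_line_colongest lD.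
pose b : seq 'I_n := map inord (colongest_word n lam).
have vb : map val b = colongest_word n lam.
  rewrite -map_comp -[RHS]map_id; apply/eq_in_map => k kb /=.
  by rewrite inordK //; move: rb => /andP[/allP/(_ k kb)].
have bw : word_elt b = colongest (wmax n lam).
  apply: invg_inj; have [bS bE] := word_elt_inv b.
  by apply: (one_line_inj bS cS); rewrite bE cE vb Eb.
have ra := epsilon_spec (inhabits [::]) (reduced_word (colongest (wmax n lam)))
  (reduced_word_exists (colongest_signed wS)).
rewrite /dd'_perm; set a := epsilon _ _ in ra *.
have [|raa E] := reduced_wordE ra bw; first by rewrite vb.
rewrite dd'_wordE; rewrite vb in E.
exact: (matsumoto (@sdd_far _ _ (PolXY_action N)) (@sdd_braid3 _ _ (PolXY_action N)) (@sdd_braid4 _ _ (PolXY_action N))).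
Qed.

Lemma XsE : Xs n = Xsq (PolXY_action N).
Proof.
rewrite /Xs /Xsq /Xfrom subn0 -val_enum_ord -map_comp; apply/eq_in_map => i _ /=.
by rewrite xv_PolXY_action /Xn inord_val.
Qed.

Lemma YsE : Ys n = Ysq N (@Yn N).
Proof.
rewrite /Ys /Ysq -val_enum_ord -map_comp; apply/eq_in_map => i _ /=.
by rewrite /Yn inord_val.
Qed.

Lemma Yn_const j : inv_from (PolXY_action N) 0 (@Yn N j).
Proof. by move=> k _; rewrite sv_PolXY_action; exact: sactC. Qed.

Lemma DeltaXYE : DeltaXY n = Delta (PolXY_action N) (@Yn N).
Proof.
transitivity (\prod_(i < n) \prod_(j < n | (i.+1 + j.+1 <= n)%N) (@Xn N i - @Yn N j)).
  by apply: eq_bigr => i _; apply: eq_bigr => j _; rewrite /Xn /Yn !inord_val.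
(* The two sides are convertible; they differ only in the path by which the
   operations of the ring are found. *)
exact_no_check (erefl (Delta (PolXY_action N) (@Yn N))).
Qed.

Lemma QtXYE : QtXY n = Qt_kernel (PolXY_action N) (@Yn N).
Proof.
(* The two sides are convertible; they differ only in the path by which the
   operations of the ring are found. *)
rewrite /QtXY XsE YsE; exact_no_check (erefl (Qt_kernel (PolXY_action N) (@Yn N))).
Qed.

End SchubertPolynomial.

Theorem theorem1 (n : nat) (hn : (1 <= n)%N)
    (lam : seq nat) (hlam : lam \in strictD n) :
  schubertC (wmax n lam) =
  (-1) ^+ (excess lam + sumn (pcompl n lam)) *
  \sum_(alpha <- strictD n)
    Qt (Xs n) alpha *
    \sum_(beta <- strictD n |
            [&& pcontained (pcompl n lam) beta,
                size beta == size (pcompl n lam) &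
                pdisjoint alpha beta])
      (-1) ^+ (excess2 alpha beta + sumn beta) *
      Qt (Ys n) (pcompl n (pcup alpha beta)) *
      \det (\matrix_(i < size (pcompl n lam), j < size (pcompl n lam))
              elem_sym (take (n - nth 0%N (pcompl n lam) j) (Ys n))
                   ((nth 0%N beta i)%:Z - (nth 0%N (pcompl n lam) j)%:Z)).
Proof.
case: n hn hlam => // N _ lD.
rewrite /schubertC dd'_perm_colongest // DeltaXYE QtXYE XsE YsE.
(* The two sides are convertible; they differ only in the path by which the
   operations of the ring are found. *)
exact_no_check (foldr_colongest_word (@Yn_const N) lD).
Qed.
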